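(* Let $B=\{B_t, t\in[0,1]\}$ be a standard Brownian motion with natural filtration $(\mathcal{F}_t)$. Let $(\phi_n)_{n\ge1}$ be a sequence of bounded nonnegative functions on $[0,1]$ such that: (1) there are a sequence $\alpha_n\uparrow 1$ and a constant $L>0$ with $$\lim_{n\to\infty}\int_{\alpha_n}^1\phi_n^2(t)\,dt=\lim_{n\to\infty}\int_0^1\phi_n^2(t)\,dt=L;$$ (2) for any $\delta\in[0,1)$, $\sup_{0\le t\le\delta}\phi_n(t)\to0$ as $n\to\infty$. Let $u=\{u_t,t\in[0,1]\}$ be a progressively measurable process such that $\int_0^1E(u_t^2)\,dt<\infty$, and suppose that $u$ is continuous in $L^2(\Omega)$ at $t=1$. Then the sequence of Itô integrals $$F_n=\int_0^1\phi_n(t)u_t\,dB_t,\qquad n\ge1,$$ converges stably, as $n\to\infty$, to $\sqrt{L}\,u_1Z$, where $Z$ is a $N(0,1)$ random variable independent of the process $B$.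
   Context: The Brownian motion $B$ is defined on a probability space $(\Omega,\mathcal{F},P)$, where $\mathcal{F}$ is the $P$-completion of the $\sigma$-field generated by $B$. Stable convergence: random variables $F_n$ on $(\Omega,\mathcal{F},P)$ with values in $\mathbb{R}^d$ converge stably to an $\mathbb{R}^d$-valued random variable $F$, defined on some extended probability space $(\Omega',\mathcal{F}',P')$, if $$\lim_{n\to\infty}E\left[Ye^{i\langle\lambda,F_n\rangle_{\mathbb{R}^d}}\right]=E'\left[Ye^{i\langle\lambda,F\rangle_{\mathbb{R}^d}}\right]$$ for every $\lambda\in\mathbb{R}^d$ and every bounded $\mathcal{F}$-measurable random variable $Y$. The variable $Z$ lives on such an extension. *)

(* Defs.v *)
From HB Require Import structures.
From mathcomp Require Import all_boot all_order all_algebra.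
From mathcomp Require Import all_classical all_reals all_analysis.
From mathcomp Require Import complex.

Set Implicit Arguments.
Unset Strict Implicit.
Unset Printing Implicit Defensive.

Import Order.TTheory GRing.Theory Num.Theory.
Import numFieldNormedType.Exports.

Local Open Scope classical_set_scope.
Local Open Scope ring_scope.

(* Processes with time set [0, 1] are functions R -> T -> R of which only the
   values at times in [0, 1] are ever used. *)

(* R[i] packaged as a numFieldType, whence it gets the topology of its
   modulus. *)
Definition Cfield (R : realType) : numFieldType := R[i].

Section Processes.
Context {R : realType} {d : measure_display} {T : measurableType d}.
Variable P : probability T R.

Definition has_law (X : T -> R) (m : set R -> \bar R) : Prop :=
  forall A : set R, measurable A -> P (X @^-1` A) = m A.

(* The product rule over the full family gives that over every subfamily:
   take A i = setT for the other indices. *)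
Definition mutually_independent (n : nat) (X : 'I_n -> T -> R) : Prop :=
  forall A : 'I_n -> set R, (forall i, measurable (A i)) ->
    P (\bigcap_(i in [set: 'I_n]) (X i @^-1` A i)) =
    (\prod_(i < n) fine (P (X i @^-1` A i)))%:E.

(* The second parameter of normal_prob is the standard deviation. *)
Record standard_brownian_motion (B : R -> T -> R) : Prop := {
  bm_measurable : forall t : R, 0 <= t <= 1 -> measurable_fun setT (B t) ;
  bm_start : {ae P, forall w, B 0 w = 0} ;
  bm_normal_increments : forall s t : R, 0 <= s -> s < t -> t <= 1 ->
    has_law (fun w => B t w - B s w) (normal_prob 0 (Num.sqrt (t - s))) ;
  bm_independent_increments : forall (n : nat) (t : nat -> R),
    (forall i, (i <= n)%N -> 0 <= t i <= 1) ->
    (forall i, (i < n)%N -> t i <= t i.+1) ->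
    mutually_independent (fun (i : 'I_n) w => B (t i.+1) w - B (t i) w) ;
  bm_continuous_paths :
    {ae P, forall w, {within `[0, 1], continuous (fun t : R => B t w)}} }.

Definition sigma_of_process (B : R -> T -> R) (t : R) : set (set T) :=
  <<s \bigcup_(s in `[0, t]) preimage_set_system setT (B s) measurable >>.

Definition completion (G : set (set T)) : set (set T) :=
  [set A | exists C N, [/\ G C, G N, P N = 0%E &
                           (A `\` C) `|` (C `\` A) `<=` N]].

(* The sigma-field at time t includes the null sets; this admits every
   integrand that is progressive for the filtration without them. *)
Definition natural_filtration (B : R -> T -> R) (t : R) : set (set T) :=
  <<s sigma_of_process B t `|` [set N | P.-negligible N] >>.

Definition progressively_measurable
    (Ft : R -> set (set T)) (u : R -> T -> R) : Prop :=
  forall t : R, 0 <= t <= 1 ->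
    measurable_fun
      (`[0, t] `*` setT : set (R * g_sigma_algebraType (Ft t)))
      (fun p => u p.1 p.2).

Definition mean_square (X : T -> R) : \bar R :=
  ('E_P[(fun w => X w ^+ 2)%R])%E.

Record simple_process (Ft : R -> set (set T)) := SimpleProcess {
  sp_size : nat ;
  sp_time : nat -> R ;
  sp_coef : nat -> T -> R ;
  sp_time01 : forall i, (i <= sp_size)%N -> 0 <= sp_time i <= 1 ;
  sp_time_nd : forall i, (i < sp_size)%N -> sp_time i <= sp_time i.+1 ;
  sp_coef_adapted : forall i, (i < sp_size)%N ->
    measurable_fun [set: g_sigma_algebraType (Ft (sp_time i))] (sp_coef i) ;
  sp_coef_bounded : forall i, (i < sp_size)%N ->
    exists M : R, forall w, `|sp_coef i w| <= M }.

Definition sp_value (Ft : R -> set (set T)) (S : simple_process Ft)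
    (t : R) (w : T) : R :=
  \sum_(i < sp_size S)
    sp_coef S i w * \1_(`]sp_time S i, sp_time S i.+1]) t.

Definition sp_integral (Ft : R -> set (set T)) (S : simple_process Ft)
    (B : R -> T -> R) (w : T) : R :=
  \sum_(i < sp_size S)
    sp_coef S i w * (B (sp_time S i.+1) w - B (sp_time S i) w).

(* F is a version of the Ito integral of v over [0, 1]: an L^2(P) limit of the
   integrals of simple processes that tend to v in L^2(dt x P).  For B a
   Brownian motion, the Ito isometry determines F up to a P-null set. *)
Definition is_ito_integral (Ft : R -> set (set T)) (B v : R -> T -> R)
    (F : T -> R) : Prop :=
  measurable_fun setT F /\
  exists S : nat -> simple_process Ft,
    (\int[lebesgue_measure]_(t in `[0%R, 1%R])
       mean_square (fun w => sp_value (S k) t w - v t w)%R)%E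
      @[k --> \oo] --> 0%E /\
    mean_square (fun w => sp_integral (S k) B w - F w)
      @[k --> \oo] --> 0%E.

Definition independent_of_sigma (X : T -> R) (G : set (set T)) : Prop :=
  forall (A : set R) (C : set T), measurable A -> G C ->
    P (X @^-1` A `&` C) = (P (X @^-1` A) * P C)%E.

Definition complex_expectation (X : T -> R[i]) : Cfield R :=
  (fine ('E_P[(fun w => complex.Re (X w))%R])%E +i*
   fine ('E_P[(fun w => complex.Im (X w))%R])%E)%C.

End Processes.

Definition expi {R : realType} (x : R) : R[i] := (cos x +i* sin x)%C.

Section StableConvergence.
Context {R : realType} {d d' : measure_display}.
Context {T : measurableType d} {T' : measurableType d'}.
Variables (P : probability T R) (P' : probability T' R).

(* (T', P') extends (T, P) through p, which lifts a variable Y on T to the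
   variable Y \o p on T'. *)
Definition extends_probability (p : T' -> T) : Prop :=
  measurable_fun setT p /\
  forall A : set T, measurable A -> P' (p @^-1` A) = P A.

Definition converges_stably (p : T' -> T) (F : nat -> T -> R) (X : T' -> R)
    : Prop :=
  forall (lambda : R) (Y : T -> R),
    measurable_fun setT Y -> (exists M : R, forall w, `|Y w| <= M) ->
    complex_expectation P (fun w => (Y w)%:C%C * expi (lambda * F n w))
      @[n --> \oo] -->
    complex_expectation P' (fun w => (Y (p w))%:C%C * expi (lambda * X w)).

End StableConvergence.

(* Main.v *)
(* By (2), [phi_n] carries its mass near time 1 only. So fix [delta < 1] close
   to 1: replacing [u_t] by a bounded [F_delta]-measurable [V] close to [u_1],
   [phi_n] on [(delta, 1]] by a step function, and a bounded test variable [Y]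
   by an [F_delta]-measurable [W] changes [E[Y cos (theta + lambda F_n)]] by
   little, thanks to the Ito isometry.  After that, [F_n] has become [V] times
   a centred Gaussian variable of variance close to [L], independent of
   [F_delta]; hence, with [chi] the characteristic function of [N(0, 1)], the
   expectation is close to [E[Y cos theta chi (lambda sqrt L u_1)]], which is
   the value of the limit since [Z] is independent of [F].  Taking
   [theta = 0, - pi / 2] yields real and imaginary parts. *)

Require Import Defs.
From HB Require Import structures.
From mathcomp Require Import all_boot all_order all_algebra.
From mathcomp Require Import all_classical all_reals all_analysis.
From mathcomp Require Import measurable_realfun complex ring lra zify.
Set Implicit Arguments.
Unset Strict Implicit.
Unset Printing Implicit Defensive.
Import Order.TTheory GRing.Theory Num.Theory.
Import numFieldNormedType.Exports.
Local Open Scope classical_set_scope.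
Local Open Scope ring_scope.

(** * The normal law *)

Section normal_law.
Context {R : realType}.
Local Notation mu := (@lebesgue_measure R).

(** The limit multiplies [Z] by [u_1], which is known only at time 1, whereas the Gaussian
    computation needs a multiplier known before the increments begin. Hence the passage to some
    [delta < 1]: for [u_1] the substitute is [u_delta] truncated, while for the test variable it
    rests on the continuity of Brownian paths at 1. The truncation level of [V] is not controlled by
    the accuracy [eps], so it must not enter the final bound: the step function is chosen last, for
    each [n] separately, with an error scaled down by that level. The other errors are at most [eps]
    times a constant free of [n], [delta], [V] and [W]. The Ito integral is given only through its
    approximating simple processes; this calls for an isometry over overlapping intervals, which
    compares a simple process with a step integrand in one stroke. The function [chi] is handled by
    its evenness, its Lipschitz bound and an addition formula drawn from Brownian motion itself. *)

Lemma lebesgue_measure_scale (c : R) : 0 < c -> forall A, measurable A ->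
  mu A = (c%:E * pushforward mu (fun x : R => (c * x)%R : measurableTypeR R) A)%E.
Proof.
move=> c0.
have mc : measurable_fun setT (fun x : R => c * x : measurableTypeR R).
  exact: mulrl_measurable.
have H := lebesgue_measure_unique (mu := mscale (NngNum (ltW c0))
  (pushforward mu (fun x : R => (c * x)%R : measurableTypeR R))).
move=> A mA; rewrite (H mc)// => _ [[a b]] _ <-.
rewrite [RHS](_ : _ = (c%:E * mu ((fun x : R => (c * x)%R) @^-1` `]a, b]))%E)//.
rewrite (_ : _ @^-1` _ = `]c^-1 * a, c^-1 * b]%classic); last first.
  by apply/seteqP; split => x /=; rewrite !in_itv/= ltr_pdivrMl// ler_pdivlMl.
rewrite !lebesgue_measure_itv/= !lte_fin ltr_pM2l ?invr_gt0//.
case: ifPn => _; last by rewrite mule0.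
by rewrite -!EFinB -mulrBr -EFinM mulrA divff ?gt_eqF// mul1r.
Qed.

Lemma normal_pdf_scale (s x : R) : 0 < s ->
  normal_pdf 0 s x = s^-1 * normal_pdf 0 1 (s^-1 * x).
Proof.
move=> s0; rewrite !normal_pdfE ?gt_eqF//= /normal_peak /normal_fun.
rewrite !subr0 expr1n mulrA; congr (_ * expR _).
  rewrite -mulrnAr sqrtrM ?sqr_ge0// sqrtr_sqr gtr0_norm// mul1r.
  by rewrite invfM.
rewrite exprMn exprVn; field; exact: lt0r_neq0.
Qed.

Lemma normal_prob_scale (s : R) (A : set R) : 0 < s -> measurable A ->
  normal_prob 0 s ((fun x => s^-1 * x) @^-1` A) = normal_prob 0 1 A.
Proof.
move=> s0 mA; rewrite /normal_prob.
have ms : measurable_fun setT (fun x : R => (s^-1 * x)%R : measurableTypeR R).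
  exact: mulrl_measurable.
have mpdf : measurable_fun setT (fun x : R => (normal_pdf 0 1 x)%:E).
  by apply/measurable_EFinP; exact: measurable_normal_pdf.
have mcpdf : measurable_fun setT (fun x : R => (s^-1 * normal_pdf 0 1 x)%:E).
  by apply/measurable_EFinP; apply: measurable_funM => //; exact: measurable_normal_pdf.
under eq_integral do rewrite normal_pdf_scale//.
have -> : (\int[mu]_(x in (fun x => (s^-1 * x)%R) @^-1` A)
    (s^-1 * normal_pdf 0 1 (s^-1 * x))%R%:E =
  \int[pushforward mu (fun x : R => (s^-1 * x)%R : measurableTypeR R)]_(x in A)
    (s^-1 * normal_pdf 0 1 x)%R%:E)%E.
  rewrite ge0_integral_pushforward//.
  - exact: measurable_funS mcpdf.
  - move=> y _; rewrite lee_fin; apply: mulr_ge0; last exact: normal_pdf_ge0.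
    by rewrite invr_ge0 ltW.
have s'0 : 0 < s^-1 by rewrite invr_gt0.
pose k : {nonneg R} := NngNum (ltW s'0).
rewrite [RHS](eq_measure_integral (mscale k (pushforward mu
   (fun x : R => (s^-1 * x)%R : measurableTypeR R)))); last first.
  by move=> B mB _; rewrite /= /mscale/= (lebesgue_measure_scale s'0).
rewrite ge0_integral_mscale//; last 2 first.
- exact: measurable_funS mpdf.
- by move=> y _; rewrite lee_fin normal_pdf_ge0.
rewrite /= -ge0_integralZl ?lee_fin ?ltW//.
- exact: measurable_funS mpdf.
- by move=> y _; rewrite lee_fin normal_pdf_ge0.
Qed.

Lemma normal_prob_opp (A : set R) : measurable A ->
  normal_prob 0 1 (-%R @^-1` A) = normal_prob 0 1 A.
Proof.
move=> mA; rewrite /normal_prob.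
have mpdf : measurable_fun setT (fun x : R => (normal_pdf 0 1 x)%:E).
  by apply/measurable_EFinP; exact: measurable_normal_pdf.
have mN : measurable_fun setT (-%R : measurableTypeR R -> measurableTypeR R).
  exact: oppr_measurable.
have -> : (\int[mu]_(x in -%R @^-1` A) (normal_pdf 0 1 x)%:E =
  \int[pushforward mu (-%R : R -> measurableTypeR R)]_(x in A)
    (normal_pdf 0 1 x)%:E)%E.
  rewrite (ge0_integral_pushforward mN); last 3 first.
  - exact: mA.
  - exact: measurable_funS mpdf.
  - by move=> y _; rewrite lee_fin; exact: normal_pdf_ge0.
  apply: eq_integral => x _ /=.
  by rewrite !normal_pdfE ?oner_neq0// /normal_fun !subr0 sqrrN.
by apply: eq_measure_integral => B mB _; exact: lebesgue_measureN.
Qed.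

Import HBNNSimple.

(** The density describes the law on sets; linearity carries the formula to simple functions, and
    monotone convergence on both sides carries it to [f]. *)
Lemma ge0_integral_normal_prob (m s : R) (f : measurableTypeR R -> \bar R) :
  measurable_fun setT f -> (forall x, 0 <= f x)%E ->
  (\int[normal_prob m s]_x f x = \int[mu]_x (f x * (normal_pdf m s x)%:E))%E.
Proof.
move=> mf f0; pose h := nnsfun_approx measurableT mf.
have mpdf : measurable_fun setT (fun x : measurableTypeR R => (normal_pdf m s x)%:E).
  by apply/measurable_EFinP; exact: measurable_normal_pdf.
have fE x : f x = limn (EFin \o h^~ x).
  by apply/esym/cvg_lim => //; apply: cvg_nnsfun_approx.
have -> : (\int[normal_prob m s]_x f x =
    limn (fun n => \int[normal_prob m s]_x (h n x)%:E))%E.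
  rewrite -monotone_convergence//.
  - by apply: eq_integral => x _; rewrite fE.
  - by move=> n; exact/measurable_EFinP.
  - by move=> n x _; rewrite lee_fin.
  - by move=> x _ a b ab; rewrite lee_fin; exact/lefP/nd_nnsfun_approx.
have -> : (\int[mu]_x (f x * (normal_pdf m s x)%:E) =
    limn (fun n => \int[mu]_x ((h n x)%:E * (normal_pdf m s x)%:E)))%E.
  rewrite -monotone_convergence//.
  - apply: eq_integral => x _; apply/esym/cvg_lim => //.
    by apply: cvgeZr => //; exact: cvg_nnsfun_approx.
  - by move=> n; apply: emeasurable_funM => //; exact/measurable_EFinP.
  - by move=> n x _; rewrite mule_ge0 ?lee_fin// normal_pdf_ge0.
  - move=> x _ a b ab; rewrite lee_wpmul2r ?lee_fin ?normal_pdf_ge0//.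
    exact/lefP/nd_nnsfun_approx.
congr (limn _); apply/funext => n.
transitivity (\sum_(y \in range (h n))
    (y%:E * normal_prob m s (h n @^-1` [set y])))%E.
  under eq_integral do rewrite fimfunE -fsumEFin//.
  rewrite ge0_integral_fsum//; last 2 first.
  - by move=> y; exact/measurable_EFinP/measurable_funM.
  - by move=> y x _; rewrite nnfun_muleindic_ge0.
  apply: eq_fsbigr => r _.
  by rewrite integralZl_indic_nnsfun// integral_indic// setIT.
transitivity (\int[mu]_x (\sum_(y \in range (h n))
   (y%:E * (normal_pdf m s x * \1_(h n @^-1` [set y]) x)%:E)))%E; last first.
  apply: eq_integral => x _; rewrite [in RHS]fimfunE.
  rewrite -fsumEFin// ge0_mule_fsuml; last first.
    by move=> y; rewrite nnfun_muleindic_ge0.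
  apply: eq_fsbigr => r _; rewrite -!EFinM; congr EFin; ring.
rewrite ge0_integral_fsum//; last 2 first.
- move=> y; apply: emeasurable_funM => //; apply/measurable_EFinP.
  apply: measurable_funM => //; first exact: measurable_normal_pdf.
- move=> y x _; rewrite -EFinM mulrCA EFinM mule_ge0 ?lee_fin ?normal_pdf_ge0//.
  exact: nnfun_muleindic_ge0.
apply: eq_fsbigr => r; rewrite inE => -[t _ <-].
rewrite ge0_integralZl ?lee_fin//; last 2 first.
- apply/measurable_EFinP; apply: measurable_funM => //; exact: measurable_normal_pdf.
- by move=> x _; rewrite lee_fin mulr_ge0// normal_pdf_ge0.
congr (_ * _)%E; rewrite /normal_prob [LHS]integral_mkcond.
apply: eq_integral => x _.
by rewrite patchE indicE; case: ifPn => _ /=; rewrite ?mulr1 ?mulr0.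
Qed.

Lemma normal_prob_second_moment :
  (normal_prob 0 1).-integrable setT (fun x : R => (x ^+ 2)%:E).
Proof.
have msq : measurable_fun setT (fun x : R => (x ^+ 2)%:E).
  by apply/measurable_EFinP; exact: exprn_measurable.
apply/integrableP; split => //=.
under eq_integral do rewrite ger0_norm ?sqr_ge0//.
rewrite ge0_integral_normal_prob//; last by move=> x; rewrite lee_fin sqr_ge0.
(* Since x^2 / 4 <= exp(x^2 / 4), the integrand x^2 exp(- x^2 / 2) is at most 4 exp(- x^2 / 4), a
   multiple of the density of standard deviation [r]; [C] collects the 4 and the two normalising
   peaks. *)
pose r : R := Num.sqrt 2.
have r0 : r != 0 by rewrite gt_eqF// sqrtr_gt0.
pose C : R := 4 * (normal_peak 1 / normal_peak r).
apply: (@le_lt_trans _ _ (\int[mu]_x (C%:E * (normal_pdf 0 r x)%:E))%E).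
  apply: ge0_le_integral => //.
  - by move=> x _; rewrite -EFinM lee_fin mulr_ge0 ?sqr_ge0// normal_pdf_ge0.
  - apply: emeasurable_funM => //; apply/measurable_EFinP; exact: measurable_normal_pdf.
  - apply: emeasurable_funM => //; apply/measurable_EFinP; exact: measurable_normal_pdf.
  move=> x _; rewrite -!EFinM lee_fin !normal_pdfE ?oner_neq0// /C.
  rewrite [leRHS](_ : _ = 4 * normal_peak 1 * normal_fun 0 r x); last first.
    by field; rewrite gt_eqF// normal_peak_gt0.
  rewrite mulrCA (mulrC 4) -[leRHS]mulrA; apply: ler_wpM2l; first exact: normal_peak_ge0.
  rewrite /normal_fun !subr0 /r sqr_sqrtr// expr1n.
  have -> : - x ^+ 2 / 2 = - (x ^+ 2 / 4) - x ^+ 2 / 4 by field.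
  have -> : - x ^+ 2 / (2 *+ 2) = - (x ^+ 2 / 4) by field.
  rewrite expRD mulrA; apply: ler_wpM2r; first exact: expR_ge0.
  rewrite expRN mulrC ler_pdivrMl ?expR_gt0//.
  have := expR_ge1Dx (x ^+ 2 / 4); lra.
rewrite ge0_integralZl ?integral_normal_pdf ?mule1 ?ltry//.
- apply/measurable_EFinP; exact: measurable_normal_pdf.
- by move=> x _; rewrite lee_fin normal_pdf_ge0.
- by rewrite lee_fin mulr_ge0// divr_ge0 ?normal_peak_ge0.
Qed.
End normal_law.

(** * Integration over independent pairs *)

Section independent_pair.
Context {R : realType} {d1 d2 d3 : measure_display}.
Context {T : measurableType d1} {T1 : measurableType d2} {T2 : measurableType d3}.
Variables (P : probability T R) (N : probability T2 R).
Variables (p : T -> T1) (X : T -> T2).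
Hypotheses (mp : measurable_fun setT p) (mX : measurable_fun setT X).
Hypothesis pX : forall (A : set T2) (C : set T1), measurable A -> measurable C ->
  P (X @^-1` A `&` p @^-1` C) = (N A * P (p @^-1` C))%E.

(** Independence makes the joint law of [p] and [X] a product measure, and Fubini's theorem
    integrates [X] out. The target of [p] is a separate measurable type so that two situations are
    covered: [p] the identity from [T] to [T] with the sigma-field of a time [s], which amounts to
    conditioning on it, and [p] the projection of the extended space. *)
Lemma integral_indep (f : T1 * T2 -> R) :
  measurable_fun setT f -> P.-integrable setT (fun w => (f (p w, X w))%:E) ->
  (\int[P]_w (f (p w, X w))%:E = \int[P]_w \int[N]_x (f (p w, x))%:E)%E.
Proof.
move=> mf intf.
have mpX : measurable_fun setT (fun w => (p w, X w)) by exact: measurable_fun_pair.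
pose pX_ : {mfun T >-> (T1 * T2)%type} := HB.pack (fun w => (p w, X w))
  (isMeasurableFun.Build _ _ _ _ _ mpX).
pose p_ : {mfun T >-> T1} := HB.pack p (isMeasurableFun.Build _ _ _ _ _ mp).
have mfE : measurable_fun setT (EFin \o f) by exact/measurable_EFinP.
have DE A : measurable A -> ((distribution P p_) \x N)%E A = distribution P pX_ A.
  apply: product_measure_unique => C D mC mD.
  rewrite /distribution /pushforward/= muleC -pX//; congr (P _).
  by apply/seteqP; split => w [].
have intD : (distribution P pX_).-integrable setT (EFin \o f).
  exact: integrable_pushforward.
have intPr : ((distribution P p_) \x N)%E.-integrable setT (EFin \o f).
  move/integrableP: intD => [_ intD]; apply/integrableP; split => //.
  by rewrite (eq_measure_integral (distribution P pX_))// => A mA _; exact: DE.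
have intF := integrable_fubini_F intPr.
have mF := measurable_fubini_F intPr.
transitivity (\int[distribution P pX_]_z (EFin \o f) z)%E.
  by rewrite integral_distribution.
rewrite -(eq_measure_integral (distribution P pX_ : set _ -> _) (m1 := ((distribution P p_) \x N)%E)); last first.
  by move=> A mA _; exact: DE.
rewrite -integral12_prod_meas1// integral_distribution//.
apply/integrableP; split; first exact: measurableT_comp.
move/integrableP : intF => [_].
rewrite (ge0_integral_distribution p_)//.
exact: measurableT_comp.
Qed.

Lemma Rintegral_indep (f : T1 * T2 -> R) (g : T1 -> R) :
  measurable_fun setT f -> P.-integrable setT (fun w => (f (p w, X w))%:E) ->
  (forall y, \int[N]_x (f (y, x))%:E = (g y)%:E)%E ->
  \int[P]_w (f (p w, X w)) = \int[P]_w (g (p w)).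
Proof.
move=> mf intf fg; rewrite /Rintegral integral_indep//.
by congr fine; apply: eq_integral => w _; rewrite fg.
Qed.

Lemma Rintegral_indepM (Y : T1 -> R) (h : T2 -> R) :
  measurable_fun setT Y -> measurable_fun setT h ->
  P.-integrable setT (fun w => (Y (p w))%:E) ->
  N.-integrable setT (EFin \o h) ->
  P.-integrable setT (fun w => (Y (p w) * h (X w))%:E) ->
  \int[P]_w (Y (p w) * h (X w)) = (\int[P]_w Y (p w)) * \int[N]_x h x.
Proof.
move=> mY mh iY ih iYh.
pose f (z : T1 * T2) := Y z.1 * h z.2.
rewrite (@Rintegral_indep f (fun y => Y y * \int[N]_x h x))//.
- by rewrite RintegralZr.
- by apply: measurable_funM; exact: measurableT_comp.
- move=> y /=; rewrite EFinM fineK; last exact: integrable_fin_num.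
  by rewrite -integralZl.
Qed.

End independent_pair.

Lemma le_normr_RintegralB {R : realType} {d} {T : measurableType d}
    (mu : {measure set T -> \bar R}) (A : set T) (X Y D : T -> R) : measurable A ->
  mu.-integrable A (EFin \o X) -> mu.-integrable A (EFin \o Y) ->
  mu.-integrable A (EFin \o D) -> (forall w, A w -> `|X w - Y w| <= D w) ->
  `|\int[mu]_(w in A) X w - \int[mu]_(w in A) Y w| <= \int[mu]_(w in A) D w.
Proof.
move=> mA iX iY iD XYD; rewrite -RintegralB//.
have iXY : mu.-integrable A (EFin \o (fun w => X w - Y w)).
  exact: (integrableB mA iX iY).
apply: (le_trans (le_normr_Rintegral _ iXY)) => //.
apply: le_Rintegral => //; exact: integrable_norm.
Qed.

Section bounded_random_variables.
Context {R : realType} {d : measure_display} {T : measurableType d}.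
Variable P : probability T R.

Lemma bounded_integrable (X : T -> R) (M : R) :
  measurable_fun setT X -> (forall w, `|X w| <= M) ->
  P.-integrable setT (EFin \o X).
Proof.
move=> mX XM; apply: measurable_bounded_integrable => //.
  by rewrite (@le_lt_trans _ _ 1%E)// ?probability_le1 ?ltry.
exists M; split; first exact: num_real.
by move=> x Mx w _; exact: le_trans (XM w) (ltW Mx).
Qed.

Lemma Rintegral_probability_cst (r : R) : \int[P]_w r = r.
Proof. by rewrite Rintegral_cst//= probability_setT mulr1. Qed.

End bounded_random_variables.

Lemma ler_dist_cos {R : realType} (x y : R) : `|cos x - cos y| <= `|x - y|.
Proof.
wlog xy : x y / x < y.
  move=> H; have [xy|yx|->] := ltgtP x y; first exact: H.
  - by rewrite distrC (distrC x); exact: H.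
  - by rewrite !subrr.
have cc : {within `[x, y], continuous (@cos R)}.
  exact/continuous_subspaceT/continuous_cos.
have [z _] := MVT_segment (ltW xy) (fun z _ => is_derive_cos z) cc.
rewrite -(normrN (cos x - _)) opprB => ->.
rewrite normrM distrC ler_piMl// normrN ler_norml sin_geN1 sin_le1//.
Qed.

(** * The characteristic function of the standard normal law *)

Section standard_normal.
Context {R : realType}.
Local Notation N := (normal_prob (0 : R) 1).

Lemma Rintegral_normal_odd (f : R -> R) : measurable_fun setT f ->
  N.-integrable setT (EFin \o f) -> (forall x, f (- x) = - f x) ->
  \int[N]_x f x = 0.
Proof.
move=> mf intf fN; suff : \int[N]_x f x = - \int[N]_x f x by lra.
have mN : measurable_fun setT (-%R : measurableTypeR R -> measurableTypeR R).
  exact: oppr_measurable.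
have E : (\int[N]_x (f x)%:E = \int[N]_x (- (f x)%:E))%E.
  transitivity (\int[pushforward N (-%R : measurableTypeR R -> measurableTypeR R)]_x (f x)%:E)%E.
    by apply: eq_measure_integral => A mA _; exact/esym/normal_prob_opp.
  rewrite integral_pushforward//.
  - by apply: eq_integral => x _ /=; rewrite fN EFinN.
  - exact/measurable_EFinP.
  - rewrite preimage_setT (_ : _ \o _ = fun x => (- (f x)%:E)%E); last first.
      by apply/funext => x /=; rewrite fN EFinN.
    exact: integrableN.
rewrite {1}/Rintegral E integralN ?fineN//.
by apply: integrable_add_def.
Qed.

(** The characteristic function of N(0, 1), that is exp(- v^2 / 2): by symmetry of the law its sine
    part vanishes. *)
Definition chi (v : R) : R := \int[N]_x cos (v * x).

Lemma measurable_cosM (a v : R) : measurable_fun setT (fun x : R => cos (a + v * x)).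
Proof.
apply: measurableT_comp; first exact: continuous_measurable_fun (@continuous_cos R).
by apply: measurable_funD => //; exact: mulrl_measurable.
Qed.

Lemma measurable_sinM (v : R) : measurable_fun setT (fun x : R => sin (v * x)).
Proof.
apply: measurableT_comp; first exact: continuous_measurable_fun (@continuous_sin R).
exact: mulrl_measurable.
Qed.

Lemma integrable_cosM (a v : R) : N.-integrable setT (fun x => (cos (a + v * x))%:E).
Proof.
apply: (@bounded_integrable _ _ _ _ _ 1); first exact: measurable_cosM.
by move=> w; rewrite ler_norml cos_geN1 cos_le1.
Qed.

(** After expanding the cosine of a sum, the sine term is odd and integrates to zero. The phase [a]
    stands for whatever is already known when an increment is integrated out. *)
Lemma integral_normal_cos (a v : R) :
  (\int[N]_x (cos (a + v * x))%:E = (cos a * chi v)%:E)%E.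
Proof.
have ic : N.-integrable setT (fun x => (cos (v * x))%:E).
  have := integrable_cosM 0 v.
  by under [X in _.-integrable _ X -> _]eq_fun do rewrite add0r.
have isin : N.-integrable setT (fun x => (sin (v * x))%:E).
  apply: (@bounded_integrable _ _ _ _ _ 1); first exact: measurable_sinM.
  by move=> w; rewrite ler_norml sin_geN1 sin_le1.
rewrite -[LHS]fineK; last exact: (integrable_fin_num _ (integrable_cosM a v)).
congr EFin; rewrite -/(Rintegral _ _ _).
transitivity (\int[N]_x (cos a * cos (v * x) - sin a * sin (v * x))).
  by apply: eq_Rintegral => x _; rewrite cosD.
rewrite RintegralB//; last 2 first.
- exact: (integrableZl measurableT (cos a) ic).
- exact: (integrableZl measurableT (sin a) isin).
rewrite !RintegralZl// [X in _ - _ * X]Rintegral_normal_odd ?mulr0 ?subr0//.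
- exact: measurable_sinM.
- by move=> x; rewrite mulrN sinN.
Qed.

Lemma normr_chi_le1 v : `|chi v| <= 1.
Proof.
have ic : N.-integrable setT (fun x => (cos (v * x))%:E).
  have := integrable_cosM 0 v.
  by under [X in _.-integrable _ X -> _]eq_fun do rewrite add0r.
apply: (le_trans (le_normr_Rintegral _ ic)) => //.
rewrite -[leRHS](Rintegral_probability_cst N).
apply: le_Rintegral => //.
- exact: integrable_norm.
- exact: finite_measure_integrable_cst.
- by move=> w _; rewrite ler_norml cos_geN1 cos_le1.
Qed.

Lemma chiN v : chi (- v) = chi v.
Proof. by apply: eq_Rintegral => x _; rewrite mulNr cosN. Qed.

Lemma chi0 : chi 0 = 1.
Proof.
rewrite /chi; under eq_Rintegral do rewrite mul0r cos0.
by rewrite Rintegral_probability_cst.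
Qed.

Lemma integrable_normal_id : N.-integrable setT (fun x : R => x%:E).
Proof.
have i1 := finite_measure_integrable_cst N (1:R) measurableT.
have i2 := integrableD measurableT i1 normal_prob_second_moment.
apply: le_integrable i2 => //.
  exact/measurable_EFinP.
move=> x _ /=; rewrite lee_fin (ger0_norm (x := 1 + _)) ?addr_ge0 ?sqr_ge0//.
by rewrite ler_norml; apply/andP; split; nra.
Qed.

(** The cosine is 1-Lipschitz, so the first absolute moment of N(0, 1) serves as the constant. This
    converts L^1 errors on the arguments of [chi] into errors on expectations. *)
Lemma chi_lipschitz : exists2 K : R, 0 <= K &
  forall v w : R, `|chi v - chi w| <= K * `|v - w|.
Proof.
exists (\int[N]_x `|x|); first exact: Rintegral_ge0.
move=> v w.
have ic u : N.-integrable setT (fun x => (cos (u * x))%:E).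
  have := integrable_cosM 0 u.
  by under [X in _.-integrable _ X -> _]eq_fun do rewrite add0r.
have iN := integrable_norm integrable_normal_id.
rewrite -RintegralZr//; apply: le_normr_RintegralB; first exact: measurableT.
- exact: ic.
- exact: ic.
- exact: (integrableZr measurableT `|v - w| iN).
move=> x _; apply: (le_trans (ler_dist_cos _ _)).
by rewrite -mulrBl normrM mulrC.
Qed.

End standard_normal.

(** * Independence of one increment from the earlier ones *)

Section independence_of_increments.
Context {R : realType} {d : measure_display} {T : measurableType d}.
Variable P : probability T R.

Lemma dynkin_indep_event (E : set T) : measurable E ->
  dynkin [set C | measurable C /\ P (E `&` C) = (P E * P C)%E].
Proof.
move=> mE; split => /=.
- by rewrite setIT probability_setT mule1.
- move=> C [mC PEC]; split; first exact: measurableC.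
  have : (P E = P (E `&` C) + P (E `&` ~` C))%E.
    rewrite -{1}(setIT E) -(setUv C) setIUr measureU//.
    - exact: measurableI.
    - by apply: measurableI => //; exact: measurableC.
    - by rewrite setIACA setICr setI0.
  rewrite PEC probability_setC//.
  rewrite -(fineK (fin_num_measure P _ mE)) -(fineK (fin_num_measure P _ mC)).
  have mEC : measurable (E `&` ~` C) by apply: measurableI => //; exact: measurableC.
  rewrite -(fineK (fin_num_measure P _ mEC)) -!EFinB -!EFinM -!EFinD => -[H].
  congr EFin; lra.
- move=> F tF FQ; have mF n : measurable (F n) by have [] := FQ n.
  split; first exact: bigcupT_measurable.
  rewrite setI_bigcupr !measure_semi_bigcup//; last 4 first.
  - exact: bigcupT_measurable.
  - by move=> n; exact: measurableI.
  - exact: trivIset_setIl.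
  - by apply: bigcupT_measurable => n; exact: measurableI.
  rewrite -(fineK (fin_num_measure P _ mE)) -nneseriesZl//.
  rewrite fineK ?fin_num_measure//.
  by apply: eq_eseriesr => n _; have [] := FQ n.
Qed.

Lemma indep_event_sigma (E : set T) (G : set (set T)) : measurable E ->
  setI_closed G -> (forall C, G C -> measurable C) ->
  (forall C, G C -> P (E `&` C) = P E * P C)%E ->
  forall C, <<s G >> C -> P (E `&` C) = (P E * P C)%E.
Proof.
move=> mE GI mG PG C; rewrite -(setI_closed_g_dynkin_g_sigma_algebra GI) => GC.
suff [] : [set C | measurable C /\ P (E `&` C) = (P E * P C)%E] C by [].
move: C GC; apply: smallest_sub; first exact: dynkin_indep_event.
by move=> C GC; split; [exact: mG|exact: PG].
Qed.

(** Cylinders that leave the last coordinate free form a pi-system generating the earlier variables.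
    Putting [A] in the free coordinate of such a cylinder turns the product rule into the claim, and
    a Dynkin argument extends it. *)
Lemma mutually_independent_last n (X : 'I_n.+1 -> T -> R) :
  (forall i, measurable_fun setT (X i)) -> mutually_independent P X ->
  forall (A : set R) (C : set T), measurable A ->
  <<s \bigcup_(i in [set i : 'I_n.+1 | (i < n)%N])
        preimage_set_system setT (X i) measurable >> C ->
  P (X ord_max @^-1` A `&` C) = (P (X ord_max @^-1` A) * P C)%E.
Proof.
move=> mX indX A C mA.
have mXA i (B : set R) : measurable B -> measurable (X i @^-1` B).
  by move=> mB; rewrite -[X in measurable X]setTI; exact: mX.
pose G := [set C | exists D : 'I_n.+1 -> set R, [/\ forall i, measurable (D i),
  D ord_max = setT & C = \bigcap_(i in [set: 'I_n.+1]) (X i @^-1` D i)]].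
have GI : setI_closed G.
  move=> _ _ [D1 [mD1 D1T ->]] [D2 [mD2 D2T ->]].
  exists (fun i => D1 i `&` D2 i); split.
  - by move=> i; exact: measurableI.
  - by rewrite D1T D2T setIT.
  - by rewrite -bigcapI.
have mG B : G B -> measurable B.
  move=> [D [mD _ ->]]; apply: fin_bigcap_measurable => // i _; exact: mXA.
have PG B : G B -> P (X ord_max @^-1` A `&` B) = (P (X ord_max @^-1` A) * P B)%E.
  move=> [D [mD DT ->]].
  pose D' i := if i == ord_max then A else D i.
  have mD' i : measurable (D' i) by rewrite /D'; case: ifP.
  have -> : X ord_max @^-1` A `&` \bigcap_(i in [set: 'I_n.+1]) (X i @^-1` D i) =
            \bigcap_(i in [set: 'I_n.+1]) (X i @^-1` D' i).
    apply/seteqP; split => w /=.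
    - by move=> [XA XD] i _ /=; rewrite /D'; case: eqP => [->//|_]; exact: XD.
    - move=> XD; split; first by have := XD ord_max I; rewrite /= /D' eqxx.
      move=> i _ /=; have := XD i I; rewrite /= /D'; case: eqP => [->|//].
      by rewrite DT.
  rewrite !indX// !big_ord_recr/= DT preimage_setT probability_setT/= mulr1.
  rewrite muleC {2}/D' eqxx EFinM fineK ?fin_num_measure//; last exact: mXA.
  congr (_%:E * _)%E; apply: eq_bigr => i _; congr (fine (P (_ @^-1` _))).
  by rewrite /D' ifF//; apply/negbTE; rewrite -val_eqE/= neq_ltn ltn_ord.
move=> sC; apply: (@indep_event_sigma _ G) => //; first exact: mXA.
move: C sC; apply: smallest_sub; first exact: smallest_sigma_algebra.
move=> C [i /= iN [B mB <-]]; apply: sub_sigma_algebra.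
exists (fun j => if j == i then B else setT); split.
- by move=> j; case: ifP.
- by case: eqP => // E; move: iN; rewrite -E/= ltnn.
- rewrite setTI; apply/seteqP; split => w /=.
  + by move=> XB j _ /=; case: eqP => [->|].
  + by move=> /(_ i I) /=; rewrite eqxx.
Qed.

End independence_of_increments.

Lemma probability_setU2 {d} {T : measurableType d} {R : realType}
    (P : probability T R) (A C : set T) : measurable A -> measurable C ->
  (P (A `|` C) <= P A + P C)%E.
Proof. by move=> mA mC; exact: measureU2. Qed.

Lemma measure_eq_symdiff {d} {T : measurableType d} {R : realType}
    (mu : {measure set T -> \bar R}) (C D : set T) :
  measurable C -> measurable D -> mu.-negligible ((C `\` D) `|` (D `\` C)) ->
  mu C = mu D.
Proof.
move=> mC mD nCD; rewrite (measureDI mu mC mD) (measureDI mu mD mC) (setIC D).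
have nC := measure_negligible (measurableD mC mD) (negligibleS (@subsetUl _ _ _) nCD).
have nD := measure_negligible (measurableD mD mC) (negligibleS (@subsetUr _ _ _) nCD).
by rewrite nC nD.
Qed.

Lemma sigma_algebraS_measurable_fun {d} {T : pointedType} {U : measurableType d}
    (G G' : set (set T)) (X : T -> U) : <<s G >> `<=` <<s G' >> ->
  measurable_fun [set: g_sigma_algebraType G] X ->
  measurable_fun [set: g_sigma_algebraType G'] X.
Proof. by move=> GG' mX _ A mA; apply: GG'; exact: mX. Qed.

(** * The Brownian filtration *)

Section brownian_filtration.
Context {R : realType} {d : measure_display} {T : measurableType d}.
Variables (P : probability T R) (B : R -> T -> R).
Hypothesis hB : standard_brownian_motion P B.
Hypothesis hF : forall A : set T,
  measurable A <-> completion P (sigma_of_process B 1) A.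
Local Notation FB := (natural_filtration P B).
Local Notation dB s t := (fun w => (B t w - B s w)%R).

Lemma measurable_sigma_of_process t : 0 <= t <= 1 ->
  sigma_of_process B t `<=` measurable.
Proof.
move=> /andP[t0 t1]; apply: smallest_sub; first exact: sigma_algebra_measurable.
move=> C [s /=]; rewrite in_itv/= => /andP[s0 st] [A mA <-].
by apply: (bm_measurable hB) => //; rewrite s0 (le_trans st).
Qed.

Lemma measurable_negligible (N : set T) : P.-negligible N -> measurable N.
Proof.
case=> A [mA PA0 NA]; have [C [N' [sC sN' PN' AC]]] := (hF A).1 mA.
have m01 : 0 <= (1 : R) <= 1 by rewrite ler01 lexx.
have mC := measurable_sigma_of_process m01 sC.
have mN' := measurable_sigma_of_process m01 sN'.
(* [N] lies in [A], which differs from [C] only inside [N']. So [N] is covered by the union of [C]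
   and [N'], a Brownian event contained in the union of [A] and [N'], hence null: [N] equals the
   empty set up to a null set. *)
apply/hF; exists set0, (C `|` N'); split.
- exact: (@measurable0 _ (g_sigma_algebraType _)).
- exact: (@measurableU _ (g_sigma_algebraType _)).
- apply/eqP; rewrite eq_le measure_ge0 andbT.
  have : (P (C `|` N') <= P (A `|` N'))%E.
    apply: le_measure; rewrite ?inE; [exact: measurableU|exact: measurableU|].
    move=> w [Cw|]; last by right.
    have [Aw|Aw] := pselect (A w); first by left.
    by right; apply: AC; right.
  move=> /le_trans; apply; apply: (le_trans (probability_setU2 _ _ _)) => //.
  by have -> : P A = 0%E by []; rewrite PN' adde0.
- rewrite setD0 set0D setU0 => w Nw.
  have [Cw|Cw] := pselect (C w); first by left.
  by right; apply: AC; left; split => //; exact: NA.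
Qed.

(** The measurable sets of [g_sigma_algebraType (FB t)] are by construction those generated by
    [FB t]; this equality moves between the two descriptions. *)
Lemma sigma_algebra_filtration t : <<s FB t >> = FB t.
Proof. by rewrite /natural_filtration smallest_id//; exact: smallest_sigma_algebra. Qed.

Lemma filtrationS s t : s <= t -> FB s `<=` FB t.
Proof.
move=> st; apply: sub_sigma_algebra2; apply: setSU.
apply: sub_sigma_algebra2 => C [r /=]; rewrite in_itv/= => /andP[r0 rs] rC.
by exists r => //=; rewrite in_itv/= r0 (le_trans rs).
Qed.

Lemma measurable_filtration t : 0 <= t <= 1 -> FB t `<=` measurable.
Proof.
move=> t01; apply: smallest_sub; first exact: sigma_algebra_measurable.
move=> C [|]; first exact: measurable_sigma_of_process.
exact: measurable_negligible.
Qed.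

Lemma adaptedS s t {d'} {U : measurableType d'} (X : T -> U) : s <= t ->
  measurable_fun [set: g_sigma_algebraType (FB s)] X ->
  measurable_fun [set: g_sigma_algebraType (FB t)] X.
Proof.
move=> st; apply: sigma_algebraS_measurable_fun; rewrite !sigma_algebra_filtration.
exact: filtrationS.
Qed.

Lemma adapted_measurable t {d'} {U : measurableType d'} (X : T -> U) :
  0 <= t <= 1 -> measurable_fun [set: g_sigma_algebraType (FB t)] X ->
  measurable_fun setT X.
Proof.
move=> t01 mX _ A mA; apply: (measurable_filtration t01).
by rewrite -sigma_algebra_filtration; exact: mX.
Qed.

Lemma measurable_id_filtration t : 0 <= t <= 1 ->
  measurable_fun setT (id : T -> g_sigma_algebraType (FB t)).
Proof.
move=> t01; apply: (adapted_measurable t01); exact: measurable_id.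
Qed.

Lemma adapted_brownian s t : 0 <= s <= t ->
  measurable_fun [set: g_sigma_algebraType (FB t)] (B s).
Proof.
move=> st _ A mA; apply: sub_sigma_algebra; apply: sub_sigma_algebra; left.
by apply: sub_sigma_algebra; exists s => //=; exists A.
Qed.

(** Independence is postulated for consecutive increments along an ordered subdivision. So the times
    of [l] are sorted and framed by 0, [s] and [t]; each [B r - B 0] is then a telescoping sum of
    increments that precede the last one. *)
Lemma increment_indep_seq (s t : R) (l : seq R) : 0 <= s -> s < t -> t <= 1 ->
  (forall r, r \in l -> 0 <= r <= s) ->
  forall (A : set R) (C : set T), measurable A ->
  <<s \bigcup_(r in [set` l]) preimage_set_system setT
        (dB 0 r) measurable >> C ->
  P ((dB s t) @^-1` A `&` C) =
  (P ((dB s t) @^-1` A) * P C)%E.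
Proof.
move=> s0 st t1 ls A C mA.
(* The default value of [nth] acts as the final time: [tt] runs through 0, the sorted list and [s],
   then takes the value [t] past the end of [x]. *)
pose srt := sort <=%R l; pose x := 0 :: rcons srt s; pose tt := nth t x.
pose m := size srt.
have tts : tt m.+1 = s by rewrite /tt/= nth_rcons ltnn eqxx.
have ttt : tt m.+2 = t.
  by rewrite /tt/= nth_rcons ltnNge leqnSn/= gtn_eqF.
have srt0 r : r \in srt -> 0 <= r <= s by rewrite mem_sort; exact: ls.
have x0s r : r \in x -> 0 <= r <= s.
  rewrite in_cons mem_rcons in_cons => /orP[/eqP->|/orP[/eqP->|/srt0//]].
  - by rewrite lexx.
  - by rewrite lexx s0.
have sx : size x = m.+2 by rewrite /x/= size_rcons.
have tt01 i : (i <= m.+2)%N -> 0 <= tt i <= 1.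
  rewrite leq_eqVlt => /orP[/eqP->|im]; first by rewrite ttt t1 andbT (le_trans s0)// ltW.
  have /x0s/andP[-> /le_trans ->//] : tt i \in x by rewrite mem_nth// sx.
  exact: le_trans (ltW st) t1.
have sort_x : sorted <=%R x.
  rewrite /x/= rcons_path; apply/andP; split.
    rewrite path_min_sorted; first by apply: sort_sorted; exact: le_total.
    by apply/allP => r /srt0/andP[].
  have : last 0 srt \in x by rewrite /x -rcons_cons mem_rcons in_cons mem_last orbT.
  by move/x0s => /andP[].
have tt_nd i : (i < m.+2)%N -> tt i <= tt i.+1.
  rewrite leq_eqVlt => /orP[/eqP[->]|im]; first by rewrite tts ttt ltW.
  by move/sortedP : sort_x => /(_ t i); apply; rewrite sx.
pose X (i : 'I_m.+2) w := B (tt i.+1) w - B (tt i) w.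
have mX i : measurable_fun setT (X i).
  apply: measurable_funB; apply: (bm_measurable hB); apply: tt01; first exact: ltn_ord.
  exact: ltnW.
have := mutually_independent_last mX (bm_independent_increments hB tt01 tt_nd) mA.
have -> : X ord_max = (dB s t) by rewrite /X/= tts ttt.
move=> H sC; apply: H; move: C sC; apply: smallest_sub.
  exact: smallest_sigma_algebra.
move=> C [r /= rl [D mD <-]].
set G := \bigcup_(i in _) _.
have mXG (i : 'I_m.+2) : (i < m.+1)%N -> measurable_fun [set: g_sigma_algebraType G] (X i).
  move=> im _ V mV; apply: sub_sigma_algebra; exists i => //.
  by exists V.
(* The index is shifted by one because 0 heads the list [x]. *)
pose k := (index r srt).+1.
have km : (k <= m)%N by rewrite index_mem mem_sort.
have ttk : tt k = r.
  by rewrite /tt/= nth_rcons index_mem mem_sort rl nth_index// mem_sort.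
suff : measurable_fun [set: g_sigma_algebraType G] (dB 0 r).
  by apply.
have -> : dB 0 r = (fun w => \sum_(i < k) X (inord i) w).
  apply/funext => w; rewrite -ttk -[B 0 w]/(B (tt 0%N) w).
  rewrite -(telescope_sumr (fun i => B (tt i) w))// big_mkord.
  apply: eq_bigr => i _; rewrite /X inordK//.
  by have := ltn_ord i; lia.
by apply: measurable_sum => i; apply: mXG; rewrite inordK; have := ltn_ord i; lia.
Qed.

(** The auxiliary class [G] must be a pi-system that generates [FB s]. Using finite lists of times
    makes it stable under intersection, by concatenation. Agreement up to a negligible set absorbs
    the null sets put into [FB s], and also allows [B r] to be replaced by [B r - B 0], since
    [B 0 = 0] holds only almost surely. *)
Lemma increment_indep (s t : R) : 0 <= s -> s < t -> t <= 1 ->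
  forall (A : set R) (C : set T), measurable A -> FB s C ->
  P (dB s t @^-1` A `&` C) = (normal_prob 0 (Num.sqrt (t - s)) A * P C)%E.
Proof.
move=> s0 st t1 A C mA FC.
have m01 : 0 <= (0 : R) <= 1 by rewrite lexx ler01.
have s01 : 0 <= s <= 1 by rewrite s0 (le_trans (ltW st)).
have t01 : 0 <= t <= 1 by rewrite t1 (le_trans s0)// ltW.
have mdB r q : 0 <= r <= 1 -> 0 <= q <= 1 -> measurable_fun setT (dB r q).
  by move=> r01 q01; apply: measurable_funB; exact: (bm_measurable hB).
rewrite -(bm_normal_increments hB s0 st t1 mA).
pose sl (l : seq R) := <<s \bigcup_(r in [set` l]) preimage_set_system setT (dB 0 r) measurable >>.
pose G := [set C | exists (l : seq R) C', [/\ forall r, r \in l -> 0 <= r <= s,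
   sl l C', measurable C & P.-negligible ((C `\` C') `|` (C' `\` C))]].
have slS l l' : {subset l <= l'} -> sl l `<=` sl l'.
  move=> ll'; apply: sub_sigma_algebra2 => D [r /= rl rD].
  by exists r => //=; exact: ll'.
have msl l : (forall r, r \in l -> 0 <= r <= s) -> sl l `<=` measurable.
  move=> ls; apply: smallest_sub; first exact: sigma_algebra_measurable.
  move=> D [r /= rl [D' mD' <-]]; apply: mdB => //.
  by have /andP[-> rs] := ls _ rl; rewrite (le_trans rs)// (le_trans (ltW st)).
apply: (@indep_event_sigma _ _ _ P _ G); last first.
- suff : FB s `<=` <<s G >> by apply.
  apply: smallest_sub; first exact: smallest_sigma_algebra.
  move=> D [|nD]; last first.
    apply: sub_sigma_algebra; exists [::], set0; split => //.
    + exact: (@measurable0 _ (g_sigma_algebraType _)).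
    + exact: measurable_negligible.
    + by rewrite setD0 set0D setU0.
  move: D; apply: smallest_sub; first exact: smallest_sigma_algebra.
  move=> D [r /=]; rewrite in_itv/= => /andP[r0 rs] [V mV <-].
  apply: sub_sigma_algebra; exists [:: r], (dB 0 r @^-1` V); split.
  + by move=> q; rewrite inE => /eqP ->; rewrite r0.
  + apply: sub_sigma_algebra; exists r; first by rewrite /= inE.
    by exists V => //; rewrite setTI.
  + by apply: (bm_measurable hB) => //; rewrite r0 (le_trans rs)// (le_trans (ltW st)).
  + rewrite setTI; apply: negligibleS (bm_start hB) => w /= -[[]|[]] /= H1 H2 B0.
    * by apply: H2; rewrite B0 subr0.
    * by apply: H2; rewrite B0 subr0 in H1.
- move=> D [l [D' [ls slD' mD nD]]].
  have mD' := msl _ ls _ slD'.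
  have PE (E : set T) : measurable E -> P (E `&` D) = P (E `&` D').
    move=> mE; apply: measure_eq_symdiff; [exact: measurableI..|].
    by apply: negligibleS nD => w /= [[[Ew Dw] ED]|[[Ew Dw] ED]]; [left|right];
      split => // Dw'; exact: ED.
  have mE : measurable (dB s t @^-1` A).
    by rewrite -[X in measurable X]setTI; exact: mdB.
  rewrite PE// (increment_indep_seq s0 st t1 ls mA slD').
  by rewrite -[D in RHS]setTI PE// setTI.
- by move=> D [l [D' []]].
- move=> D1 D2 [l1 [D1' [l1s sD1 mD1 nD1]]] [l2 [D2' [l2s sD2 mD2 nD2]]].
  exists (l1 ++ l2), (D1' `&` D2'); split.
  + by move=> r; rewrite mem_cat => /orP[/l1s|/l2s].
  + apply: (@measurableI _ (g_sigma_algebraType _)).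
    * by apply: slS sD1 => r; rewrite mem_cat => ->.
    * by apply: slS sD2 => r; rewrite mem_cat => ->; rewrite orbT.
  + exact: measurableI.
  + apply: negligibleS (negligibleU nD1 nD2) => w /= [[[D1w D2w] D12]|[[D1w D2w] D12]].
    * have [D1'w|D1'w] := pselect (D1' w); last by left; left.
      by right; left; split => // D2'w; exact: D12.
    * have [D1'w|D1'w] := pselect (D1 w); last by left; right.
      by right; right; split => // D2'w; exact: D12.
- by rewrite -[X in measurable X]setTI; exact: mdB.
Qed.

End brownian_filtration.

(** * The Ito isometry *)

Section square_integrable.
Context {R : realType} {d : measure_display} {T : measurableType d}.
Variable P : probability T R.

Definition square_integrable (X : T -> R) : Prop :=
  measurable_fun setT X /\ P.-integrable setT (fun w => (X w ^+ 2)%:E).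

Lemma mean_squareE (X : T -> R) : mean_square P X = (\int[P]_w (X w ^+ 2)%:E)%E.
Proof. by rewrite /mean_square unlock. Qed.

Lemma mean_square_ge0 (X : T -> R) : (0 <= mean_square P X)%E.
Proof. by rewrite mean_squareE; apply: integral_ge0 => w _; rewrite lee_fin sqr_ge0. Qed.

Lemma square_integrableP (X : T -> R) :
  measurable_fun setT X -> square_integrable X <-> (mean_square P X < +oo)%E.
Proof.
move=> mX; have mX2 : measurable_fun setT (fun w => (X w ^+ 2)%:E).
  by apply/measurable_EFinP; exact: measurable_funX.
rewrite mean_squareE; split.
- move=> [_ /integrableP[_]].
  by under eq_integral do rewrite gee0_abs ?lee_fin ?sqr_ge0//.
- move=> H; split => //; apply/integrableP; split => //.
  by under eq_integral do rewrite gee0_abs ?lee_fin ?sqr_ge0//.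
Qed.

Lemma square_integrableM (X Y : T -> R) :
  square_integrable X -> square_integrable Y ->
  P.-integrable setT (fun w => (X w * Y w)%:E).
Proof.
move=> [mX iX] [mY iY]; have := integrableD measurableT iX iY.
apply: le_integrable => //; first by apply/measurable_EFinP; exact: measurable_funM.
move=> w _ /=; rewrite lee_fin (ger0_norm (x := _ + _)) ?addr_ge0 ?sqr_ge0//.
by rewrite ler_norml; apply/andP; split; nra.
Qed.

Lemma square_integrableD (X Y : T -> R) :
  square_integrable X -> square_integrable Y ->
  square_integrable (fun w => X w + Y w).
Proof.
move=> [mX iX] [mY iY]; split; first exact: measurable_funD.
have := integrableZl measurableT 2 (integrableD measurableT iX iY).
apply: le_integrable => //.
  by apply/measurable_EFinP; apply: measurable_funX; exact: measurable_funD.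
move=> w _ /=; have X2 := sqr_ge0 (X w); have Y2 := sqr_ge0 (Y w).
rewrite lee_fin ger0_norm ?sqr_ge0// ger0_norm; last by lra.
rewrite -subr_ge0 (_ : _ - _ = (X w - Y w) ^+ 2) ?sqr_ge0//; ring.
Qed.

Lemma square_integrable_bounded (Y X : T -> R) (M : R) :
  measurable_fun setT Y -> (forall w, `|Y w| <= M) ->
  square_integrable X -> square_integrable (fun w => Y w * X w).
Proof.
move=> mY YM [mX iX]; split; first exact: measurable_funM.
have := integrableZl measurableT (M ^+ 2) iX.
apply: le_integrable => //.
  by apply/measurable_EFinP; apply: measurable_funX; exact: measurable_funM.
move=> w _ /=; rewrite lee_fin ger0_norm ?sqr_ge0// ger0_norm; last first.
  by apply: mulr_ge0; exact: sqr_ge0.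
rewrite exprMn ler_wpM2r ?sqr_ge0// -real_normK ?num_real//.
by rewrite lerXn2r// nnegrE (le_trans _ (YM w)).
Qed.

Lemma bounded_square_integrable (Y : T -> R) (M : R) :
  measurable_fun setT Y -> (forall w, `|Y w| <= M) -> square_integrable Y.
Proof.
move=> mY YM; split => //; apply: (@bounded_integrable _ _ _ _ _ (M ^+ 2)).
  exact: measurable_funX.
by move=> w; rewrite normrX lerXn2r// nnegrE (le_trans _ (YM w)).
Qed.

Lemma square_integrable_integrable (X : T -> R) :
  square_integrable X -> P.-integrable setT (EFin \o X).
Proof.
move=> LX; have L1 : square_integrable (cst 1).
  by apply: (@bounded_square_integrable _ 1) => // w; rewrite normr1.
have := square_integrableM LX L1.
by apply: eq_integrable => // w _ /=; rewrite mulr1.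
Qed.

End square_integrable.

Lemma integrable_law {R : realType} {d : measure_display} {T : measurableType d}
    (P : probability T R) (X : T -> R) (s : R) (h : R -> R) :
  measurable_fun setT X -> has_law P X (normal_prob 0 s) ->
  measurable_fun setT h -> (normal_prob 0 s).-integrable setT (EFin \o h) ->
  P.-integrable setT (fun w => (h (X w))%:E).
Proof.
move=> mX lX mh /integrableP[_ ih]; apply/integrableP; split.
  by apply/measurable_EFinP; exact: measurableT_comp.
pose X_ : {mfun T >-> measurableTypeR R} := HB.pack (X : T -> measurableTypeR R)
  (isMeasurableFun.Build _ _ T (measurableTypeR R) _ mX).
have mh' : measurable_fun setT (fun x : measurableTypeR R => `|(h x)%:E|%E).
  by apply: measurableT_comp => //; exact/measurable_EFinP.
have := @ge0_integral_distribution _ _ _ _ _ P X_ (fun x => `|(h x)%:E|%E) mh'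
  (fun x => abse_ge0 _).
move=> /= <-; apply: le_lt_trans ih; rewrite le_eqVlt; apply/orP; left; apply/eqP.
by apply: eq_measure_integral => A mA _; exact: lX.
Qed.

Section increments.
Context {R : realType} {d : measure_display} {T : measurableType d}.
Variables (P : probability T R) (B : R -> T -> R).
Hypothesis hB : standard_brownian_motion P B.
Hypothesis hF : forall A : set T,
  measurable A <-> completion P (sigma_of_process B 1) A.
Local Notation FB := (natural_filtration P B).
Local Notation dB s t := (fun w => (B t w - B s w)%R).
Local Notation N := (normal_prob (0 : R) 1).

(** Its value is 1. It is carried as a symbol through the isometry and ends up inside the constant
    of the final estimate. *)
Definition normal_moment2 : R := \int[N]_x (x ^+ 2).

Lemma normal_moment2_ge0 : 0 <= normal_moment2.
Proof. by apply: Rintegral_ge0 => x _; exact: sqr_ge0. Qed.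

Lemma measurable_increment (s t : R) : 0 <= s <= 1 -> 0 <= t <= 1 ->
  measurable_fun setT (dB s t).
Proof. by move=> s01 t01; apply: measurable_funB; exact: (bm_measurable hB). Qed.

(** This is the hypothesis [pX] on independent pairs, with [p] the identity into [T] equipped with
    [FB s]. Dividing by the standard deviation lets the single law [N] serve for all pairs of
    times. *)
Lemma scaled_increment_indep (s t : R) : 0 <= s -> s < t -> t <= 1 ->
  forall (A : set (measurableTypeR R)) (C : set (g_sigma_algebraType (FB s))),
  measurable A -> measurable C ->
  P ((fun w => (Num.sqrt (t - s))^-1 * (B t w - B s w)) @^-1` A `&` id @^-1` C) =
  (N A * P (id @^-1` C))%E.
Proof.
move=> s0 st t1 A C mA mC.
have FC : FB s C by rewrite -sigma_algebra_filtration.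
have r0 : 0 < Num.sqrt (t - s) by rewrite sqrtr_gt0 subr_gt0.
rewrite -(normal_prob_scale r0 mA) -(increment_indep hB hF s0 st t1) //.
have mc : measurable_fun setT (fun x : R => (Num.sqrt (t - s))^-1 * x).
  exact: mulrl_measurable.
by rewrite -[X in measurable X]setTI; exact: mc.
Qed.

Lemma scaled_increment_law (s t : R) : 0 <= s -> s < t -> t <= 1 ->
  has_law P (fun w => (Num.sqrt (t - s))^-1 * (B t w - B s w)) N.
Proof.
move=> s0 st t1 A mA.
have := scaled_increment_indep s0 st t1 mA (@measurableT _ _).
by rewrite preimage_setT setIT probability_setT mule1.
Qed.

Lemma increment_square_integrable (s t : R) : 0 <= s <= t -> t <= 1 ->
  square_integrable P (dB s t).
Proof.
move=> /andP[s0]; rewrite le_eqVlt => /predU1P[<-|st] t1.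
  apply: (@bounded_square_integrable _ _ _ _ _ 0); last by move=> w; rewrite subrr normr0.
  by apply: measurable_increment; rewrite s0.
have s01 : 0 <= s <= 1 by rewrite s0 (le_trans (ltW st)).
have t01 : 0 <= t <= 1 by rewrite t1 (le_trans s0)// ltW.
split; first exact: measurable_increment.
have r0 : 0 < Num.sqrt (t - s) by rewrite sqrtr_gt0 subr_gt0.
have mX : measurable_fun setT (fun w => (Num.sqrt (t - s))^-1 * (B t w - B s w)).
  by apply: measurable_funM => //; exact: measurable_increment.
have := integrable_law mX (scaled_increment_law s0 st t1)
  (@exprn_measurable _ _ 2) normal_prob_second_moment.
move/(integrableZl measurableT (Num.sqrt (t - s) ^+ 2)).
apply: eq_integrable => // w _ /=; rewrite -EFinM; congr EFin.
by rewrite -exprMn mulrA divff ?gt_eqF// mul1r.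
Qed.

(** Given [FB s], the functions [W], [V] and [theta] are frozen and the increment is a centred
    Gaussian of variance [t - s], which can be integrated out. Subdivisions may repeat a time, so
    [s = t] is allowed; both sides then agree because [chi 0 = 1]. *)
Lemma cos_increment (s t : R) (W V theta : T -> R) (M : R) :
  0 <= s <= t -> t <= 1 ->
  measurable_fun [set: g_sigma_algebraType (FB s)] W ->
  measurable_fun [set: g_sigma_algebraType (FB s)] V ->
  measurable_fun [set: g_sigma_algebraType (FB s)] theta ->
  (forall w, `|W w| <= M) ->
  \int[P]_w (W w * cos (theta w + V w * (B t w - B s w))) =
  \int[P]_w (W w * (cos (theta w) * chi (V w * Num.sqrt (t - s)))).
Proof.
move=> /andP[s0]; rewrite le_eqVlt => /predU1P[<-|st] t1 mW mV mtheta WM.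
  by apply: eq_Rintegral => w _; rewrite !subrr sqrtr0 !mulr0 addr0 chi0 mulr1.
set r := Num.sqrt (t - s).
have r0 : 0 < r by rewrite sqrtr_gt0 subr_gt0.
have s01 : 0 <= s <= 1 by rewrite s0 (le_trans (ltW st)).
have t01 : 0 <= t <= 1 by rewrite t1 (le_trans s0)// ltW.
pose X w := r^-1 * (B t w - B s w).
have mX : measurable_fun setT X.
  by apply: measurable_funM => //; exact: measurable_increment.
pose T1 := g_sigma_algebraType (FB s).
pose f (z : T1 * measurableTypeR R) :=
  W z.1 * cos (theta z.1 + V z.1 * r * z.2).
pose g (y : T1) := W y * (cos (theta y) * chi (V y * r)).
have mf : measurable_fun setT f.
  have m1 (h : T1 -> R) : measurable_fun setT h ->
     measurable_fun setT (fun z : T1 * measurableTypeR R => h z.1).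
    by move=> mh; apply: measurableT_comp => //; exact: measurable_fst.
  apply: measurable_funM; first exact: m1.
  apply: measurableT_comp; first exact: continuous_measurable_fun (@continuous_cos R).
  apply: measurable_funD; first exact: m1.
  apply: measurable_funM; last exact: measurable_snd.
  by apply: measurable_funM => //; exact: m1.
have mT (h : T -> R) : measurable_fun [set: T1] h -> measurable_fun [set: T] h.
  exact: (adapted_measurable hB hF s01).
rewrite -[RHS](Rintegral_indep (X := X : T -> measurableTypeR R) (f := f) (g := g)
  (measurable_id_filtration hB hF s01) mX (scaled_increment_indep s0 st t1) mf).
- apply: eq_Rintegral => w _; rewrite /f /X/=; congr (_ * cos (_ + _)).
  by field; rewrite gt_eqF.
- apply: (@bounded_integrable _ _ _ _ _ M).
    apply: measurable_funM; first exact: mT.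
    apply: measurableT_comp; first exact: continuous_measurable_fun (@continuous_cos R).
    apply: measurable_funD; first exact: mT.
    by apply: measurable_funM => //; apply: measurable_funM => //; exact: mT.
  move=> w; rewrite normrM -[leRHS]mulr1; apply: ler_pM => //.
  by rewrite ler_norml cos_geN1 cos_le1.
- move=> y; rewrite /f /g /= EFinM -integral_normal_cos.
  rewrite -integralZl//; last exact: integrable_cosM.
Qed.

Lemma increment_mean0 (s t : R) (Y : T -> R) : 0 <= s <= t -> t <= 1 ->
  measurable_fun [set: g_sigma_algebraType (FB s)] Y ->
  P.-integrable setT (EFin \o Y) ->
  P.-integrable setT (fun w => (Y w * (B t w - B s w))%:E) ->
  \int[P]_w (Y w * (B t w - B s w)) = 0.
Proof.
move=> /andP[s0]; rewrite le_eqVlt => /predU1P[<-|st] t1 mY iY iYB.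
  under eq_Rintegral do rewrite subrr mulr0.
  by rewrite Rintegral_probability_cst.
set r := Num.sqrt (t - s).
have r0 : 0 < r by rewrite sqrtr_gt0 subr_gt0.
have s01 : 0 <= s <= 1 by rewrite s0 (le_trans (ltW st)).
have t01 : 0 <= t <= 1 by rewrite t1 (le_trans s0)// ltW.
pose X w := r^-1 * (B t w - B s w).
have mX : measurable_fun setT X.
  by apply: measurable_funM => //; exact: measurable_increment.
transitivity (\int[P]_w (r * (Y w * X w))).
  by apply: eq_Rintegral => w _; rewrite /X; field; rewrite gt_eqF.
have iYX : P.-integrable setT (fun w => (Y w * X w)%:E).
  have := integrableZl measurableT r^-1 iYB.
  by apply: eq_integrable => // w _; rewrite -EFinM /X; congr EFin; ring.
rewrite RintegralZl//.
rewrite (Rintegral_indepM (X := X : T -> measurableTypeR R) (h := id)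
  (measurable_id_filtration hB hF s01) mX (scaled_increment_indep s0 st t1))//.
- rewrite [X in _ * (_ * X)]Rintegral_normal_odd ?mulr0//.
  exact: integrable_normal_id.
- exact: integrable_normal_id.
Qed.

Lemma increment_moment2 (s t : R) (Y : T -> R) (M : R) : 0 <= s <= t -> t <= 1 ->
  measurable_fun [set: g_sigma_algebraType (FB s)] Y ->
  (forall w, `|Y w| <= M) ->
  \int[P]_w (Y w * (B t w - B s w) ^+ 2) =
  normal_moment2 * (t - s) * \int[P]_w Y w.
Proof.
move=> /andP[s0]; rewrite le_eqVlt => /predU1P[<-|st] t1 mY YM.
  under eq_Rintegral do rewrite subrr expr0n mulr0.
  by rewrite Rintegral_probability_cst subrr mulr0 mul0r.
set r := Num.sqrt (t - s).
have r0 : 0 < r by rewrite sqrtr_gt0 subr_gt0.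
have s01 : 0 <= s <= 1 by rewrite s0 (le_trans (ltW st)).
have t01 : 0 <= t <= 1 by rewrite t1 (le_trans s0)// ltW.
pose X w := r^-1 * (B t w - B s w).
have mX : measurable_fun setT X.
  by apply: measurable_funM => //; exact: measurable_increment.
have rr : r ^+ 2 = t - s by rewrite sqr_sqrtr// subr_ge0 ltW.
transitivity (\int[P]_w (r ^+ 2 * (Y w * X w ^+ 2))).
  by apply: eq_Rintegral => w _; rewrite /X; field; rewrite gt_eqF.
have mYT := adapted_measurable hB hF s01 mY.
have iYX : P.-integrable setT (fun w => (Y w * X w ^+ 2)%:E).
  have iX : P.-integrable setT (fun w => (X w ^+ 2)%:E).
    exact: (integrable_law mX (scaled_increment_law s0 st t1)
      (@exprn_measurable _ _ 2) normal_prob_second_moment).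
  have := integrableZl measurableT M iX.
  apply: le_integrable => //.
    apply/measurable_EFinP; apply: measurable_funM => //; exact: measurable_funX.
  move=> w _ /=; rewrite lee_fin !normrM ler_wpM2r//.
  by rewrite (le_trans (YM w))// ler_norm.
rewrite RintegralZl// rr.
rewrite (Rintegral_indepM (X := X : T -> measurableTypeR R) (h := fun x => x ^+ 2)
  (measurable_id_filtration hB hF s01) mX (scaled_increment_indep s0 st t1))//.
- by rewrite /normal_moment2; ring.
- exact: bounded_integrable YM.
- exact: normal_prob_second_moment.
Qed.
End increments.

Lemma mean_square_sum {R : realType} {d : measure_display} {T : measurableType d}
    (P : probability T R) (I : finType) (a : I -> T -> R) :
  (forall i, square_integrable P (a i)) ->
  mean_square P (fun w => \sum_i a i w) =
  (\sum_i \sum_j \int[P]_w (a i w * a j w))%:E.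
Proof.
move=> La; rewrite mean_squareE.
have iaa i j := square_integrableM (La i) (La j).
under eq_integral do rewrite expr2 big_distrlr/= -sumEFin.
rewrite integral_sum//; last first.
  move=> i; under eq_fun do rewrite -sumEFin.
  by apply: integrable_sum => // j _; exact: iaa.
rewrite -sumEFin; apply: eq_bigr => i _.
under eq_integral do rewrite -sumEFin.
rewrite integral_sum//.
rewrite -sumEFin; apply: eq_bigr => j _.
by rewrite /Rintegral fineK//; exact: integrable_fin_num.
Qed.

Section ito_isometry.
Context {R : realType} {d : measure_display} {T : measurableType d}.
Variables (P : probability T R) (B : R -> T -> R).
Hypothesis hB : standard_brownian_motion P B.
Hypothesis hF : forall A : set T,
  measurable A <-> completion P (sigma_of_process B 1) A.
Local Notation FB := (natural_filtration P B).
Local Notation dB s t := (fun w => (B t w - B s w)%R).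
Local Notation m2 := (@normal_moment2 R).

(** The longer increment is cut at [b]. Its second piece has mean zero given everything known at
    [b], so only the conditional second moment of the shorter increment survives. *)
Lemma increment_overlap (a b c M : R) (zeta : T -> R) :
  0 <= a <= b -> b <= c -> c <= 1 ->
  measurable_fun [set: g_sigma_algebraType (FB a)] zeta ->
  (forall w, `|zeta w| <= M) ->
  \int[P]_w (zeta w * dB a b w * dB a c w) = m2 * (b - a) * \int[P]_w zeta w.
Proof.
move=> /andP[a0 ab] bc c1 mz zM.
have b1 := le_trans bc c1.
have a01 : 0 <= a <= 1 by rewrite a0 (le_trans ab).
have mzT := adapted_measurable hB hF a01 mz.
have Lab : square_integrable P (dB a b).
  by apply: (increment_square_integrable hB hF) => //; rewrite a0.
have Lbc : square_integrable P (dB b c).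
  by apply: (increment_square_integrable hB hF) => //; rewrite (le_trans a0).
have Lz := square_integrable_bounded mzT zM Lab.
transitivity (\int[P]_w (zeta w * dB a b w ^+ 2 + zeta w * dB a b w * dB b c w)).
  by apply: eq_Rintegral => w _; ring.
rewrite RintegralD//; last 2 first.
- have := square_integrableM Lz Lab.
  by apply: eq_integrable => // w _ /=; congr EFin; ring.
- exact: square_integrableM Lz Lbc.
rewrite (increment_moment2 hB hF (M := M))//; last by rewrite a0.
rewrite (increment_mean0 hB hF (Y := fun w => zeta w * dB a b w)) ?addr0//.
- by rewrite (le_trans a0).
- apply: measurable_funM; first exact: adaptedS mz.
  by apply: measurable_funB; apply: adapted_brownian; rewrite ?lexx ?a0 ?ab// (le_trans a0).
- exact: square_integrable_integrable Lz.
- exact: square_integrableM Lz Lbc.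
Qed.

(** The length of the intersection of ]s, t] and ]s', t'], equal to 0 when they do not meet. *)
Definition overlap (s t s' t' : R) : R :=
  Num.max 0 (Num.min t t' - Num.max s s').

Lemma overlapC (s t s' t' : R) : overlap s' t' s t = overlap s t s' t'.
Proof. by rewrite /overlap (minC t) (maxC s). Qed.

(** Cutting the increment that starts earlier at the starting time of the other one reduces the
    claim to two increments with a common start, the case of [increment_overlap]. *)
Lemma increment_cov (s t s' t' M M' : R) (xi xi' : T -> R) :
  0 <= s <= t -> t <= 1 -> 0 <= s' <= t' -> t' <= 1 ->
  measurable_fun [set: g_sigma_algebraType (FB s)] xi ->
  (forall w, `|xi w| <= M) ->
  measurable_fun [set: g_sigma_algebraType (FB s')] xi' ->
  (forall w, `|xi' w| <= M') ->
  \int[P]_w (xi w * dB s t w * (xi' w * dB s' t' w)) =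
  m2 * overlap s t s' t' * \int[P]_w (xi w * xi' w).
Proof.
wlog ss' : s t s' t' M M' xi xi' / s <= s'.
  move=> H; have [ss'|/ltW s's] := leP s s'; first exact: H.
  move=> st t1 st' t1' mxi xiM mxi' xiM'.
  rewrite [LHS](_ : _ = \int[P]_w (xi' w * dB s' t' w * (xi w * dB s t w))).
    rewrite (H _ _ _ _ M' M)// overlapC; congr (_ * _).
    by apply: eq_Rintegral => w _; rewrite mulrC.
  by apply: eq_Rintegral => w _; rewrite mulrC.
move=> /andP[s0 st] t1 /andP[s0' st'] t1' mxi xiM mxi' xiM'.
have s01 : 0 <= s <= 1 by rewrite s0 (le_trans st).
have s01' : 0 <= s' <= 1 by rewrite s0' (le_trans st').
have mxiT := adapted_measurable hB hF s01 mxi.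
have mxiT' := adapted_measurable hB hF s01' mxi'.
have LdB r q : 0 <= r <= q -> q <= 1 -> square_integrable P (dB r q).
  exact: (increment_square_integrable hB hF).
(* the part of the first increment before [s'] is orthogonal to the second one *)
have past q : s <= q <= s' -> \int[P]_w (xi w * dB s q w * (xi' w * dB s' t' w)) = 0.
  move=> /andP[sq qs'].
  have Lx : square_integrable P (fun w => xi' w * (xi w * dB s q w)).
    apply: (square_integrable_bounded mxiT' xiM').
    apply: (square_integrable_bounded mxiT xiM).
    by apply: LdB; rewrite ?s0// (le_trans qs')// (le_trans st').
  rewrite -[RHS](increment_mean0 hB hF (s := s') (t := t')
    (Y := fun w => xi' w * (xi w * dB s q w)))//.
  - by apply: eq_Rintegral => w _; ring.
  - by rewrite s0'.
  - apply: measurable_funM => //; apply: measurable_funM; first exact: adaptedS mxi.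
    by apply: measurable_funB; apply: adapted_brownian; rewrite ?s0// qs' (le_trans s0).
  - exact: square_integrable_integrable Lx.
  - by apply: square_integrableM => //; apply: LdB; rewrite ?s0'.
have [ts'|s't] := leP t s'.
  rewrite past ?st// /overlap max_l ?mulr0 ?mul0r//.
  by rewrite subr_le0 ge_min le_max ts' orbT.
set zeta := fun w => xi w * xi' w.
have mz : measurable_fun [set: g_sigma_algebraType (FB s')] zeta.
  by apply: measurable_funM => //; exact: adaptedS mxi.
have zM w : `|zeta w| <= M * M' by rewrite normrM ler_pM.
have mzT := adapted_measurable hB hF s01' mz.
transitivity (\int[P]_w (xi w * dB s s' w * (xi' w * dB s' t' w) +
    zeta w * dB s' t w * dB s' t' w)).
  by apply: eq_Rintegral => w _; rewrite /zeta; ring.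
have Ls't : square_integrable P (dB s' t) by apply: LdB; rewrite ?s0'// ltW.
have Ls't' : square_integrable P (dB s' t') by apply: LdB; rewrite ?s0'.
rewrite RintegralD//; last 2 first.
- apply: square_integrableM.
  + apply: (square_integrable_bounded mxiT xiM); apply: LdB; first by rewrite s0.
    by case/andP : s01'.
  + exact: (square_integrable_bounded mxiT' xiM').
- by apply: square_integrableM => //; exact: (square_integrable_bounded mzT zM).
rewrite past ?ss' ?lexx// add0r /overlap (max_r ss').
have [tt'|/ltW t't] := leP t t'.
  rewrite (increment_overlap (M := M * M'))//; last by rewrite s0' ltW.
  by rewrite max_r// subr_ge0 ltW.
transitivity (\int[P]_w (zeta w * dB s' t' w * dB s' t w)).
  by apply: eq_Rintegral => w _; ring.
rewrite (increment_overlap (M := M * M'))//; last by rewrite s0'.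
by rewrite max_r// subr_ge0.
Qed.

Lemma indic_itvM (s t s' t' x : R) :
  \1_(`]s, t]) x * \1_(`]s', t']) x =
  \1_(`]Num.max s s', Num.min t t']) x :> R.
Proof.
transitivity (\1_(`]s, t] `&` `]s', t']) x : R); first by rewrite indicI.
congr (\1_ _ x); apply/seteqP; split => y /=; rewrite !in_itv/= gt_max le_min.
  by move=> [/andP[-> ->] /andP[-> ->]].
by move=> /andP[/andP[-> ->] /andP[-> ->]].
Qed.

Lemma integrable_indic_itvM (s t s' t' : R) :
  lebesgue_measure.-integrable `[0%R, 1%R]
    (fun x : R => (\1_(`]s, t]) x * \1_(`]s', t']) x : R)%:E).
Proof.
rewrite (_ : (fun _ => _) = EFin \o \1_(`]Num.max s s', Num.min t t'])); last first.
  by apply/funext => x /=; rewrite indic_itvM.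
apply: (@integrableS _ _ _ _ setT) => //.
exact: (integrable_indic_itv _ _ false false).
Qed.

Lemma integral_overlap (s t s' t' : R) : 0 <= s -> t <= 1 -> 0 <= s' -> t' <= 1 ->
  (\int[lebesgue_measure]_(x in `[0%R, 1%R])
     (\1_(`]s, t]) x * \1_(`]s', t']) x : R)%:E = (overlap s t s' t')%:E)%E.
Proof.
move=> s0 t1 s0' t1'.
under eq_integral do rewrite indic_itvM.
rewrite integral_indic//.
rewrite setIidl; last first.
  move=> x /=; rewrite !in_itv/= gt_max le_min => /andP[/andP[sx _] /andP[xt _]].
  by rewrite (le_trans s0 (ltW sx)) (le_trans xt t1).
rewrite [LHS]lebesgue_measure_itv/= lte_fin /overlap; case: ifPn => [h|].
  have h' : 0 <= Num.min t t' - Num.max s s' by rewrite subr_ge0 ltW.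
  by rewrite (max_r h') -EFinB.
by rewrite -leNgt => h; rewrite max_l// subr_le0.
Qed.

(** Both squares expand into double sums that agree term by term: on the left the covariance of two
    increments is proportional to their overlap, on the right that overlap is the integral of a
    product of indicators. The intervals may overlap freely, so a difference of two elementary
    integrands needs no common refinement of their subdivisions. *)
Lemma ito_isometry (I : finType) (s t : I -> R) (xi : I -> T -> R) :
  (forall i, 0 <= s i <= t i) -> (forall i, t i <= 1) ->
  (forall i, measurable_fun [set: g_sigma_algebraType (FB (s i))] (xi i)) ->
  (forall i, exists M : R, forall w, `|xi i w| <= M) ->
  mean_square P (fun w => \sum_i xi i w * (B (t i) w - B (s i) w)) =
  (m2%:E * \int[lebesgue_measure]_(x in `[0%R, 1%R])
    mean_square P (fun w => \sum_i xi i w * \1_(`]s i, t i]) x)%R)%E.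
Proof.
move=> st t1 mxi /choice[M xiM].
have s01 i : 0 <= s i <= 1 by have /andP[-> /le_trans ->] := st i.
have mxiT i := adapted_measurable hB hF (s01 i) (mxi i).
have Lxi i := bounded_square_integrable P (mxiT i) (xiM i).
rewrite mean_square_sum; last first.
  move=> i; apply: (square_integrable_bounded (mxiT i) (xiM i)).
  exact: (increment_square_integrable hB hF).
transitivity (m2%:E * \int[lebesgue_measure]_(x in `[0%R, 1%R])
   (\sum_i \sum_j ((\int[P]_w (xi i w * xi j w))%R * (\1_(`]s i, t i]) x * \1_(`]s j, t j]) x))%R%:E))%E.
  have ciij i j : lebesgue_measure.-integrable `[0%R, 1%R] (fun x : R =>
     ((\int[P]_w (xi i w * xi j w))%R%:E * (\1_(`]s i, t i]) x * \1_(`]s j, t j]) x)%R%:E))%E.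
    apply: integrableZl => //; exact: integrable_indic_itvM.
  have ni i : lebesgue_measure.-integrable `[0%R, 1%R] (fun x : R => \sum_j
     ((\int[P]_w (xi i w * xi j w))%R%:E * (\1_(`]s i, t i]) x * \1_(`]s j, t j]) x)%R%:E))%E.
    by apply: integrable_sum => // j _; exact: ciij.
  under eq_integral do under eq_bigr do under eq_bigr do rewrite EFinM.
  rewrite integral_sum//.
  rewrite [X in (_ * X)%E](_ : _ = (\sum_i \sum_j (overlap (s i) (t i) (s j) (t j) * \int[P]_w (xi i w * xi j w)))%:E).
    rewrite -EFinM; congr EFin; rewrite mulr_sumr; apply: eq_bigr => i _.
    rewrite mulr_sumr; apply: eq_bigr => j _; rewrite mulrA.
    by rewrite (increment_cov (M := M i) (M' := M j)).
  rewrite -sumEFin; apply: eq_bigr => i _.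
  rewrite integral_sum// -sumEFin; apply: eq_bigr => j _.
  have [/andP[si _] /andP[sj _]] := (st i, st j).
  rewrite integralZl//; last exact: integrable_indic_itvM.
  by rewrite integral_overlap// muleC -EFinM.
congr (_ * _)%E; apply: eq_integral => x _; rewrite mean_square_sum; last first.
  move=> i; under eq_fun do rewrite mulrC.
  apply: (@square_integrable_bounded _ _ _ _ _ _ 1) => // w.
  by rewrite indicE; case: (_ \in _); rewrite ?normr1 ?normr0.
rewrite -sumEFin; apply: eq_bigr => i _; rewrite -sumEFin; apply: eq_bigr => j _.
congr EFin; rewrite -RintegralZr//; last exact: square_integrableM.
by apply: eq_Rintegral => w _; ring.
Qed.
End ito_isometry.

(** * Approximation by events and functions known before time 1 *)

Section approximation_before_one.
Context {R : realType} {d : measure_display} {T : measurableType d}.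
Variables (P : probability T R) (B : R -> T -> R).
Hypothesis hB : standard_brownian_motion P B.
Hypothesis hF : forall A : set T,
  measurable A <-> completion P (sigma_of_process B 1) A.
Local Notation FB := (natural_filtration P B).

(** Events that can be decided before time 1 up to an arbitrarily small error. They form a
    sigma-field, which turns out to contain every measurable set; this is left continuity of the
    filtration at time 1. *)
Definition approx_set (A : set T) : Prop := measurable A /\
  forall e : R, 0 < e -> exists (delta : R) A', [/\ 0 <= delta < 1, FB delta A' &
    (P ((A `\` A') `|` (A' `\` A)) <= e%:E)%E].

Lemma approx_set_filtration (delta : R) (A : set T) :
  0 <= delta < 1 -> FB delta A -> approx_set A.
Proof.
move=> /andP[d0 d1] FA; split.
  by apply: (measurable_filtration hB hF) FA; rewrite d0 ltW.
move=> e e0; exists delta, A; split; rewrite ?d0//.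
by rewrite setDv setU0 measure0 lee_fin ltW.
Qed.

Lemma approx_set_negligible (A C : set T) : measurable C -> approx_set A ->
  P.-negligible ((C `\` A) `|` (A `\` C)) -> approx_set C.
Proof.
move=> mC [mA hA] nCA; split => // e e0; have [delta [A' [d01 FA' PA]]] := hA _ e0.
exists delta, A'; split => //.
have mA' : measurable A'.
  by apply: (measurable_filtration hB hF) FA'; case/andP : d01 => -> /ltW.
have mCA : measurable ((C `\` A) `|` (A `\` C)).
  by apply: measurableU; exact: measurableD.
apply: (@le_trans _ _ (P (((C `\` A) `|` (A `\` C)) `|` ((A `\` A') `|` (A' `\` A))))).
  apply: le_measure; rewrite ?inE; do ?[apply: measurableU|apply: measurableD] => //.
  move=> w [[Cw A'w]|[A'w Cw]]; have [Aw|Aw] := pselect (A w).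
  - by right; left.
  - by left; left.
  - by left; right.
  - by right; right.
apply: le_trans (probability_setU2 _ _ _) _ => //.
  by apply: measurableU; exact: measurableD.
have PCA : P ((C `\` A) `|` (A `\` C)) = 0%E by exact: measure_negligible.
by rewrite PCA add0e.
Qed.

Lemma approx_setC (A : set T) : approx_set A -> approx_set (~` A).
Proof.
move=> [mA hA]; split; first exact: measurableC.
move=> e e0; have [delta [A' [d01 FA' PA]]] := hA _ e0.
exists delta, (~` A'); split => //.
  rewrite -sigma_algebra_filtration.
  by apply: (@measurableC _ (g_sigma_algebraType _)); exact: sub_sigma_algebra.
by rewrite setUC !setDE !setCK (setIC _ A') (setIC _ A) -!setDE.
Qed.

Lemma approx_setU (A C : set T) : approx_set A -> approx_set C -> approx_set (A `|` C).
Proof.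
move=> [mA hA] [mC hC]; split; first exact: measurableU.
move=> e e0; have e20 : 0 < e / 2 by rewrite divr_gt0.
have [d1 [A' [/andP[d10 d11] FA' PA]]] := hA _ e20.
have [d2 [C' [/andP[d20 d21] FC' PC]]] := hC _ e20.
have mA' : measurable A' by apply: (measurable_filtration hB hF) FA'; rewrite d10 ltW.
have mC' : measurable C' by apply: (measurable_filtration hB hF) FC'; rewrite d20 ltW.
exists (Num.max d1 d2), (A' `|` C'); split.
- by rewrite le_max d10/= gt_max d11 d21.
- rewrite -sigma_algebra_filtration; apply: (@measurableU _ (g_sigma_algebraType _)).
  + by apply: sub_sigma_algebra; apply: filtrationS FA'; rewrite le_max lexx.
  + by apply: sub_sigma_algebra; apply: filtrationS FC'; rewrite le_max lexx orbT.
apply: (@le_trans _ _ (P (((A `\` A') `|` (A' `\` A)) `|` ((C `\` C') `|` (C' `\` C))))).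
  apply: le_measure; rewrite ?inE; do ?[apply: measurableU|apply: measurableD] => //;
    do ?[exact: measurableU].
  move=> w [[[Aw|Cw] /not_orP[A'w C'w]]|[[A'w|C'w] /not_orP[Aw Cw]]].
  - by left; left.
  - by right; left.
  - by left; right.
  - by right; right.
apply: le_trans (probability_setU2 _ _ _) _; do ?[apply: measurableU|apply: measurableD] => //.
by rewrite [e]splitr EFinD; exact: leeD.
Qed.

(** The approximation times of countably many sets may accumulate at 1. So the union is first cut
    down to finitely many sets, at a cost of [e / 2] by continuity from below; for these a maximum
    of times below 1 stays below 1. *)
Lemma approx_set_bigcup (F : (set T)^nat) : (forall n, approx_set (F n)) ->
  approx_set (\bigcup_n F n).
Proof.
move=> hF'; have mF n : measurable (F n) by have [] := hF' n.
have mU : measurable (\bigcup_n F n) by exact: bigcupT_measurable.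
split => // e e0; have e20 : 0 < e / 2 by rewrite divr_gt0.
pose U n := \big[setU/set0]_(i < n.+1) F i.
have hU n : approx_set (U n).
  rewrite /U; elim: n => [|n ih]; first by rewrite big_ord1.
  by rewrite big_ord_recr; exact: approx_setU.
have mUn n : measurable (U n) by have [] := hU n.
have UE : \bigcup_n U n = \bigcup_n F n.
  apply/seteqP; split => w [n _].
    by rewrite /U -bigcup_mkord => -[k _ Fk]; exists k.
  by move=> Fn; exists n => //; rewrite /U -bigcup_mkord; exists n => //=.
have := @nondecreasing_cvg_mu _ _ _ P U mUn.
rewrite UE => /(_ mU) H.
have {H} : P (U n) @[n --> \oo] --> P (\bigcup_n F n).
  by apply: H => n m nm; apply/subsetPset; apply: subset_bigsetU.
rewrite -[P (\bigcup_n F n)]fineK ?fin_num_measure// => /fine_cvgP[_].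
move=> /cvgrPdist_le/(_ _ e20)[n _ /(_ _ (leqnn n))] /= PUn.
have [_ /(_ _ e20)[delta [A' [d01 FA' PA]]]] := hU n.
exists delta, A'; split => //.
have mA' : measurable A'.
  by apply: (measurable_filtration hB hF) FA'; case/andP : d01 => -> /ltW.
have UF : U n `<=` \bigcup_n F n by rewrite -UE => w Uw; exists n.
apply: (@le_trans _ _ (P ((\bigcup_n F n `\` U n) `|` ((U n `\` A') `|` (A' `\` U n))))).
  apply: le_measure; rewrite ?inE; do ?[apply: measurableU|apply: measurableD] => //.
  move=> w [[Fw A'w]|[A'w Fw]]; have [Uw|Uw] := pselect (U n w).
  - by right; left.
  - by left.
  - by exfalso; apply: Fw; exact: UF.
  - by right; right.
apply: le_trans (probability_setU2 _ _ _) _; do ?[apply: measurableU|apply: measurableD] => //.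
rewrite [e]splitr EFinD; apply: leeD => //.
have -> : P (\bigcup_n F n `\` U n) = (P (\bigcup_n F n) - P (U n))%E.
  rewrite measureD//; first by rewrite (setIidr UF).
  by rewrite -ge0_fin_numE// fin_num_measure.
rewrite -(fineK (fin_num_measure P _ mU)) -(fineK (fin_num_measure P _ (mUn n))).
by rewrite -EFinB lee_fin (le_trans (ler_norm _)).
Qed.

Lemma sigma_algebra_approx_set : sigma_algebra setT approx_set.
Proof.
split.
- apply: (@approx_set_filtration 0); first by rewrite lexx ltr01.
  rewrite -sigma_algebra_filtration; exact: (@measurable0 _ (g_sigma_algebraType _)).
- by move=> A hA; rewrite setTD; exact: approx_setC.
- exact: approx_set_bigcup.
Qed.

Lemma brownian_left_cvg1 : exists2 A : set T, measurable A /\ P (~` A) = 0%E &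
  forall w, A w -> B (1 - n.+2%:R^-1) w @[n --> \oo] --> B 1 w.
Proof.
have [N [mN PN hN]] := bm_continuous_paths hB.
exists (~` N); first by rewrite setCK; split => //; exact: measurableC.
move=> w Nw.
have : {within `[(0:R), 1], continuous (fun t : R => B t w)}.
  by apply: contrapT => H; apply: Nw; exact: hN.
move/(continuous_within_itvP _ (ltr01)) => [_ _] /cvg_at_leftP; apply; split.
- by move=> n; rewrite ltrBlDr ltrDl invr_gt0.
- rewrite -[X in _ --> X]subr0; apply: cvgB; first exact: cvg_cst.
  have := @cvg_harmonic R; rewrite -(cvg_shiftS) //.
Qed.

(** The approximable sets contain [FB t] for every [t < 1]. By path continuity [B 1] is almost
    surely a limit of earlier values, so its events are approximable too; together these generate
    the Brownian sigma-field, and the completion adds only null modifications. *)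
Lemma approx_set_measurable (A : set T) : measurable A -> approx_set A.
Proof.
have [D [mD PD] BD] := brownian_left_cvg1.
have sA : <<s approx_set >> = approx_set.
  by rewrite smallest_id//; exact: sigma_algebra_approx_set.
have mBt (t : R) : 0 <= t < 1 -> measurable_fun [set: g_sigma_algebraType approx_set] (B t).
  move=> t01 _ V mV; apply: sub_sigma_algebra; apply: (approx_set_filtration t01).
  rewrite -sigma_algebra_filtration; apply: adapted_brownian => //.
  by case/andP : t01 => -> _; rewrite lexx.
have aD : approx_set D.
  apply: (@approx_set_negligible setT) => //.
    by rewrite -setC0; apply: approx_setC; case: sigma_algebra_approx_set.
  rewrite setDT set0U setTD; exists (~` D); split => //; exact: measurableC.
(* The indicator of the full-measure set [D] makes the convergence hold at every point, so that
   measurability passes to the limit for the sigma-field [approx_set]. *)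
have mB1D : measurable_fun [set: g_sigma_algebraType approx_set] (fun w => B 1 w * \1_D w).
  apply: (@measurable_fun_cvg _ (g_sigma_algebraType approx_set) R setT (fun n w => B (1 - n.+2%:R^-1) w * \1_D w)).
  - move=> n; apply: measurable_funM.
      apply: mBt; rewrite subr_ge0 invf_le1// ler1n/=.
      by rewrite ltrBlDr ltrDl invr_gt0.
    by apply: measurable_indic; apply: sub_sigma_algebra.
  - move=> w _; rewrite indicE; have [Dw|Dw] := boolP (w \in D).
      rewrite mulr1; under eq_fun do rewrite mulr1.
      by apply: BD; exact: set_mem.
    rewrite mulr0; under eq_fun do rewrite mulr0.
    exact: cvg_cst.
move=> mA; have [C [N [sC sN PN ACN]]] := (hF A).1 mA.
have m01 : 0 <= (1 : R) <= 1 by rewrite ler01 lexx.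
have mN := measurable_sigma_of_process hB m01 sN.
have mC := measurable_sigma_of_process hB m01 sC.
suff aC : approx_set C.
  apply: (approx_set_negligible mA aC); exists N; split => //.
move: C sC {ACN mC}; apply: smallest_sub; first exact: sigma_algebra_approx_set.
move=> C [s /=]; rewrite in_itv/= => /andP[s0 s1] [V mV <-].
move: s1; rewrite le_eqVlt => /predU1P[->|s1]; last first.
  by rewrite -sA; apply: mBt => //; rewrite s0.
have aV : approx_set ((fun w => B 1 w * \1_D w) @^-1` V).
  by rewrite -sA -[X in <<s _ >> X]setTI; exact: mB1D.
apply: (approx_set_negligible _ aV).
  by apply: (bm_measurable hB).
rewrite setTI; exists (~` D); split => //; first exact: measurableC.
move=> w; rewrite /= indicE; have [Dw|Dw] := boolP (w \in D).
  by rewrite mulr1 => -[[]|[]].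
by move=> _ Dw'; move: Dw; rewrite mem_set.
Qed.
End approximation_before_one.

Definition clip {R : realType} (M v : R) : R := Num.max (- M) (Num.min M v).

Lemma normr_clip {R : realType} (M v : R) : 0 <= M -> `|clip M v| <= M.
Proof.
move=> M0; rewrite ler_norml /clip le_max lexx/= ge_max ge_min lexx/= andbT.
by rewrite (le_trans _ M0)// oppr_le0.
Qed.

Lemma clip_id {R : realType} (M v : R) : `|v| <= M -> clip M v = v.
Proof. by rewrite ler_norml /clip => /andP[Mv vM]; rewrite min_r// max_r. Qed.

(** Together with [clip_id], this shows that truncating an approximant at [M] never moves it away
    from a target bounded by [M]: the bound on the approximant costs no accuracy. *)
Lemma ler_dist_clip {R : realType} (M u v : R) : 0 <= M ->
  `|clip M u - clip M v| <= `|u - v|.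
Proof.
move=> M0; wlog uv : u v / u <= v.
  move=> H; have [|/ltW] := leP u v; first exact: H.
  by rewrite distrC (distrC u); exact: H.
rewrite (ler0_norm (x := u - v)) ?subr_le0// /clip.
have [uM|Mu] := ltP u (- M).
  rewrite (min_r (_ : u <= M)) ?(max_l (_ : u <= - M)); [|lra|lra].
  have [vM|Mv] := leP M v; first by rewrite max_r ?ler0_norm; lra.
  by have [h|h] := leP (- M) v; rewrite ler0_norm; lra.
have [vM|Mv] := leP M v; last first.
  by rewrite (min_r (_ : u <= M)) ?max_r ?ler0_norm; lra.
have [uM|uM] := leP M u; first by rewrite subrr normr0; lra.
by rewrite !max_r ?ler0_norm; lra.
Qed.

Lemma measurable_clip {R : realType} {d} {T : measurableType d} (D : set T) (M : R) (V : T -> R) :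
  measurable_fun D V -> measurable_fun D (fun w => clip M (V w)).
Proof. by move=> mV; apply: measurable_maxr => //; exact: measurable_minr. Qed.

Section approximation_of_functions.
Context {R : realType} {d : measure_display} {T : measurableType d}.
Variables (P : probability T R) (B : R -> T -> R).
Hypothesis hB : standard_brownian_motion P B.
Hypothesis hF : forall A : set T,
  measurable A <-> completion P (sigma_of_process B 1) A.
Local Notation FB := (natural_filtration P B).

Definition approx_fun (X : T -> R) : Prop := measurable_fun setT X /\
  forall e : R, 0 < e -> exists (delta : R) (W : T -> R), [/\ 0 <= delta < 1,
    measurable_fun [set: g_sigma_algebraType (FB delta)] W &
    (\int[P]_w `|X w - W w|%:E <= e%:E)%E].

Let mFB (delta : R) (W : T -> R) : 0 <= delta < 1 ->
  measurable_fun [set: g_sigma_algebraType (FB delta)] W -> measurable_fun setT W.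
Proof.
move=> /andP[d0 d1]; apply: (adapted_measurable hB hF); by rewrite d0 ltW.
Qed.

Let mdist (X W : T -> R) : measurable_fun setT X -> measurable_fun setT W ->
  measurable_fun setT (fun w => `|X w - W w|%:E).
Proof.
move=> mX mW; apply/measurable_EFinP; apply: measurableT_comp => //.
exact: measurable_funB.
Qed.

Lemma approx_funD (X Y : T -> R) : approx_fun X -> approx_fun Y ->
  approx_fun (fun w => X w + Y w).
Proof.
move=> [mX hX] [mY hY]; split; first exact: measurable_funD.
move=> e e0; have e20 : 0 < e / 2 by rewrite divr_gt0.
have [d1 [V [/andP[d10 d11] mV XV]]] := hX _ e20.
have [d2 [W [/andP[d20 d21] mW YW]]] := hY _ e20.
have mVT : measurable_fun setT V by apply: mFB mV; rewrite d10.
have mWT : measurable_fun setT W by apply: mFB mW; rewrite d20.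
exists (Num.max d1 d2), (fun w => V w + W w); split.
- by rewrite le_max d10/= gt_max d11 d21.
- apply: measurable_funD.
  + by apply: adaptedS mV; rewrite le_max lexx.
  + by apply: adaptedS mW; rewrite le_max lexx orbT.
apply: (@le_trans _ _ (\int[P]_w (`|X w - V w|%:E + `|Y w - W w|%:E))%E).
  apply: ge0_le_integral => //.
  - by apply: mdist; exact: measurable_funD.
  - by apply: emeasurable_funD; exact: mdist.
  - move=> w _; rewrite -EFinD lee_fin (_ : _ - _ = (X w - V w) + (Y w - W w)).
      exact: ler_normD.
    by ring.
rewrite ge0_integralD//; try exact: mdist.
by rewrite [e]splitr EFinD; exact: leeD.
Qed.

Lemma approx_fun_indic (r : R) (A : set T) : measurable A ->
  approx_fun (fun w => r * \1_A w).
Proof.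
move=> mA; split; first by apply: measurable_funM => //; exact: measurable_indic.
(* The summand 1 keeps the divisor positive when [r = 0]. *)
move=> e e0; have r0 : 0 < `|r| + 1 by rewrite ltr_pwDr.
have e'0 : 0 < e / (`|r| + 1) by rewrite divr_gt0.
have [_ /(_ _ e'0)[delta [A' [d01 FA' PA]]]] := approx_set_measurable hB hF mA.
have mA' : measurable A'.
  by apply: (measurable_filtration hB hF) FA'; case/andP : d01 => -> /ltW.
exists delta, (fun w => r * \1_A' w); split => //.
  apply: measurable_funM => //; apply: measurable_indic; exact: sub_sigma_algebra.
have mD : measurable ((A `\` A') `|` (A' `\` A)).
  by apply: measurableU; exact: measurableD.
apply: (@le_trans _ _ (\int[P]_w (`|r|%:E * (\1_((A `\` A') `|` (A' `\` A)) w)%:E))%E).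
  apply: ge0_le_integral => //.
  - by apply: mdist; apply: measurable_funM => //; exact: measurable_indic.
  - by apply/measurable_EFinP; apply: measurable_funM => //; exact: measurable_indic.
  - move=> w _; rewrite -EFinM lee_fin -mulrBr normrM ler_wpM2l//.
    rewrite !indicE in_setU !in_setD.
    by case: (w \in A); case: (w \in A'); rewrite /= ?subrr ?subr0 ?sub0r ?normrN ?normr1 ?normr0.
rewrite ge0_integralZl//; last by apply/measurable_EFinP; exact: measurable_indic.
rewrite integral_indic// setIT.
apply: (@le_trans _ _ ((`|r| + 1)%:E * (e / (`|r| + 1))%:E)%E).
  by apply: lee_pmul; rewrite ?lee_fin// lerDl.
by rewrite -EFinM mulrC divfK// gt_eqF.
Qed.

Import HBSimple.

Lemma approx_fun_sfun (g : {sfun T >-> R}) : approx_fun g.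
Proof.
have -> : (g : T -> R) = (fun w => \sum_(y <- finmap.enum_fset (fset_set (range g))) y * \1_(g @^-1` [set y]) w).
  by apply/funext => w; rewrite {1}fimfunE fsbig_finite.
elim: (finmap.enum_fset _) => [|y s ih].
  under eq_fun do rewrite big_nil.
  have := approx_fun_indic 0 (@measurableT _ T).
  by under eq_fun do rewrite mul0r.
under eq_fun do rewrite big_cons.
by apply: approx_funD => //; exact: approx_fun_indic.
Qed.

(** Simple functions are dense in L^1 and are approximable before time 1. The final truncation gives
    [W] the same bound as [Y], so the constants built from [M] do not depend on [delta]. *)
Lemma approx_fun_bounded (Y : T -> R) (M : R) : measurable_fun setT Y ->
  (forall w, `|Y w| <= M) -> forall e : R, 0 < e -> exists (delta : R) (W : T -> R), [/\ 0 <= delta < 1,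
    measurable_fun [set: g_sigma_algebraType (FB delta)] W,
    (forall w, `|W w| <= M) & \int[P]_w `|Y w - W w| <= e].
Proof.
move=> mY YM e e0; have e20 : 0 < e / 2 by rewrite divr_gt0.
have iY := bounded_integrable P mY YM.
have [g [ig _]] := approximation_sfun_integrable measurableT iY.
move/fine_cvgP => [fing /cvgrPdist_le/(_ _ e20) H].
near \oo => n.
have Yg : (\int[P]_w `|Y w - g n w|%:E <= (e / 2)%:E)%E.
  have -> : (\int[P]_w `|Y w - g n w|%:E = \int[P]_w `|(Y w)%:E - (g n w)%:E|)%E by [].
  have fn : (\int[P]_w `|(Y w)%:E - (g n w)%:E|)%E \is a fin_num.
    by near: n; exact: fing.
  rewrite -(fineK fn) lee_fin (le_trans (ler_norm _))// -normrN -sub0r.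
  by near: n; exact: H.
have [_ /(_ _ e20)[delta [V [d01 mV gV]]]] := approx_fun_sfun (g n).
have mVT := mFB d01 mV.
pose W w := clip M (V w).
have mW : measurable_fun [set: g_sigma_algebraType (FB delta)] W.
  exact: measurable_clip.
have M0 (w : T) : 0 <= M by exact: le_trans (normr_ge0 _) (YM w).
have WM w : `|W w| <= M by exact: normr_clip (M0 w).
have mWT := mFB d01 mW.
exists delta, W; split => //.
have fin0 : (\int[P]_w `|Y w - W w|%:E <= e%:E)%E.
  apply: (@le_trans _ _ (\int[P]_w (`|Y w - g n w|%:E + `|g n w - V w|%:E))%E).
    apply: ge0_le_integral => //; [exact: mdist| |].
    - by apply: emeasurable_funD; apply: mdist.
    - move=> w _; rewrite -EFinD lee_fin.
      have H1 : `|Y w - W w| <= `|Y w - V w|.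
        by rewrite -{1}(clip_id (YM w)); exact: ler_dist_clip (M0 w).
      apply: (le_trans H1); rewrite (_ : _ - _ = (Y w - g n w) + (g n w - V w)).
        exact: ler_normD.
      by ring.
  rewrite ge0_integralD//; try exact: mdist.
  by rewrite [e]splitr EFinD; exact: leeD.
rewrite /Rintegral -lee_fin fineK// ge0_fin_numE; last exact: integral_ge0.
exact: le_lt_trans fin0 (ltry _).
Unshelve. all: by end_near.
Qed.
End approximation_of_functions.

Lemma le_upto {R : realType} (tau : nat -> R) (m : nat) :
  (forall i, (i < m)%N -> tau i <= tau i.+1) ->
  forall i j, (i <= j <= m)%N -> tau i <= tau j.
Proof.
move=> tau_nd i j /andP[]; elim: j => [|j ih].
  by rewrite leqn0 => /eqP ->.
rewrite leq_eqVlt => /predU1P[->//|ij] jm.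
exact: le_trans (ih ij (ltnW jm)) (tau_nd _ jm).
Qed.

Lemma measurable_chi {R : realType} : measurable_fun setT (@chi R).
Proof.
apply: continuous_measurable_fun => x; have [K K0 HK] := @chi_lipschitz R.
apply/cvgrPdist_le => e e0.
have K1 : 0 < K + 1 by rewrite ltr_pwDr.
apply/nbhs_ballP; exists (e / (K + 1)) => /=; first exact: divr_gt0.
move=> y /ltW xy; apply: (le_trans (HK _ _)).
apply: (@le_trans _ _ ((K + 1) * `|x - y|)); first by rewrite ler_wpM2r// lerDl.
by rewrite mulrC -ler_pdivlMr.
Qed.

Lemma chi_sqrt_sqr {R : realType} (x : R) : chi (Num.sqrt (x ^+ 2)) = chi x.
Proof. by rewrite sqrtr_sqr; have [|] := ger0P x => _ //; rewrite chiN. Qed.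

(** * Characteristic functions of step integrals *)

Section characteristic_functions.
Context {R : realType} {d : measure_display} {T : measurableType d}.
Variables (P : probability T R) (B : R -> T -> R).
Hypothesis hB : standard_brownian_motion P B.
Hypothesis hF : forall A : set T,
  measurable A <-> completion P (sigma_of_process B 1) A.
Local Notation FB := (natural_filtration P B).

(* The addition formula for the Gaussian characteristic function is read off
   the decomposition of [B 1 - B 0] into two independent increments. *)
Lemma chi_sqrtD (a b : R) : 0 <= a -> 0 <= b ->
  chi (Num.sqrt a) * chi (Num.sqrt b) = chi (Num.sqrt (a + b)).
Proof.
move=> a0 b0; have [ab0|ab0] := eqVneq (a + b) 0.
  have [-> ->] : a = 0 /\ b = 0 by lra.
  by rewrite addr0 sqrtr0 chi0 mulr1.
have abp : 0 < a + b by rewrite lt_neqAle eq_sym ab0 addr_ge0.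
pose r := a / (a + b); pose v := Num.sqrt (a + b).
have r0 : 0 <= r by rewrite divr_ge0// ltW.
have r1 : r <= 1 by rewrite ler_pdivrMr// mul1r lerDl.
have mcst (s x : R) : measurable_fun [set: g_sigma_algebraType (FB s)] (cst x : T -> R).
  by [].
have mB (s t : R) : 0 <= s <= t -> measurable_fun [set: g_sigma_algebraType (FB t)]
    (fun w => v * (B s w - B 0 w)).
  move=> /andP[s0 st]; apply: measurable_funM => //.
  apply: measurable_funB; apply: adapted_brownian; first by rewrite s0.
  by rewrite lexx (le_trans s0).
have c1 (w : T) : `|cst (1 : R) w| <= 1 by rewrite normr1.
have E1 := cos_increment hB hF (V := cst v) (theta := cst 0) (s := 0) (t := 1)
  _ _ (mcst _ 1) (mcst _ _) (mcst _ _) c1.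
have E2 := cos_increment hB hF (V := cst v) (theta := fun w => v * (B r w - B 0 w)) (s := r) (t := 1)
  _ _ (mcst _ 1) (mcst _ _) _ c1.
have E3 := cos_increment hB hF (V := cst v) (theta := cst 0) (s := 0) (t := r)
  _ _ (mcst _ 1) (mcst _ _) (mcst _ _) c1.
have : chi v = chi (v * Num.sqrt r) * chi (v * Num.sqrt (1 - r)).
  rewrite /= in E1 E2 E3.
  transitivity (\int[P]_w (1 * cos (0 + v * (B 1 w - B 0 w)))).
    rewrite E1 ?lexx ?ler01//.
    under eq_Rintegral do rewrite mul1r subr0 sqrtr1 mulr1 cos0 mul1r.
    by rewrite Rintegral_probability_cst.
  transitivity (\int[P]_w (1 * cos (v * (B r w - B 0 w) + v * (B 1 w - B r w)))).
    by apply: eq_Rintegral => w _; congr (_ * cos _); ring.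
  rewrite E2 ?r0//; last by apply: mB; rewrite r0 lexx.
  transitivity (\int[P]_w (1 * cos (0 + v * (B r w - B 0 w)) * chi (v * Num.sqrt (1 - r)))).
    by apply: eq_Rintegral => w _; rewrite add0r mulrA.
  rewrite RintegralZr//; last first.
    apply: (@bounded_integrable _ _ _ _ _ 1).
      under eq_fun do rewrite mul1r add0r.
      apply: measurableT_comp; first exact: continuous_measurable_fun (@continuous_cos R).
      apply: (adapted_measurable hB hF (t := 1)); first by rewrite ler01 lexx.
      by apply: mB; rewrite r0.
    by move=> w; rewrite mul1r ler_norml cos_geN1 cos_le1.
  rewrite E3 ?lexx ?r0// subr0.
  under eq_Rintegral do rewrite mul1r cos0 mul1r.
  by rewrite Rintegral_probability_cst.
have rE : (a + b) * r = a by rewrite /r mulrC divfK.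
rewrite /v -!sqrtrM ?(ltW abp)// rE.
by rewrite (_ : (a + b) * (1 - r) = b) => [->//|]; rewrite mulrBr rE mulr1 addrC addKr.
Qed.

(** Induction on the number of cells, integrating out the last increment first. The factor
    [chi (V w * c m * r)] that it leaves behind depends on [V] only, so it is known at [tau 0] and
    joins the weight, whose bound survives because [chi] is at most 1 in modulus; this is why [W]
    varies in the induction. The addition formula then merges the two values of [chi]. *)
Lemma cos_step_sum (m : nat) (tau c : nat -> R) (theta M : R) (V W : T -> R) :
  0 <= tau 0%N -> (forall i, (i < m)%N -> tau i <= tau i.+1) -> tau m <= 1 ->
  measurable_fun [set: g_sigma_algebraType (FB (tau 0%N))] V ->
  measurable_fun [set: g_sigma_algebraType (FB (tau 0%N))] W ->
  (forall w, `|W w| <= M) ->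
  \int[P]_w (W w * cos (theta + V w * \sum_(i < m) c i * (B (tau i.+1) w - B (tau i) w))) =
  \int[P]_w (W w * (cos theta *
    chi (V w * Num.sqrt (\sum_(i < m) c i ^+ 2 * (tau i.+1 - tau i))))).
Proof.
move=> tau0; elim: m W => [|m IH] W tau_nd tau1 mV mW WM.
  by apply: eq_Rintegral => w _; rewrite !big_ord0 sqrtr0 !mulr0 addr0 chi0 mulr1.
have tau_le i j : (i <= j <= m.+1)%N -> tau i <= tau j.
  by move=> H; exact: (le_upto tau_nd H).
have mtau : tau m <= tau m.+1 by exact: tau_nd.
have h0m : tau 0%N <= tau m by apply: tau_le; lia.
have m0 := le_trans tau0 h0m.
set X := fun w => \sum_(i < m) c i * (B (tau i.+1) w - B (tau i) w).
have mX : measurable_fun [set: g_sigma_algebraType (FB (tau m))] X.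
  apply: measurable_sum => i; apply: measurable_funM => //.
  have im := ltn_ord i.
  by apply: measurable_funB; apply: adapted_brownian;
    rewrite (le_trans tau0) ?tau_le//; lia.
have mVm : measurable_fun [set: g_sigma_algebraType (FB (tau m))] V by exact: adaptedS mV.
have mWm : measurable_fun [set: g_sigma_algebraType (FB (tau m))] W by exact: adaptedS mW.
transitivity (\int[P]_w (W w * cos ((theta + V w * X w) +
    (V w * c m) * (B (tau m.+1) w - B (tau m) w)))).
  by apply: eq_Rintegral => w _; rewrite big_ord_recr/=; congr (_ * cos _); rewrite /X; ring.
have mthX : measurable_fun [set: g_sigma_algebraType (FB (tau m))]
    (fun w => theta + V w * X w).
  by apply: measurable_funD => //; exact: measurable_funM.
have m01 : 0 <= tau m <= tau m.+1 by rewrite m0.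
rewrite (cos_increment hB hF (V := fun w => V w * c m)
  (theta := fun w => theta + V w * X w) m01 tau1 mWm _ mthX WM); last exact: measurable_funM.
pose r := Num.sqrt (tau m.+1 - tau m).
pose W' w := W w * chi (V w * c m * r).
have mW' : measurable_fun [set: g_sigma_algebraType (FB (tau 0%N))] W'.
  apply: measurable_funM => //; apply: measurableT_comp; first exact: measurable_chi.
  by apply: measurable_funM => //; exact: measurable_funM.
transitivity (\int[P]_w (W' w * cos (theta + V w * X w))).
  by apply: eq_Rintegral => w _; rewrite /W'; ring.
have W'M w : `|W' w| <= M.
  rewrite /W' normrM -[leRHS]mulr1; apply: ler_pM => //; exact: normr_chi_le1.
have nd' i : (i < m)%N -> tau i <= tau i.+1 by move=> im; apply: tau_nd; exact: leqW.
etransitivity; first exact: (IH W' nd' (le_trans mtau tau1) mV mW' W'M).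
apply: eq_Rintegral => w _; rewrite /W' big_ord_recr/=.
set s2 := \sum_(i < m) _.
have s20 : 0 <= s2.
  apply: sumr_ge0 => i _; rewrite mulr_ge0 ?sqr_ge0// subr_ge0; apply: tau_nd.
  exact: leqW (ltn_ord i).
have d0 : 0 <= tau m.+1 - tau m by rewrite subr_ge0.
rewrite -!mulrA; congr (_ * _); rewrite mulrCA; congr (_ * _).
rewrite -[chi (V w * (c m * r))]chi_sqrt_sqr -[chi (V w * Num.sqrt s2)]chi_sqrt_sqr.
rewrite -[RHS]chi_sqrt_sqr chi_sqrtD ?sqr_ge0//; congr (chi (Num.sqrt _)).
rewrite !exprMn !sqr_sqrtr//; first by ring.
by rewrite addr_ge0// mulrA -expr2 mulr_ge0// sqr_ge0.
Qed.

End characteristic_functions.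

(** * Step functions and approximation of bounded functions by them *)

Section step_functions.
Context {R : realType}.
Local Notation mu := (@lebesgue_measure R).

(** Cells are open on the left as in [sp_value], so that [V] times a step function is an elementary
    integrand when [V] is bounded and known at [tau 0]. *)
Definition step (m : nat) (tau c : nat -> R) (x : R) : R :=
  \sum_(i < m) c i * \1_(`]tau i, tau i.+1]) x.

Lemma stepE (m : nat) (tau c : nat -> R) (i : nat) (x : R) :
  (forall j, (j < m)%N -> tau j <= tau j.+1) -> (i < m)%N ->
  tau i < x <= tau i.+1 -> step m tau c x = c i.
Proof.
move=> tau_nd im /andP[ix xi].
rewrite /step (bigD1 (Ordinal im))//= big1 ?addr0.
  by rewrite indicE mem_set ?mulr1//= in_itv/= ix.
move=> j ji; rewrite indicE memNset ?mulr0//= in_itv/= => /andP[jx xj].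
have jm := ltn_ord j.
have : (j : nat) != i by apply: contra ji => /eqP ji; apply/eqP/val_inj.
rewrite neq_ltn => /orP[lt_ji|lt_ij].
- have := le_upto tau_nd (i := j.+1) (j := i) _; rewrite lt_ji (ltnW im) => /(_ isT) h.
  by have := le_lt_trans (le_trans xj h) ix; rewrite ltxx.
- have := le_upto tau_nd (i := i.+1) (j := j) _; rewrite lt_ij (ltnW jm) => /(_ isT) h.
  by have := le_lt_trans (le_trans xi h) jx; rewrite ltxx.
Qed.

Lemma step_interval (m : nat) (tau : nat -> R) (x : R) :
  tau 0%N < x -> x <= tau m -> exists2 i, (i < m)%N & tau i < x <= tau i.+1.
Proof.
move=> x0 xm; have ex : exists j, x <= tau j by exists m.
have jm : (ex_minn ex <= m)%N by case: ex_minnP => j _; apply.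
case: ex_minnP jm => -[|i] xi imin im; first by move: x0; rewrite ltNge xi.
exists i => //; rewrite xi andbT ltNge; apply/negP => /imin.
by rewrite ltnn.
Qed.

Lemma step_le (m : nat) (tau c : nat -> R) (x : R) :
  (forall j, (j < m)%N -> tau j <= tau j.+1) -> x <= tau 0%N ->
  step m tau c x = 0.
Proof.
move=> tau_nd x0; rewrite /step big1// => i _.
rewrite indicE memNset ?mulr0//= in_itv/= => /andP[ix _].
have := le_upto tau_nd (i := 0%N) (j := i); rewrite (ltnW (ltn_ord i)) => /(_ isT) h.
by have := lt_le_trans ix (le_trans x0 h); rewrite ltxx.
Qed.

Lemma measurable_step (m : nat) (tau c : nat -> R) (D : set R) :
  measurable_fun D (step m tau c).
Proof.
apply: measurable_funTS; apply: measurable_sum => i; exact: measurable_funM.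
Qed.

Lemma integral_step_sqr (m : nat) (tau c : nat -> R) :
  (forall j, (j < m)%N -> tau j <= tau j.+1) ->
  \int[mu]_(x in `]tau 0%N, tau m]) (step m tau c x ^+ 2) =
  \sum_(i < m) c i ^+ 2 * (tau i.+1 - tau i).
Proof.
move=> tau_nd.
transitivity (\int[mu]_(x in `]tau 0%N, tau m])
    (\sum_(i < m) (c i ^+ 2 * \1_(`]tau i, tau i.+1]) x))).
  apply: eq_Rintegral => x; rewrite inE/= in_itv/= => /andP[x0 xm].
  have [i im ixi] := step_interval x0 xm.
  rewrite (stepE _ tau_nd im ixi).
  by rewrite -[RHS]/(step m tau (fun i => c i ^+ 2) x) (stepE _ tau_nd im ixi).
have ii (i : 'I_m) : mu.-integrable `]tau 0%N, tau m]
    (fun x => (c i ^+ 2)%:E * (\1_(`]tau i, tau i.+1]) x : R)%:E)%E.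
  apply: integrableZl => //; apply: (@integrableS _ _ _ _ setT) => //.
  exact: (integrable_indic_itv _ _ false false).
rewrite /Rintegral; under eq_integral do rewrite -sumEFin.
under eq_integral do under eq_bigr do rewrite EFinM.
rewrite integral_sum//.
rewrite (_ : (\sum_(i < m) _)%E = (\sum_(i < m) c i ^+ 2 * (tau i.+1 - tau i))%:E)//.
rewrite -sumEFin; apply: eq_bigr => i _.
rewrite integralZl//; last first.
  apply: (@integrableS _ _ _ _ setT) => //.
  exact: (integrable_indic_itv _ _ false false).
rewrite integral_indic// setIidl; last first.
  move=> x /=; rewrite !in_itv/= => /andP[ix xi].
  have im := ltn_ord i.
  rewrite (le_lt_trans _ ix) ?(le_trans xi)//; apply: (le_upto tau_nd); lia.
rewrite [X in (_ * X)%E]lebesgue_measure_itv/= lte_fin EFinM.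
have := tau_nd i (ltn_ord i); rewrite le_eqVlt => /predU1P[->|h].
  by rewrite ltxx subrr.
by rewrite h -EFinB.
Qed.

(** On a uniform mesh, the values of [h] at the right ends of the cells converge pointwise by
    continuity, and the bound [M] gives dominated convergence. *)
Lemma continuous_step_approx (h : R -> R) (a M : R) : a < 1 -> continuous h ->
  (forall x, `|h x| <= M) -> forall e, 0 < e ->
  exists (m : nat) (tau c : nat -> R), [/\ tau 0%N = a, tau m = 1,
    forall i, (i < m)%N -> tau i <= tau i.+1,
    forall i, `|c i| <= M &
    (\int[mu]_(x in `]a, 1%R]) `|h x - step m tau c x|%:E <= e%:E)%E].
Proof.
move=> a1 ch hM e e0.
have a1' : 0 < 1 - a by rewrite subr_gt0.
pose tau n i : R := a + i%:R * ((1 - a) / n.+1%:R).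
pose c n i := h (tau n i.+1).
have tau_nd n i : tau n i <= tau n i.+1.
  rewrite lerD2l ler_wpM2r ?ler_nat// divr_ge0// ltW//.
have tau0 n : tau n 0%N = a by rewrite /tau mul0r addr0.
have tau1 n : tau n n.+1 = 1.
  by rewrite /tau mulrC divfK ?pnatr_eq0// addrC subrK.
have mh : measurable_fun `]a, 1%R] (EFin \o h).
  apply/measurable_EFinP/measurable_funTS; exact: continuous_measurable_fun.
have cvgs : {ae mu, forall x, `]a, 1%R]%classic x ->
    (step n.+1 (tau n) (c n) x)%:E @[n --> \oo] --> (h x)%:E}.
  apply: aeW => x /=; rewrite in_itv/= => /andP[ax x1].
  apply/cvg_EFin; first by apply: nearW.
  apply/cvgrPdist_le => eps eps0.
  have /cvgrPdist_le/(_ _ eps0)/nbhs_ballP[r /= r0 hr] := ch x.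
  near=> n.
  have x0 : tau n 0%N < x by rewrite tau0.
  have xn : x <= tau n n.+1 by rewrite tau1.
  have [i im ixi] := step_interval x0 xn.
  rewrite (stepE _ (fun i _ => tau_nd n i) im ixi); apply: hr.
  move/andP: ixi => [ix xi]; rewrite /ball/= ler0_norm ?subr_le0// opprB.
  apply: (@le_lt_trans _ _ ((1 - a) / n.+1%:R)).
    rewrite lerBlDr (le_trans _ (lerD (lexx _) (ltW ix)))//.
    by rewrite /tau -[i.+1]addn1 natrD mulrDl mul1r addrA addrC.
  rewrite ltr_pdivrMr// mulrC -ltr_pdivrMr//.
  have nr : (1 - a) / r < n%:R by near: n; exact: nbhs_infty_gtr.
  by rewrite (lt_le_trans nr)// ler_nat.
have bnds : {ae mu, forall x n, `]a, 1%R]%classic x ->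
    (`|(step n.+1 (tau n) (c n) x)%:E| <= (cst M%:E) x)%E}.
  apply: aeW => x n /=; rewrite in_itv/= => /andP[ax x1].
  have x0 : tau n 0%N < x by rewrite tau0.
  have xn : x <= tau n n.+1 by rewrite tau1.
  have [i im ixi] := step_interval x0 xn.
  by rewrite (stepE _ (fun i _ => tau_nd n i) im ixi) lee_fin; exact: hM.
have iM : mu.-integrable `]a, 1%R] (cst M%:E).
  apply: (@measurable_bounded_integrable _ _ _ _ (cst M)) => //.
    by rewrite [X in (X < _)%E]lebesgue_measure_itv/= lte_fin a1 -EFinB ltry.
  exact: bounded_cst.
have mst n : measurable_fun `]a, 1%R] (fun x => (step n.+1 (tau n) (c n) x)%:E).
  by apply/measurable_EFinP; exact: measurable_step.
have [_ + _] := @dominated_convergence _ (measurableTypeR R) R mu `]a, 1%R]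
  (measurable_itv _) (fun n x => (step n.+1 (tau n) (c n) x)%:E) (EFin \o h)
  (cst M%:E) mst mh cvgs iM bnds.
move=> /fine_cvgP[fing /cvgrPdist_le/(_ _ e0) H].
near \oo => n; exists n.+1, (tau n), (c n); split => //.
- by move=> i; exact: hM.
- have -> : (\int[mu]_(x in `]a, 1%R]) `|h x - step n.+1 (tau n) (c n) x|%:E =
     \int[mu]_(x in `]a, 1%R]) `|(step n.+1 (tau n) (c n) x)%:E - (h x)%:E|)%E.
    by apply: eq_integral => x _; rewrite -EFinB/= distrC.
  have fn : (\int[mu]_(x in `]a, 1%R]) `|(step n.+1 (tau n) (c n) x)%:E - (h x)%:E|)%E \is a fin_num.
    by near: n; exact: fing.
  rewrite -(fineK fn) lee_fin (le_trans (ler_norm _))// -normrN -sub0r.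
  by near: n; exact: H.
Unshelve. all: by end_near. Qed.

(** Continuous functions are dense in L^1. Since truncation keeps every approximant bounded by [M],
    an L^1 error controls both the squared error and the difference of the squares, with the factor
    [2 * M]. *)
Lemma step_approx (f : R -> R) (a M : R) : a < 1 -> 0 <= M ->
  measurable_fun `]a, 1%R] f -> (forall x, a < x <= 1 -> `|f x| <= M) ->
  forall e, 0 < e -> exists (m : nat) (tau c : nat -> R),
  [/\ tau 0%N = a, tau m = 1, forall i, (i < m)%N -> tau i <= tau i.+1,
    \int[mu]_(x in `]a, 1%R]) (f x - step m tau c x) ^+ 2 <= e &
    `|\sum_(i < m) c i ^+ 2 * (tau i.+1 - tau i) - \int[mu]_(x in `]a, 1%R]) f x ^+ 2| <= e].
Proof.
move=> a1 M0 mf fM e e0.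
have Dfin : (mu `]a, 1%R] < +oo)%E.
  by rewrite [X in (X < _)%E]lebesgue_measure_itv/= lte_fin a1 -EFinB ltry.
have bi (k : R -> R) (K : R) : measurable_fun `]a, 1%R] k ->
    (forall x, a < x <= 1 -> `|k x| <= K) -> mu.-integrable `]a, 1%R] (EFin \o k).
  move=> mk kK; apply: measurable_bounded_integrable => //.
  exists K; split; first exact: num_real.
  move=> y Ky x /=; rewrite in_itv/= => xa; exact: le_trans (kK _ xa) (ltW Ky).
(* Chosen so that [2 * M * eta <= e]; the summand 1 covers [M = 0]. *)
pose eta := e / (4 * M + 1).
have M1 : 0 < 4 * M + 1 by lra.
have eta0 : 0 < eta by rewrite divr_gt0.
have eta20 : 0 < eta / 2 by rewrite divr_gt0.
have [g [cg ig]] := approximation_continuous_integrable (measurable_itv _) Dfin (bi _ _ mf fM).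
move=> /fine_cvgP[fing /cvgrPdist_le/(_ _ eta20) H].
near \oo => n.
have fn : (\int[mu]_(x in `]a, 1%R]) `|(f x - g n x)%:E|)%E \is a fin_num.
  by near: n; exact: fing.
have fg : (\int[mu]_(x in `]a, 1%R]) `|(f x - g n x)%:E| <= (eta / 2)%:E)%E.
  rewrite -(fineK fn) lee_fin (le_trans (ler_norm _))// -normrN -sub0r.
  by near: n; exact: H.
pose h x := clip M (g n x).
have ch : continuous h.
  move=> x; apply/cvgrPdist_le => r r0; have /cvgrPdist_le/(_ _ r0) := cg n x.
  by apply: filterS => y; apply: le_trans; exact: ler_dist_clip.
have hM x : `|h x| <= M by exact: normr_clip.
have [m [tau [c [tau0 taum tau_nd cM hs]]]] := continuous_step_approx a1 ch hM eta20.
set D := `]a, 1%R]%classic; have mD : measurable D by exact: measurable_itv.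
set st := step m tau c; have mst : measurable_fun D st by exact: measurable_step.
have DE x : D x -> a < x <= 1 by rewrite /D/= in_itv/=.
have sM x : a < x <= 1 -> `|st x| <= M.
  move=> /andP[ax x1]; rewrite -tau0 in ax; rewrite -taum in x1.
  by have [i im ixi] := step_interval ax x1; rewrite /st (stepE _ tau_nd im ixi).
have mgn : measurable_fun D (g n).
  by apply: measurable_funTS; exact: continuous_measurable_fun.
have mh : measurable_fun D h by exact: measurable_clip.
have mdiff (k l : R -> R) : measurable_fun D k -> measurable_fun D l ->
    measurable_fun D (fun x => `|k x - l x|).
  by move=> mk ml; apply: measurableT_comp => //; exact: measurable_funB.
have ifs : mu.-integrable D (EFin \o (fun x => `|f x - st x|)).
  apply: (bi _ (M + M)); first exact: mdiff.
  move=> x xa; rewrite normr_id (le_trans (ler_normB _ _))// lerD ?fM ?sM//.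
have fs : \int[mu]_(x in D) `|f x - st x| <= eta.
  rewrite /Rintegral -lee_fin fineK; last exact: (integrable_fin_num _ ifs).
  apply: (@le_trans _ _ (\int[mu]_(x in D) (`|f x - g n x|%:E + `|h x - st x|%:E))%E).
    apply: ge0_le_integral => //.
    - by apply/measurable_EFinP; exact: mdiff.
    - by apply: emeasurable_funD; apply/measurable_EFinP; exact: mdiff.
    - move=> x /DE xa; rewrite -EFinD lee_fin.
      apply: (@le_trans _ _ (`|f x - h x| + `|h x - st x|)).
        by rewrite (_ : f x - st x = (f x - h x) + (h x - st x)) ?ler_normD//; ring.
      by rewrite lerD2r -{1}(clip_id (fM _ xa)); exact: ler_dist_clip.
  rewrite ge0_integralD//; try by apply/measurable_EFinP; exact: mdiff.
  by rewrite [eta]splitr EFinD; apply: leeD.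
have Meta : 2 * M * eta <= e.
  rewrite /eta mulrA ler_pdivrMr// mulrC ler_pM2l//; lra.
have iMfs : mu.-integrable D (EFin \o (fun x => 2 * M * `|f x - st x|)).
  apply: (bi _ (2 * M * (M + M))).
    by apply: measurable_funM => //; exact: mdiff.
  move=> x xa; rewrite normrM normr_id ger0_norm ?mulr_ge0// ler_wpM2l ?mulr_ge0//.
  by rewrite (le_trans (ler_normB _ _))// lerD ?fM ?sM.
have i2 (k : R -> R) (K : R) : measurable_fun D k ->
    (forall x, a < x <= 1 -> `|k x| <= K) -> mu.-integrable D (EFin \o (fun x => k x ^+ 2)).
  move=> mk kK; apply: (bi _ (K * K)); first exact: measurable_funX.
  by move=> x xa; rewrite expr2 normrM ler_pM// kK.
have le2 : 2 * M * \int[mu]_(x in D) `|f x - st x| <= e.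
  by apply: le_trans Meta; rewrite ler_wpM2l// mulr_ge0.
exists m, tau, c; split => //.
- apply: le_trans le2; rewrite -RintegralZl//; apply: le_Rintegral => //.
    apply: (i2 _ (M + M)); first exact: measurable_funB.
    by move=> x xa; rewrite (le_trans (ler_normB _ _))// lerD ?fM ?sM.
  move=> x /DE xa; rewrite -real_normK ?num_real// expr2 ler_wpM2r//.
  by rewrite (le_trans (ler_normB _ _))// mulr_natl mulr2n lerD ?fM ?sM.
- rewrite -integral_step_sqr// tau0 taum -/D -/st.
  apply: le_trans le2; rewrite -RintegralZl//; apply: le_normr_RintegralB => //.
  + exact: (i2 _ M).
  + exact: (i2 _ M).
  move=> x /DE xa; rewrite subr_sqr normrM mulrC distrC ler_wpM2r//.
  by rewrite (le_trans (ler_normD _ _))// mulr_natl mulr2n lerD ?fM ?sM.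
Unshelve. all: by end_near. Qed.

End step_functions.

Lemma cvge0_near_le {R : realType} (a : nat -> \bar R) (e : R) :
  a k @[k --> \oo] --> 0%E -> 0 < e -> \forall k \near \oo, (a k <= e%:E)%E.
Proof.
move=> /fine_cvgP[fina /cvgrPdist_le ca] e0; have H := ca _ e0.
near=> k; have fk : a k \is a fin_num by near: k; exact: fina.
rewrite -(fineK fk) lee_fin (le_trans (ler_norm _))// -normrN -sub0r.
by near: k; exact: H.
Unshelve. all: by end_near. Qed.

(** * Ito integrals and step integrals *)

Section mean_square_bounds.
Context {R : realType} {d : measure_display} {T : measurableType d}.
Variable P : probability T R.

Lemma mean_square_wsum2 (a b : R) (X Y Z : T -> R) : 0 <= a -> 0 <= b ->
  measurable_fun setT X -> measurable_fun setT Y -> measurable_fun setT Z ->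
  (forall w, X w ^+ 2 <= a * Y w ^+ 2 + b * Z w ^+ 2) ->
  (mean_square P X <= a%:E * mean_square P Y + b%:E * mean_square P Z)%E.
Proof.
move=> a0 b0 mX mY mZ H; rewrite !mean_squareE.
have m2 (W : T -> R) : measurable_fun setT W -> measurable_fun setT (fun w => (W w ^+ 2)%:E).
  by move=> mW; apply/measurable_EFinP; exact: measurable_funX.
have s0 (W : T -> R) w : (0 <= (W w ^+ 2)%:E)%E by rewrite lee_fin sqr_ge0.
rewrite -!ge0_integralZl ?lee_fin//; try by [exact: m2|move=> w _; exact: s0].
rewrite -ge0_integralD//; last 4 first.
- by move=> w _; rewrite mule_ge0 ?lee_fin// sqr_ge0.
- by apply: emeasurable_funM => //; exact: m2.
- by move=> w _; rewrite mule_ge0 ?lee_fin// sqr_ge0.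
- by apply: emeasurable_funM => //; exact: m2.
apply: ge0_le_integral => //.
- exact: m2.
- by apply: emeasurable_funD; apply: emeasurable_funM => //; exact: m2.
- by move=> w _; rewrite -!EFinM -EFinD lee_fin.
Qed.

Lemma mean_squareZ (a : R) (X : T -> R) : measurable_fun setT X ->
  mean_square P (fun w => a * X w) = ((a ^+ 2)%:E * mean_square P X)%E.
Proof.
move=> mX; rewrite !mean_squareE -ge0_integralZl ?lee_fin ?sqr_ge0//.
- by apply: eq_integral => w _; rewrite exprMn EFinM.
- by apply/measurable_EFinP; exact: measurable_funX.
- by move=> w _; rewrite lee_fin sqr_ge0.
Qed.

Lemma section_measurable (D : set R) (h : R -> T -> R) (t : R) : measurable D ->
  D t -> measurable_fun (D `*` setT : set (R * T)) (fun z => h z.1 z.2) ->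
  measurable_fun setT (h t).
Proof.
move=> mD Dt mh; have mDT : measurable (D `*` setT : set (R * T)) by exact: measurableX.
move=> _ A mA; have := mh mDT A mA => /(measurable_xsection t).
rewrite (_ : xsection _ _ = h t @^-1` A) ?setTI//.
by apply/seteqP; split => w; rewrite /xsection/= inE/= => // -[].
Qed.

Lemma measurable_fun_fst (f : R -> R) : measurable_fun (`[0, 1] : set R) f ->
  measurable_fun ((`[0, 1] : set R) `*` setT : set (R * T)) (fun z => f z.1).
Proof.
move=> mf; apply: (measurable_comp (F := (`[0, 1] : set R))) mf _ => //.
  by move=> _ [[x w] [/= x01 _] <-].
by apply: measurable_funTS; exact: measurable_fst.
Qed.

Lemma measurable_mean_square (h : R -> T -> R) :
  measurable_fun ((`[0, 1] : set R) `*` setT : set (R * T)) (fun z => h z.1 z.2) ->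
  measurable_fun (`[0, 1] : set R) (fun t => mean_square P (h t)).
Proof.
move=> mh; have mD : measurable ((`[0, 1] : set R) `*` setT : set (R * T)).
  by apply: measurableX.
pose g : R * T -> \bar R := ((fun z => (h z.1 z.2 ^+ 2)%:E) \_ (`[0%R, 1%R] `*` setT)).
have mg : measurable_fun setT g.
  apply/(measurable_restrictT _ mD); apply/measurable_EFinP.
  exact: measurable_funX.
have g0 z : (0 <= g z)%E.
  by apply: erestrict_ge0 => x _; rewrite lee_fin sqr_ge0.
have := measurable_fun_fubini_tonelli_F (m2 := P) g mg g0.
move/(@measurable_funTS _ _ _ _ (`[0, 1] : set R)); apply: eq_measurable_fun => t tD.
rewrite mean_squareE /fubini_F; apply: eq_integral => w _.
by rewrite /g patchE mem_set//; split => //; exact: set_mem.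
Qed.

End mean_square_bounds.

Section ito_integrals.
Context {R : realType} {d : measure_display} {T : measurableType d}.
Variables (P : probability T R) (B : R -> T -> R).
Hypothesis hB : standard_brownian_motion P B.
Hypothesis hF : forall A : set T,
  measurable A <-> completion P (sigma_of_process B 1) A.
Local Notation FB := (natural_filtration P B).
Local Notation m2 := (@normal_moment2 R).
Local Notation D01 := ((`[0, 1] : set R) `*` setT : set (R * T)).

Lemma progressive_measurable1 (u : R -> T -> R) :
  progressively_measurable FB u -> measurable_fun D01 (fun z => u z.1 z.2).
Proof.
have m01 : 0 <= (1 : R) <= 1 by rewrite ler01 lexx.
move=> /(_ _ m01) mu.
have mid : measurable_fun setT (fun z : R * T => (z.1, z.2 : g_sigma_algebraType (FB 1))).
  apply: measurable_fun_pair; first exact: measurable_fst.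
  have := @measurable_snd _ _ R T.
  exact: measurableT_comp (measurable_id_filtration hB hF m01).
have mD : measurable D01 by apply: measurableX.
have mD' : measurable ((`[0, 1] : set R) `*` setT : set (R * g_sigma_algebraType (FB 1))).
  by apply: measurableX.
move=> _ V mV; have := mid measurableT _ (mu mD' V mV).
by rewrite setTI.
Qed.

Lemma measurable_simple_process (S : simple_process FB) :
  measurable_fun D01 (fun z => sp_value S z.1 z.2).
Proof.
apply: measurable_funTS; apply: measurable_sum => i; apply: measurable_funM.
- have mc := adapted_measurable hB hF (sp_time01 (ltnW (ltn_ord i)))
    (sp_coef_adapted (ltn_ord i)).
  exact: measurableT_comp mc measurable_snd.
- have mi : measurable_fun setT (\1_(`]sp_time S i, sp_time S i.+1]) : R -> R).
    exact: measurable_indic.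
  exact: measurableT_comp mi measurable_fst.
Qed.

Definition step_integral (m : nat) (tau c : nat -> R) (w : T) : R :=
  \sum_(i < m) c i * (B (tau i.+1) w - B (tau i) w).

Section step.
Variables (m : nat) (tau c : nat -> R) (V : T -> R) (K : R).
Hypotheses (tau0 : 0 <= tau 0%N) (taum : tau m <= 1).
Hypothesis tau_nd : forall i, (i < m)%N -> tau i <= tau i.+1.
Hypothesis mV : measurable_fun [set: g_sigma_algebraType (FB (tau 0%N))] V.
Hypothesis VK : forall w, `|V w| <= K.

Let tau01 i : (i <= m)%N -> 0 <= tau i <= 1.
Proof.
move=> im; rewrite (le_trans tau0 (le_upto tau_nd (i := 0%N) (j := i) im))/=.
by apply: le_trans taum; apply: (le_upto tau_nd); rewrite im leqnn.
Qed.

Let mVT : measurable_fun setT V.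
Proof. exact: adapted_measurable (tau01 (leq0n m)) mV. Qed.

Lemma measurable_step_integral : measurable_fun setT (step_integral m tau c).
Proof.
apply: measurable_sum => i; apply: measurable_funM => //.
by apply: (measurable_increment hB); apply: tau01; [exact: ltnW|].
Qed.

(** The isometry is applied over the disjoint sum of the cells of [S] and those of the step
    function, the latter with coefficients [- c j * V], so the difference is a single sum over
    overlapping intervals. *)
Lemma simple_process_step_isometry (S : simple_process FB) :
  mean_square P (fun w => sp_integral S B w - V w * step_integral m tau c w) =
  (m2%:E * \int[lebesgue_measure]_(t in `[0%R, 1%R])
    mean_square P (fun w => sp_value S t w - V w * step m tau c t)%R)%E.
Proof.
pose s (i : 'I_(sp_size S) + 'I_m) : R :=
  match i with inl i => sp_time S i | inr j => tau j end.
pose t (i : 'I_(sp_size S) + 'I_m) : R :=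
  match i with inl i => sp_time S i.+1 | inr j => tau j.+1 end.
pose xi (i : 'I_(sp_size S) + 'I_m) : T -> R :=
  match i with inl i => sp_coef S i | inr j => fun w => - c j * V w end.
have st i : 0 <= s i <= t i.
  case: i => i /=.
  - have /andP[-> _] := sp_time01 (ltnW (ltn_ord i)).
    by rewrite sp_time_nd// ltn_ord.
  - by have /andP[-> _] := tau01 (ltnW (ltn_ord i)); rewrite tau_nd.
have t1 i : t i <= 1.
  case: i => i /=.
  - by have /andP[] := sp_time01 (ltn_ord i).
  - by have /andP[] := tau01 (ltn_ord i).
have mxi i : measurable_fun [set: g_sigma_algebraType (FB (s i))] (xi i).
  case: i => i /=; first exact: sp_coef_adapted (ltn_ord i).
  apply: measurable_funM => //; apply: adaptedS mV.
  by apply: (le_upto tau_nd); rewrite leq0n ltnW.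
have bxi i : exists M : R, forall w, `|xi i w| <= M.
  case: i => i /=; first exact: sp_coef_bounded (ltn_ord i).
  exists (`|c i| * K) => w; rewrite normrM normrN; exact: ler_wpM2l.
have := ito_isometry hB hF st t1 mxi bxi.
have -> : (fun w => \sum_i xi i w * (B (t i) w - B (s i) w)) =
    (fun w => sp_integral S B w - V w * step_integral m tau c w).
  apply/funext => w; rewrite big_sumType/=; congr (_ + _).
  rewrite /step_integral mulr_sumr -sumrN; apply: eq_bigr => j _; ring.
move=> ->; congr (_ * _)%E; apply: eq_integral => x _; congr (mean_square P _).
apply/funext => w; rewrite big_sumType/=; congr (_ + _).
rewrite /step mulr_sumr -sumrN; apply: eq_bigr => j _; ring.
Qed.

(** [F] is reached only through its simple processes. One passes from [F] to the integral of [S k],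
    then by the isometry to integrands, then from [S k] to [v]. The two splittings of a square cost
    a factor 2 each, whence the 4, and the errors due to [S k] vanish as [k] grows. *)
Lemma ito_integral_step_dist (v : R -> T -> R) (F : T -> R) :
  measurable_fun D01 (fun z => v z.1 z.2) -> is_ito_integral P FB B v F ->
  (mean_square P (fun w => F w - V w * step_integral m tau c w)%R <=
  (4 * m2)%:E * \int[lebesgue_measure]_(t in `[0%R, 1%R])
    mean_square P (fun w => v t w - V w * step m tau c t)%R)%E.
Proof.
move=> mv [mF [S [cS cI]]].
set J := (\int[lebesgue_measure]_(t in _) mean_square P (fun w => v t w - _)%R)%E.
have m20 := @normal_moment2_ge0 R.
have mVs : measurable_fun D01 (fun z => V z.2 * step m tau c z.1).
  apply: measurable_funTS; apply: measurable_funM.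
    exact: measurableT_comp mVT measurable_snd.
  have ms : measurable_fun setT (step m tau c) by exact: measurable_step.
  exact: measurableT_comp ms measurable_fst.
have mI k : measurable_fun setT (sp_integral (S k) B).
  apply: measurable_sum => i; have iS := ltn_ord i; apply: measurable_funM.
    exact: adapted_measurable (sp_time01 (ltnW iS)) (sp_coef_adapted iS).
  by apply: (measurable_increment hB); apply: sp_time01; [exact: ltnW|].
have mVG : measurable_fun setT (fun w => V w * step_integral m tau c w).
  by apply: measurable_funM => //; exact: measurable_step_integral.
have bound k : (mean_square P (fun w => F w - V w * step_integral m tau c w)%R <=
   2%:E * mean_square P (fun w => sp_integral (S k) B w - F w)%R +
   (4 * m2)%:E * \int[lebesgue_measure]_(t in `[0%R, 1%R])
       mean_square P (fun w => sp_value (S k) t w - v t w)%R + (4 * m2)%:E * J)%E.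
  apply: (@le_trans _ _ (2%:E * mean_square P (fun w => sp_integral (S k) B w - F w)%R +
    2%:E * mean_square P (fun w => sp_integral (S k) B w - V w * step_integral m tau c w)%R)%E).
    apply: mean_square_wsum2 => //; try exact: measurable_funB.
    move=> w; rewrite -subr_ge0.
    rewrite (_ : _ - _ = (2 * sp_integral (S k) B w - F w - V w * step_integral m tau c w) ^+ 2).
      exact: sqr_ge0.
    by ring.
  rewrite -addeA leeD2l// simple_process_step_isometry.
  set J1 := (\int[lebesgue_measure]_(t in `[0%R, 1%R]) mean_square P (fun w => sp_value (S k) t w - v t w)%R)%E.
  apply: (@le_trans _ _ (2%:E * (m2%:E * (2%:E * J1 + 2%:E * J)))%E); last first.
    rewrite muleA -EFinM ge0_muleDr ?mule_ge0 ?lee_fin//; last 2 first.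
    - by apply: integral_ge0 => t _; exact: mean_square_ge0.
    - by apply: integral_ge0 => t _; exact: mean_square_ge0.
    rewrite !muleA -!EFinM (_ : 2 * m2 * 2 = 4 * m2)//; ring.
  rewrite lee_pmul2l// lee_wpmul2l ?lee_fin//.
  have mJ1 : measurable_fun (`[0, 1] : set R) (fun t => mean_square P (fun w => sp_value (S k) t w - v t w)).
    apply: measurable_mean_square; apply: measurable_funB => //.
    exact: measurable_simple_process.
  have mJ : measurable_fun (`[0, 1] : set R) (fun t => mean_square P (fun w => v t w - V w * step m tau c t)).
    by apply: measurable_mean_square; exact: measurable_funB.
  rewrite -!ge0_integralZl//; try by [move=> t _; exact: mean_square_ge0].
  rewrite -ge0_integralD//; last 4 first.
  - by move=> t _; rewrite mule_ge0 ?mean_square_ge0.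
  - by apply: emeasurable_funM.
  - by move=> t _; rewrite mule_ge0 ?mean_square_ge0.
  - by apply: emeasurable_funM.
  apply: ge0_le_integral => //.
  - by move=> t _; exact: mean_square_ge0.
  - apply: measurable_mean_square; apply: measurable_funB => //.
    exact: measurable_simple_process.
  - by apply: emeasurable_funD; apply: emeasurable_funM.
  move=> t t01.
  have mSt := section_measurable (measurable_itv _) t01 (measurable_simple_process (S k)).
  have mvt := section_measurable (measurable_itv _) t01 mv.
  have mVt : measurable_fun setT (fun w => V w * step m tau c t) by exact: measurable_funM.
  apply: mean_square_wsum2 => //; try exact: measurable_funB.
  move=> w; rewrite -subr_ge0.
  rewrite (_ : _ - _ = (sp_value (S k) t w - 2 * v t w + V w * step m tau c t) ^+ 2).
    exact: sqr_ge0.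
  by ring.
apply/lee_addgt0Pr => e e0.
pose e1 := e / (2 + 4 * m2).
have K0 : 0 < 2 + 4 * m2 by lra.
have e10 : 0 < e1 by rewrite divr_gt0.
near \oo => k.
apply: (le_trans (bound k)); rewrite addeC leeD2l//.
apply: (@le_trans _ _ (2%:E * e1%:E + (4 * m2)%:E * e1%:E)%E).
  apply: leeD.
  - by rewrite lee_pmul2l//; near: k; exact: cvge0_near_le.
  - by rewrite lee_wpmul2l ?lee_fin ?mulr_ge0//; near: k; exact: cvge0_near_le.
by rewrite -!EFinM -EFinD lee_fin -mulrDl /e1 mulrC divfK// gt_eqF.
Unshelve. all: by end_near. Qed.

End step.
End ito_integrals.

(** * Distance from the integrand to a step integrand *)

Section integrand_distance.
Context {R : realType} {d : measure_display} {T : measurableType d}.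
Variable P : probability T R.
Local Notation mu := (@lebesgue_measure R).
Local Notation D01 := ((`[0, 1] : set R) `*` setT : set (R * T)).

(** Up to time [tau 0] the step function vanishes and the smallness of [phi] suffices. Afterwards
    the difference is phi (u_t - u_1) + phi (u_1 - V) + (phi - step) V. The factor phi^2 of the
    first two terms is only integrated, never bounded pointwise, because [phi] may concentrate near
    1. *)
Lemma integrand_step_dist (u : R -> T -> R) (phi : R -> R) (V : T -> R)
    (m : nat) (tau c : nat -> R) (eps eta eta' K : R) :
  measurable_fun D01 (fun z => u z.1 z.2) ->
  measurable_fun (`[0, 1] : set R) phi -> measurable_fun setT V ->
  0 <= tau 0%N < 1 -> (forall i, (i < m)%N -> tau i <= tau i.+1) ->
  0 <= eta -> 0 <= eta' -> 0 <= K ->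
  (forall t, 0 <= t <= tau 0%N -> 0 <= phi t <= eps) ->
  (forall t, tau 0%N < t <= 1 ->
     (mean_square P (fun w => u t w - u 1 w)%R <= eta%:E)%E) ->
  (mean_square P (fun w => u 1 w - V w)%R <= eta'%:E)%E ->
  (mean_square P V <= K%:E)%E ->
  (\int[mu]_(t in `[0%R, 1%R])
     mean_square P (fun w => phi t * u t w - V w * step m tau c t)%R <=
  (eps ^+ 2)%:E * \int[mu]_(t in `[0%R, 1%R]) mean_square P (u t) +
  (3 * (eta + eta'))%:E * \int[mu]_(t in `[0%R, 1%R]) (phi t ^+ 2)%:E +
  (3 * K)%:E * \int[mu]_(t in `]tau 0%N, 1%R]) ((phi t - step m tau c t) ^+ 2)%:E)%E.
Proof.
move=> mu_ mphi mV /andP[tau0 tau1] tau_nd eta0 eta'0 K0 phieps uu1 u1V VK.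
set st := step m tau c; have mst : measurable_fun (`[0, 1] : set R) st by exact: measurable_step.
pose a t := mean_square P (u t).
pose b t := (phi t ^+ 2)%:E.
(* Extension by zero lets the three bounds be added and compared pointwise under one integral over
   [0, 1]. *)
pose e t := ((fun t => ((phi t - st t) ^+ 2)%:E) \_ `]tau 0%N, 1%R]) t.
have mD01 : measurable (`[0, 1] : set R) by [].
have ma : measurable_fun (`[0, 1] : set R) a by exact: measurable_mean_square.
have mb : measurable_fun (`[0, 1] : set R) b.
  by apply/measurable_EFinP; exact: measurable_funX.
have sub01 : `]tau 0%N, 1%R] `<=` (`[0, 1] : set R).
  by move=> x /=; rewrite !in_itv/= => /andP[h ->]; rewrite (le_trans tau0 (ltW h)).
have me : measurable_fun (`[0, 1] : set R) e.
  apply/(measurable_restrict _ _ _).1 => //; rewrite setIidr//.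
  apply/measurable_EFinP; apply: measurable_funX; apply: measurable_funB.
  - exact: measurable_funS mphi.
  - exact: measurable_funS mst.
have a0 t : (0 <= a t)%E by exact: mean_square_ge0.
have b0 t : (0 <= b t)%E by rewrite lee_fin sqr_ge0.
have e0 t : (0 <= e t)%E by apply: erestrict_ge0 => x _; rewrite lee_fin sqr_ge0.
have eta30 : 0 <= 3 * (eta + eta') by rewrite mulr_ge0// addr_ge0.
have K30 : 0 <= 3 * K by rewrite mulr_ge0.
have -> : (\int[mu]_(t in `]tau 0%N, 1%R]) ((phi t - st t) ^+ 2)%:E =
    \int[mu]_(t in `[0%R, 1%R]) e t)%E.
  by rewrite -integral_mkcondr setIidr.
rewrite -!ge0_integralZl ?lee_fin ?sqr_ge0//;
  try by [move=> t _; rewrite lee_fin sqr_ge0|move=> t _; exact: mean_square_ge0].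
have mZ (k : R) (f : R -> \bar R) : measurable_fun (`[0, 1] : set R) f ->
    measurable_fun (`[0, 1] : set R) (fun x => k%:E * f x)%E.
  by move=> mf; apply: emeasurable_funM.
rewrite -ge0_integralD//; last 4 first.
- by move=> t _; apply: mule_ge0; [rewrite lee_fin sqr_ge0|exact: a0].
- exact: mZ.
- by move=> t _; apply: mule_ge0; [rewrite lee_fin|exact: b0].
- exact: mZ.
rewrite -ge0_integralD//; last 4 first.
- move=> t _; apply: adde_ge0; apply: mule_ge0; rewrite ?lee_fin ?sqr_ge0//.
  exact: a0.
- by apply: emeasurable_funD; exact: mZ.
- by move=> t _; apply: mule_ge0; [rewrite lee_fin|exact: e0].
- exact: mZ.
apply: ge0_le_integral => //.
- by move=> t _; exact: mean_square_ge0.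
- apply: measurable_mean_square; apply: measurable_funB.
    by apply: measurable_funM => //; exact: measurable_fun_fst.
  apply: measurable_funM; last exact: measurable_fun_fst.
  by apply: measurable_funTS; exact: measurableT_comp mV measurable_snd.
- by apply: emeasurable_funD; [apply: emeasurable_funD|]; exact: mZ.
move=> t /=; rewrite in_itv/= => /andP[t0 t1].
have mut : measurable_fun setT (u t).
  by apply: (@section_measurable _ _ _ (`[0, 1] : set R)) => //=; rewrite in_itv/= t0.
have mu1 : measurable_fun setT (u 1).
  by apply: (@section_measurable _ _ _ (`[0, 1] : set R)) => //=; rewrite in_itv/= lexx ler01.
have [ttau|taut] := leP t (tau 0%N).
  rewrite /st step_le//; under [X in mean_square P X]eq_fun do rewrite mulr0 subr0.
  rewrite mean_squareZ// -addeA; apply: (@le_trans _ _ ((eps ^+ 2)%:E * a t)%E).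
    have /andP[p0 pe] : 0 <= phi t <= eps by apply: phieps; rewrite t0.
    apply: lee_wpmul2r; first exact: a0.
    by rewrite lee_fin lerXn2r// nnegrE// (le_trans p0 pe).
  apply: leeDl; apply: adde_ge0; apply: mule_ge0; rewrite ?lee_fin ?sqr_ge0//.
have -> : e t = ((phi t - st t) ^+ 2)%:E.
  by rewrite /e patchE mem_set//= in_itv/= taut.
(* The weights 3 and 3/2 here, followed by 2 and 2 on the second term, amount to (x + y + z)^2 <= 3
   (x^2 + y^2 + z^2). *)
apply: (@le_trans _ _ (3%:E * mean_square P (fun w => phi t * (u t w - u 1 w))%R +
   (3/2)%:E * (mean_square P (fun w => phi t * (u 1 w - V w) + (phi t - st t) * V w)%R))%E).
  apply: mean_square_wsum2.
  - by [].
  - by [].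
  - by apply: measurable_funB; exact: measurable_funM.
  - by apply: measurable_funM => //; exact: measurable_funB.
  - apply: measurable_funD; apply: measurable_funM => //.
    exact: measurable_funB.
  move=> w; rewrite -subr_ge0.
  set x := phi t * (u t w - u 1 w); set q := phi t * (u 1 w - V w) + _.
  have -> : phi t * u t w - V w * st t = x + q by rewrite /x /q; ring.
  have -> : 3 * x ^+ 2 + 3 / 2 * q ^+ 2 - (x + q) ^+ 2 = (2 * x - q) ^+ 2 / 2 by field.
  by rewrite divr_ge0// sqr_ge0.
apply: (@le_trans _ _ (3%:E * mean_square P (fun w => phi t * (u t w - u 1 w))%R +
   (3/2)%:E * (2%:E * mean_square P (fun w => phi t * (u 1 w - V w))%R +
   2%:E * mean_square P (fun w => (phi t - st t) * V w)%R))%E).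
  rewrite leeD2l// lee_pmul2l// ?lte_fin//; apply: mean_square_wsum2 => //.
  - by apply: measurable_funD; apply: measurable_funM => //; exact: measurable_funB.
  - by apply: measurable_funM => //; exact: measurable_funB.
  - exact: measurable_funM.
  move=> w; rewrite -subr_ge0.
  set x := phi t * (u 1 w - V w); set q := (_ * V w).
  have -> : 2 * x ^+ 2 + 2 * q ^+ 2 - (x + q) ^+ 2 = (x - q) ^+ 2 by ring.
  exact: sqr_ge0.
rewrite !mean_squareZ//; try exact: measurable_funB.
apply: (@le_trans _ _ (3%:E * ((phi t ^+ 2)%:E * eta%:E) + (3 / 2)%:E *
   (2%:E * ((phi t ^+ 2)%:E * eta'%:E) + 2%:E * (((phi t - st t) ^+ 2)%:E * K%:E)))%E).
  apply: leeD.
    rewrite lee_pmul2l// lee_wpmul2l ?lee_fin ?sqr_ge0//; apply: uu1.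
    by rewrite taut.
  rewrite lee_pmul2l ?lte_fin//; apply: leeD; rewrite lee_pmul2l// lee_wpmul2l ?lee_fin ?sqr_ge0//.
apply: (@le_trans _ _ (((3 * (eta + eta'))%:E * b t + (3 * K)%:E * ((phi t - st t) ^+ 2)%:E))%E).
  suff : 3 * (phi t ^+ 2 * eta) + 3 / 2 * (2 * (phi t ^+ 2 * eta') + 2 * ((phi t - st t) ^+ 2 * K)) <=
      3 * (eta + eta') * phi t ^+ 2 + 3 * K * (phi t - st t) ^+ 2 by rewrite -lee_fin.
  by rewrite le_eqVlt; apply/orP; left; apply/eqP; field.
rewrite -addeA; apply: leeDr; apply: mule_ge0; last exact: a0.
by rewrite lee_fin sqr_ge0.
Qed.
End integrand_distance.

Lemma ler_dist_clip_norm {R : realType} (M x : R) : 0 <= M -> `|x - clip M x| <= `|x|.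
Proof.
move=> M0; have [xM|Mx] := leP `|x| M; first by rewrite clip_id// subrr normr0.
have [x0|x0] := leP 0 x.
  rewrite ger0_norm// in Mx *; rewrite /clip min_l; last exact: ltW.
  by rewrite max_r ?ger0_norm; lra.
rewrite ltr0_norm// in Mx *; rewrite /clip min_r; last by lra.
by rewrite max_l; [rewrite ler0_norm; lra|lra].
Qed.

(** Dominated convergence: the truncation error is eventually zero at each point and its square
    never exceeds that of [X]. *)
Lemma truncation_mean_square {R : realType} {d} {T : measurableType d}
    (P : probability T R) (X : T -> R) : square_integrable P X ->
  forall e : R, 0 < e -> exists2 M : R, 0 <= M &
    (mean_square P (fun w => X w - clip M (X w))%R <= e%:E)%E.
Proof.
move=> [mX iX] e e0.
have mXc n : measurable_fun setT (fun w => X w - clip n%:R (X w)).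
  by apply: measurable_funB => //; exact: measurable_clip.
have mf n : measurable_fun setT (fun w => ((X w - clip n%:R (X w)) ^+ 2)%:E).
  by apply/measurable_EFinP; exact: measurable_funX.
have cf : {ae P, forall w, setT w ->
    ((X w - clip n%:R (X w)) ^+ 2)%:E @[n --> \oo] --> (cst 0%E : T -> \bar R) w}.
  apply: aeW => w _; apply: cvg_near_cst; near=> n.
  rewrite clip_id ?subrr ?expr0n//; apply: ltW.
  by near: n; exact: nbhs_infty_gtr.
have bf : {ae P, forall w n, setT w ->
    (`|((X w - clip n%:R (X w)) ^+ 2)%:E| <= (X w ^+ 2)%:E)%E}.
  apply: aeW => w n _; rewrite lee_fin ger0_norm ?sqr_ge0//.
  rewrite -[leLHS]real_normK ?num_real// -[leRHS]real_normK ?num_real//.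
  by rewrite lerXn2r// ler_dist_clip_norm.
have [_ _] := dominated_convergence measurableT mf (@measurable_cst _ _ _ _ _ _) cf iX bf.
rewrite integral0 => /cvge0_near_le/(_ e0) [n _ /(_ _ (leqnn n)) H].
by exists n%:R => //; rewrite mean_squareE.
Unshelve. all: by end_near. Qed.

Lemma Rintegral_extension {R : realType} {d d'} {T : measurableType d}
    {T' : measurableType d'} (P : probability T R) (P' : probability T' R)
    (p : T' -> T) (g : T -> R) :
  extends_probability P P' p -> measurable_fun setT g ->
  P'.-integrable setT (fun w => (g (p w))%:E) ->
  \int[P']_w g (p w) = \int[P]_w g w.
Proof.
move=> [mp pP] mg ig; rewrite /Rintegral; congr fine.
pose p_ : {mfun T' >-> T} := HB.pack p (isMeasurableFun.Build _ _ _ _ _ mp).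
have mgE : measurable_fun setT (EFin \o g) by exact/measurable_EFinP.
rewrite [RHS](eq_measure_integral (distribution P' p_ : set _ -> _)); last first.
  by move=> A mA _; exact/esym/pP.
by rewrite integral_distribution.
Qed.

(** * Independence on the extension *)

Section extension.
Context {R : realType} {d d' : measure_display}.
Context {T : measurableType d} {T' : measurableType d'}.
Variables (P : probability T R) (P' : probability T' R) (B : R -> T -> R).
Variables (p : T' -> T) (Z : T' -> R).
Hypothesis hB : standard_brownian_motion P B.
Hypothesis hF : forall A : set T,
  measurable A <-> completion P (sigma_of_process B 1) A.
Hypothesis p_ext : extends_probability P P' p.
Hypothesis mZ : measurable_fun setT Z.
Hypothesis Z_normal : has_law P' Z (normal_prob 0 1).
Hypothesis Z_indep : independent_of_sigma P' Z
  (sigma_of_process (fun t w => B t (p w)) 1).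

Lemma preimage_sigma_of_process (C : set T) : sigma_of_process B 1 C ->
  sigma_of_process (fun t w => B t (p w)) 1 (p @^-1` C).
Proof.
move: C; apply: smallest_sub.
  split => /=.
  - by rewrite preimage_set0; exact: (@measurable0 _ (g_sigma_algebraType _)).
  - move=> A hA; rewrite setTD preimage_setC.
    exact: (@measurableC _ (g_sigma_algebraType _)).
  - move=> A hA; rewrite preimage_bigcup.
    exact: (@bigcupT_measurable _ (g_sigma_algebraType _)).
move=> C [s s1 [A mA <-]]; apply: sub_sigma_algebra; exists s => //.
by exists A.
Qed.

(** Independence is assumed only for the events of the lifted Brownian motion. A measurable [C]
    agrees with a Brownian event up to a null set, and null sets lift to null sets because [p]
    preserves probabilities. *)
Lemma gaussian_indep (A : set R) (C : set T) : measurable A -> measurable C ->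
  P' (Z @^-1` A `&` p @^-1` C) = (normal_prob 0 1 A * P' (p @^-1` C))%E.
Proof.
move=> mA mC; have [mp pP] := p_ext.
have m01 : 0 <= (1 : R) <= 1 by rewrite ler01 lexx.
have [C0 [N [sC0 sN PN CN]]] := (hF C).1 mC.
have mC0 := measurable_sigma_of_process hB m01 sC0.
have mN := measurable_sigma_of_process hB m01 sN.
have mpT (D : set T) : measurable D -> measurable (p @^-1` D).
  by move=> mD; rewrite -[X in measurable X]setTI; exact: mp.
have mZA : measurable (Z @^-1` A) by rewrite -[X in measurable X]setTI; exact: mZ.
have nN : P'.-negligible (p @^-1` N).
  by exists (p @^-1` N); split => //; [exact: mpT|rewrite pP].
have E (D : set T') : measurable D -> P' (D `&` p @^-1` C) = P' (D `&` p @^-1` C0).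
  move=> mD; apply: measure_eq_symdiff.
  - by apply: measurableI => //; exact: mpT.
  - by apply: measurableI => //; exact: mpT.
  - apply: negligibleS nN => w /= [[[Dw Cw] DC]|[[Dw Cw] DC]]; apply: CN.
    + by left; split => // C0w; exact: DC.
    + by right; split => // C0w; exact: DC.
rewrite E// Z_indep//; last exact: preimage_sigma_of_process.
by rewrite Z_normal// -[p @^-1` C0]setTI -E// setTI.
Qed.

(** Integrating [Z] out brings the limiting expectation back to [T], in the shape that
    [cos_step_sum] produces for step integrals, so that the two can be compared on one space. *)
Lemma limit_cos (Y V : T -> R) (M theta : R) :
  measurable_fun setT Y -> (forall w, `|Y w| <= M) -> measurable_fun setT V ->
  \int[P']_w (Y (p w) * cos (theta + V (p w) * Z w)) =
  \int[P]_w (Y w * (cos theta * chi (V w))).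
Proof.
move=> mY YM mV; have [mp pP] := p_ext.
have mcos : measurable_fun setT (@cos R).
  exact: continuous_measurable_fun (@continuous_cos R).
pose f (z : T * measurableTypeR R) := Y z.1 * cos (theta + V z.1 * z.2).
have mf : measurable_fun setT f.
  have m1 (h : T -> R) : measurable_fun setT h ->
     measurable_fun setT (fun z : T * measurableTypeR R => h z.1).
    by move=> mh; apply: measurableT_comp => //; exact: measurable_fst.
  apply: measurable_funM; first exact: m1.
  apply: measurableT_comp => //; apply: measurable_funD => //.
  by apply: measurable_funM; [exact: m1|exact: measurable_snd].
have bdd (a b c : R) : `|a| <= M -> `|b| <= 1 -> `|a * b| <= M.
  by move=> aM b1; rewrite normrM -[leRHS]mulr1 ler_pM.
transitivity (\int[P']_w (Y (p w) * (cos theta * chi (V (p w))))).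
  apply: (Rintegral_indep (X := Z : T' -> measurableTypeR R) (N := normal_prob 0 1)
     (f := f) (g := fun y => Y y * (cos theta * chi (V y))) mp mZ gaussian_indep mf).
  - apply: (@bounded_integrable _ _ _ _ _ M).
      have mpZ : measurable_fun setT (fun w => (p w, Z w : measurableTypeR R)).
        exact: measurable_fun_pair.
      exact: measurableT_comp mf mpZ.
    by move=> w; apply: bdd => //; rewrite ler_norml cos_geN1 cos_le1.
  - move=> y; rewrite /f /= EFinM -integral_normal_cos.
    by rewrite -integralZl//; exact: integrable_cosM.
have mg : measurable_fun setT (fun w => Y w * (cos theta * chi (V w))).
  apply: measurable_funM => //; apply: measurable_funM => //.
  by apply: measurableT_comp => //; exact: measurable_chi.
rewrite (Rintegral_extension (g := fun w => Y w * (cos theta * chi (V w))) p_ext)//.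
apply: (@bounded_integrable _ _ _ _ _ M); first exact: measurableT_comp mg mp.
move=> w; apply: bdd => //; rewrite normrM -[leRHS]mulr1 ler_pM//.
- by rewrite ler_norml cos_geN1 cos_le1.
- exact: normr_chi_le1.
Qed.
End extension.

(** * The limit *)

Section comparison.
Context {R : realType} {d : measure_display} {T : measurableType d}.
Variable P : probability T R.

(** The Cauchy-Schwarz bound, obtained by integrating |x| <= eta / 2 + x^2 / (2 eta). *)
Lemma mean_square_norm_le (X : T -> R) (eta : R) : measurable_fun setT X ->
  0 < eta -> (mean_square P X <= (eta ^+ 2)%:E)%E ->
  P.-integrable setT (EFin \o X) /\ \int[P]_w `|X w| <= eta.
Proof.
move=> mX eta0 Xeta.
have LX : square_integrable P X.
  by apply/square_integrableP => //; exact: le_lt_trans Xeta (ltry _).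
have iX := square_integrable_integrable LX; split => //.
have [_ iX2] := LX.
have iR : P.-integrable setT (EFin \o (fun w => (2 * eta)^-1 * X w ^+ 2)).
  exact: (integrableZl measurableT _ iX2).
have iC : P.-integrable setT (EFin \o (fun w : T => eta / 2)).
  exact: (finite_measure_integrable_cst P _ measurableT).
apply: (@le_trans _ _ (\int[P]_w (eta / 2 + (2 * eta)^-1 * X w ^+ 2))).
  apply: le_Rintegral => //; [exact: integrable_norm iX|exact: (integrableD measurableT iC iR)|].
  move=> w _; rewrite -subr_ge0.
  have -> : eta / 2 + (2 * eta)^-1 * X w ^+ 2 - `|X w| = (2 * eta)^-1 * (eta - `|X w|) ^+ 2.
    have <- : `|X w| ^+ 2 = X w ^+ 2 by rewrite real_normK ?num_real.
    by field; exact: lt0r_neq0.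
  by rewrite mulr_ge0 ?sqr_ge0// invr_ge0 mulr_ge0// ltW.
rewrite RintegralD// Rintegral_probability_cst RintegralZl//.
have H : \int[P]_w (X w ^+ 2) <= eta ^+ 2.
  move: Xeta; rewrite mean_squareE /Rintegral => Xeta.
  by rewrite -lee_fin fineK//; exact: (integrable_fin_num _ iX2).
have eta20 : 0 < 2 * eta by rewrite mulr_gt0.
have : (2 * eta)^-1 * \int[P]_w (X w ^+ 2) <= (2 * eta)^-1 * eta ^+ 2.
  by rewrite ler_wpM2l// invr_ge0 ltW.
have -> : (2 * eta)^-1 * eta ^+ 2 = eta / 2 by field; exact: lt0r_neq0.
lra.
Qed.

(** Serves at both ends of the comparison: once with [a] and [b] cosines of the Ito and step
    integrals, once with [a] and [b] values of [chi] before and after the replacement of [u 1]. *)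
Lemma Rintegral_prod_dist (Y W a b D : T -> R) (M : R) :
  measurable_fun setT Y -> measurable_fun setT W ->
  measurable_fun setT a -> measurable_fun setT b ->
  (forall w, `|Y w| <= M) -> (forall w, `|W w| <= M) ->
  (forall w, `|a w| <= 1) -> (forall w, `|b w| <= 1) ->
  P.-integrable setT (EFin \o D) -> (forall w, `|a w - b w| <= D w) ->
  `|\int[P]_w (Y w * a w) - \int[P]_w (W w * b w)| <=
  \int[P]_w `|Y w - W w| + M * \int[P]_w D w.
Proof.
move=> mY mW ma mb YM WM a1 b1 iD abD.
have bdd (x y : R) : `|x| <= M -> `|y| <= 1 -> `|x * y| <= M.
  by move=> xM y1; rewrite normrM -[leRHS]mulr1 ler_pM.
have iYW : P.-integrable setT (EFin \o (fun w => `|Y w - W w|)).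
  apply: (@bounded_integrable _ _ _ _ _ (M + M)).
    by apply: measurableT_comp => //; exact: measurable_funB.
  by move=> w; rewrite normr_id (le_trans (ler_normB _ _))// lerD.
have iMD : P.-integrable setT (EFin \o (fun w => M * D w)).
  exact: (integrableZl measurableT M iD).
rewrite -(RintegralZl M measurableT iD) -RintegralD//.
apply: le_normr_RintegralB => //.
- by apply: (@bounded_integrable _ _ _ _ _ M) => [|w]; [exact: measurable_funM|exact: bdd].
- by apply: (@bounded_integrable _ _ _ _ _ M) => [|w]; [exact: measurable_funM|exact: bdd].
- exact: (integrableD measurableT iYW iMD).
move=> w _; have -> : Y w * a w - W w * b w = (Y w - W w) * a w + W w * (a w - b w) by ring.
apply: (le_trans (ler_normD _ _)); rewrite !normrM lerD//.
  by rewrite -[leRHS]mulr1 ler_wpM2l.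
by apply: ler_pM.
Qed.

End comparison.

Lemma ler_dist_sqrt {R : realType} (s L : R) : 0 <= s -> 0 < L ->
  `|Num.sqrt s - Num.sqrt L| <= `|s - L| / Num.sqrt L.
Proof.
move=> s0 L0; have rL0 : 0 < Num.sqrt L by rewrite sqrtr_gt0.
rewrite ler_pdivlMr//.
have -> : s - L = (Num.sqrt s - Num.sqrt L) * (Num.sqrt s + Num.sqrt L).
  by rewrite -subr_sqr !sqr_sqrtr// ltW.
by rewrite normrM ler_wpM2l// ger0_norm ?addr_ge0 ?sqrtr_ge0// lerDr sqrtr_ge0.
Qed.

Lemma sqr_integrable01 {R : realType} (D : set R) (f : R -> R) (M : R) :
  measurable D -> D `<=` `[0, 1] -> measurable_fun D f ->
  (forall x, D x -> `|f x| <= M) ->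
  (@lebesgue_measure R).-integrable D (EFin \o (fun x => f x ^+ 2)).
Proof.
move=> mD D01 mf fM; apply: measurable_bounded_integrable => //.
- apply: (@le_lt_trans _ _ (lebesgue_measure (`[0, 1] : set R))).
    by apply: le_measure => //; rewrite inE.
  by rewrite lebesgue_measure_itv/= lte_fin ltr01 oppr0 adde0 ltry.
- exact: measurable_funX.
exists (M * M); split; first exact: num_real.
by move=> y My x Dx /=; rewrite (le_trans _ (ltW My))// expr2 normrM ler_pM ?fM.
Qed.

(** * The quantitative estimate for one integrand *)

Section key_estimate.
Context {R : realType} {d : measure_display} {T : measurableType d}.
Variables (P : probability T R) (B : R -> T -> R).
Hypothesis hB : standard_brownian_motion P B.
Hypothesis hF : forall A : set T,
  measurable A <-> completion P (sigma_of_process B 1) A.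
Local Notation FB := (natural_filtration P B).
Local Notation m2 := (@normal_moment2 R).
Local Notation mu := (@lebesgue_measure R).

(* [W] and [V] are substitutes of [Y] and [u 1] that are known at time [delta]:
   given [FB delta], the step integral against [V] is Gaussian, which gives its
   characteristic function exactly. *)
Lemma ito_cos_dist (u : R -> T -> R) (phi : R -> R) (F Y W V : T -> R)
    (delta eps L A K M Mphi KV lam theta : R) :
  measurable_fun ((`[0, 1] : set R) `*` setT : set (R * T)) (fun z => u z.1 z.2) ->
  measurable_fun (`[0, 1] : set R) phi ->
  is_ito_integral P FB B (fun t w => phi t * u t w) F ->
  0 <= delta < 1 -> 0 < eps <= 1 -> 0 < L -> 0 <= A ->
  (forall v w : R, `|chi v - chi w| <= K * `|v - w|) -> 0 <= K ->
  (forall t, 0 <= t <= 1 -> 0 <= phi t <= Mphi) ->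
  (forall t, 0 <= t <= delta -> phi t <= eps) ->
  `|\int[mu]_(t in `[0, 1]) (phi t ^+ 2) - L| <= eps ->
  (\int[mu]_(t in `[0%R, 1%R]) mean_square P (u t) <= A%:E)%E ->
  (forall t, delta < t <= 1 ->
     (mean_square P (fun w => u t w - u 1 w)%R <= (eps ^+ 2)%:E)%E) ->
  (mean_square P (fun w => u 1 w - V w)%R <= (4 * eps ^+ 2)%:E)%E ->
  measurable_fun setT Y -> (forall w, `|Y w| <= M) ->
  measurable_fun [set: g_sigma_algebraType (FB delta)] W -> (forall w, `|W w| <= M) ->
  \int[P]_w `|Y w - W w| <= eps ->
  measurable_fun [set: g_sigma_algebraType (FB delta)] V -> (forall w, `|V w| <= KV) ->
  P.-integrable setT (EFin \o u 1) ->
  `|\int[P]_w (Y w * cos (theta + lam * F w)) -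
    \int[P]_w (Y w * (cos theta * chi (lam * (Num.sqrt L * u 1 w))))| <=
  (2 + M * `|lam| * (Num.sqrt (4 * m2 * (A + 15 * (L + 1) + 3)) + 1) +
   M * K * `|lam| * ((Num.sqrt L + 3 / Num.sqrt L) * 2 + 3 / Num.sqrt L * \int[P]_w `|u 1 w|)) * eps.
Proof.
move=> mu_ mphi Fito /andP[d0 d1] /andP[e0 e1] L0 A0 chiK K0 phiM phieps phiL uA uu1 u1V
  mY YM mW WM YW mV VK iu1.
set C2 := Num.sqrt (4 * _ * _) + 1; set rL := Num.sqrt L.
have d01 : 0 <= delta <= 1 by rewrite d0 ltW.
have mVT := adapted_measurable hB hF d01 mV.
have mWT := adapted_measurable hB hF d01 mW.
have mu1 : measurable_fun setT (u 1).
  by apply: (@section_measurable _ _ _ (`[0, 1] : set R)) => //=; rewrite in_itv/= lexx ler01.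
have KV2 : (mean_square P V <= (KV ^+ 2)%:E)%E.
  rewrite mean_squareE.
  have LV := bounded_square_integrable P mVT VK.
  rewrite -(fineK (integrable_fin_num measurableT LV.2)) lee_fin.
  rewrite -(Rintegral_probability_cst P (KV ^+ 2)).
  apply: le_Rintegral => //; first exact: LV.2.
    exact: (finite_measure_integrable_cst P _ measurableT).
  by move=> w _; rewrite -[leLHS]real_normK ?num_real// lerXn2r ?nnegrE ?(le_trans _ (VK w)).
(* The step error is multiplied by the mean square of [V], at most [KV ^+ 2]. This choice keeps the
   product below [eps ^+ 2], so that [KV] disappears from the final bound. *)
pose e := eps ^+ 2 / (KV ^+ 2 + 1).
have KV20 : 0 <= KV ^+ 2 := sqr_ge0 _.
have e20 : 0 < eps ^+ 2 by rewrite exprn_gt0.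
have ee0 : 0 < e by rewrite divr_gt0// ltr_pwDr.
have e2e : eps ^+ 2 <= eps by rewrite expr2 ler_piMr// ltW.
have ee2 : e <= eps ^+ 2.
  by rewrite ler_pdivrMr ?ltr_pwDr// ler_peMr ?(ltW e20)// lerDr.
have Mphi0 : 0 <= Mphi.
  have /andP[h1 h2] : 0 <= phi 0 <= Mphi by apply: phiM; rewrite lexx ler01.
  exact: le_trans h1 h2.
have sub1 : `]delta, 1%R] `<=` (`[0, 1] : set R).
  by move=> x /=; rewrite !in_itv/= => /andP[h ->]; rewrite (le_trans d0 (ltW h)).
have mphi1 : measurable_fun `]delta, 1%R] phi by exact: measurable_funS mphi.
have phiM' x : delta < x <= 1 -> `|phi x| <= Mphi.
  move=> /andP[dx x1]; have /andP[h1 h2] : 0 <= phi x <= Mphi.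
    by apply: phiM; rewrite x1 (le_trans d0 (ltW dx)).
  by rewrite ger0_norm.
have [m [tau [c [tau0 taum tau_nd phist sst]]]] := step_approx d1 Mphi0 mphi1 phiM' ee0.
set G := step_integral B m tau c.
pose s2 := \sum_(i < m) c i ^+ 2 * (tau i.+1 - tau i).
have s20 : 0 <= s2.
  by apply: sumr_ge0 => i _; rewrite mulr_ge0 ?sqr_ge0// subr_ge0 tau_nd.
pose sig := Num.sqrt s2.
have sig0 : 0 <= sig by exact: sqrtr_ge0.
have rL0 : 0 < rL by rewrite sqrtr_gt0.
have iphi : mu.-integrable (`[0, 1] : set R) (EFin \o (fun t => phi t ^+ 2)).
  apply: (@sqr_integrable01 _ _ _ Mphi) => // t; rewrite /= in_itv/= => t01.
  by have /andP[h1 h2] := phiM _ t01; rewrite ger0_norm.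
(* One [eps] each for the total integral of [phi ^+ 2] against [L], for its part on [0, delta], and
   for the replacement of [phi] by the step function. *)
have s2L : `|s2 - L| <= 3 * eps.
  have D0 : `[0, delta] `<=` (`[0, 1] : set R).
    by move=> x /=; rewrite !in_itv/= => /andP[-> h]; rewrite (le_trans h (ltW d1)).
  have iphi0 : mu.-integrable (`[0, delta] : set R) (EFin \o (fun t => phi t ^+ 2)).
    exact: integrableS iphi.
  have iphi1 : mu.-integrable (`]delta, 1%R] : set R) (EFin \o (fun t => phi t ^+ 2)).
    exact: integrableS iphi.
  have DU : `[0, 1]%classic = `[0, delta]%classic `|` `]delta, 1%R]%classic :> set R.
    apply/seteqP; split => x /=; rewrite !in_itv/=.
      by move=> /andP[-> ->]; rewrite !andbT; case: (leP x delta) => _; [left|right].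
    by move=> []; [exact: (D0 x)|exact: (sub1 x)].
  have split1 : \int[mu]_(t in `[0, 1]) (phi t ^+ 2) =
      \int[mu]_(t in `[0, delta]) (phi t ^+ 2) + \int[mu]_(t in `]delta, 1%R]) (phi t ^+ 2).
    rewrite DU Rintegral_setU -?DU//; apply/disj_setPS => x [] /=; rewrite !in_itv/=.
    by move=> /andP[_ h] /andP[/lt_geF]; rewrite h.
  have h0 : 0 <= \int[mu]_(t in `[0, delta]) (phi t ^+ 2).
    by apply: Rintegral_ge0 => x _; exact: sqr_ge0.
  have h1 : \int[mu]_(t in `[0, delta]) (phi t ^+ 2) <= eps.
    have mud : mu `[0, delta] = delta%:E.
      rewrite lebesgue_measure_itv/= lte_fin oppr0 adde0; case: ltP => // dle.
      by congr EFin; apply/le_anti; rewrite d0 dle.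
    have icst : mu.-integrable (`[0, delta] : set R) (EFin \o (fun t : R => eps ^+ 2)).
      exact: (@sqr_integrable01 _ _ (fun=> eps) `|eps|).
    apply: (@le_trans _ _ (\int[mu]_(t in `[0, delta]) (eps ^+ 2))).
      apply: le_Rintegral => // t; rewrite /= in_itv/= => /andP[t0 td].
      have h : 0 <= t <= delta by rewrite t0.
      have /phiM/andP[p0 _] : 0 <= t <= 1 by rewrite t0 (le_trans td (ltW d1)).
      by rewrite lerXn2r ?nnegrE ?(ltW e0)// phieps.
    rewrite Rintegral_cst// [X in fine X](_ : _ = delta%:E)//=.
    by apply: le_trans e2e; rewrite ler_piMr// ltW.
  move: phiL sst (le_trans ee2 e2e) h0 h1; rewrite split1 -/s2.
  set I0 := \int[mu]_(t in `[0, delta]) _; set I1 := \int[mu]_(t in `]_, _]) _.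
  move: (s2) (e) I0 I1; clear => s e I0 I1; rewrite !ler_norml => /andP[? ?] /andP[? ?] *.
  by apply/andP; split; lra.
have sigL : `|sig - rL| <= 3 / rL * eps.
  apply: (le_trans (ler_dist_sqrt s20 L0)); rewrite -/rL mulrAC.
  by rewrite ler_wpM2r// invr_ge0 ltW.
have m20 := @normal_moment2_ge0 R.
(* In the constant, 15 is 3 * (1 + 4), from the errors [eps ^+ 2] on [u t - u 1] and [4 * eps ^+ 2]
   on [u 1 - V]; [L + 1] bounds the integral of [phi ^+ 2], and the last 3 comes from the step
   error. The summand 1 in [C2] makes it positive. *)
have FVG : (mean_square P (fun w => F w - V w * G w)%R <= ((C2 * eps) ^+ 2)%:E)%E.
  pose C1 := 4 * m2 * (A + 15 * (L + 1) + 3).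
  have C10 : 0 <= C1 by rewrite mulr_ge0 ?mulr_ge0// !addr_ge0// mulr_ge0// addr_ge0// ltW.
  have C12 : C1 <= C2 ^+ 2.
    rewrite -[leLHS]sqr_sqrtr// lerXn2r ?nnegrE ?sqrtr_ge0 ?lerDl//.
    by rewrite addr_ge0// sqrtr_ge0.
  have mv : measurable_fun ((`[0, 1] : set R) `*` setT : set (R * T))
      (fun z => phi z.1 * u z.1 z.2).
    by apply: measurable_funM => //; exact: measurable_fun_fst.
  have tau0' : 0 <= tau 0%N by rewrite tau0.
  have taum' : tau m <= 1 by rewrite taum.
  have mV0 : measurable_fun [set: g_sigma_algebraType (FB (tau 0%N))] V by rewrite tau0.
  have dist := ito_integral_step_dist hB hF c
    (v := fun t w => phi t * u t w) tau0' taum' tau_nd mV0 VK mv Fito.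
  apply: (le_trans dist).
  have iphis : mu.-integrable (`]delta, 1%R] : set R)
      (EFin \o (fun t => (phi t - step m tau c t) ^+ 2)).
    apply: (@sqr_integrable01 _ _ _ (Mphi + \sum_(i < m) `|c i|)) => //.
      by apply: measurable_funB => //; exact: measurable_step.
    move=> x; rewrite /= in_itv/= => xd.
    rewrite (le_trans (ler_normB _ _))// lerD ?phiM'// /step.
    rewrite (le_trans (ler_norm_sum _ _ _))//; apply: ler_sum => i _.
    by rewrite normrM ler_piMr// indicE; case: (_ \in _); rewrite ?normr1 ?normr0.
  have step_dist := @integrand_step_dist _ _ _ P u phi V m tau c eps (eps ^+ 2) (4 * eps ^+ 2) (KV ^+ 2).
  apply: (@le_trans _ _ ((4 * m2)%:E * ((eps ^+ 2 * (A + 15 * (L + 1) + 3))%:E))%E).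
    apply: lee_wpmul2l; first by rewrite lee_fin mulr_ge0.
    apply: (le_trans (step_dist _ _ _ _ _ _ _ _ _ _ _ _)) => //.
    - by rewrite tau0 d0 d1.
    - exact: ltW.
    - by rewrite mulr_ge0// ltW.
    - move=> t; rewrite tau0 => /andP[t0 td]; rewrite phieps ?t0// andbT.
      by have /phiM/andP[] : 0 <= t <= 1 by rewrite t0 (le_trans td (ltW d1)).
    - by move=> t; rewrite tau0; exact: uu1.
    have -> : (eps ^+ 2 * (A + 15 * (L + 1) + 3))%:E =
        ((eps ^+ 2)%:E * A%:E + (3 * (eps ^+ 2 + 4 * eps ^+ 2))%:E * (L + 1)%:E +
         (3 * eps ^+ 2)%:E)%E.
      by rewrite -!EFinM -!EFinD; congr EFin; ring.
    apply: leeD; first apply: leeD.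
    - by apply: lee_wpmul2l => //; rewrite lee_fin ltW.
    - apply: lee_wpmul2l; first by rewrite lee_fin mulr_ge0// addr_ge0 ?mulr_ge0// ltW.
      rewrite -(fineK (integrable_fin_num _ iphi))// lee_fin.
      by move: phiL; rewrite /Rintegral ler_norml => /andP[_]; lra.
    rewrite tau0 -(fineK (integrable_fin_num _ iphis))// -EFinM lee_fin.
    rewrite -mulrA ler_wpM2l//.
    apply: (@le_trans _ _ (KV ^+ 2 * e)); first exact: ler_wpM2l.
    rewrite /e mulrA ler_pdivrMr ?ltr_pwDr// mulrC ler_wpM2l// ?ltW//.
    by rewrite ltrDl.
  rewrite -EFinM lee_fin exprMn mulrCA -/C1 [leRHS]mulrC.
  by apply: ler_wpM2l => //; exact: ltW.
have mF : measurable_fun setT F by case: Fito.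
have mG : measurable_fun setT G.
  by apply: (measurable_step_integral hB); rewrite ?tau0 ?taum.
have C20 : 0 < C2 by rewrite ltr_pwDr// sqrtr_ge0.
have mFVG : measurable_fun setT (fun w => F w - V w * G w).
  by apply: measurable_funB => //; exact: measurable_funM.
have [iFVG FVGle] := mean_square_norm_le mFVG (mulr_gt0 C20 e0) FVG.
have mu1V : measurable_fun setT (fun w => u 1 w - V w) by exact: measurable_funB.
have u1V' : (mean_square P (fun w => u 1 w - V w)%R <= ((2 * eps) ^+ 2)%:E)%E.
  by rewrite (_ : (2 * eps) ^+ 2 = 4 * eps ^+ 2)//; ring.
have [iu1V u1Vle] := mean_square_norm_le mu1V (mulr_gt0 (ltr0Sn R 1) e0) u1V'.
have mcos : measurable_fun setT (@cos R).
  exact: continuous_measurable_fun (@continuous_cos R).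
have M0 (w : T) : 0 <= M := le_trans (normr_ge0 _) (YM w).
have cosle (x : R) : `|cos x| <= 1 by rewrite ler_norml cos_geN1 cos_le1.
have ccle (x y : R) : `|cos x * chi y| <= 1.
  by rewrite normrM -[leRHS]mulr1 ler_pM// normr_chi_le1.
have mcc (f : T -> R) : measurable_fun setT f ->
    measurable_fun setT (fun w => cos theta * chi (f w)).
  move=> mf; apply: measurable_funM => //.
  by apply: measurableT_comp => //; exact: measurable_chi.
have Mge0 : 0 <= M := M0 point.
(* From the Ito integral to the step integral: the cosine is 1-Lipschitz, so the L^1 distance
   between [F] and [V * G] suffices. *)
have E1 : `|\int[P]_w (Y w * cos (theta + lam * F w)) -
    \int[P]_w (W w * cos (theta + (lam * V w) * G w))| <= eps + M * (`|lam| * (C2 * eps)).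
  apply: (le_trans (Rintegral_prod_dist (M := M)
     (D := fun w => `|lam| * `|F w - V w * G w|) _ _ _ _ _ _ _ _ _ _)) => //.
  - by apply: measurableT_comp => //; apply: measurable_funD => //; exact: measurable_funM.
  - apply: measurableT_comp => //; apply: measurable_funD => //.
    by apply: measurable_funM => //; exact: measurable_funM.
  - exact: (integrableZl measurableT `|lam| (integrable_norm iFVG)).
  - move=> w; apply: (le_trans (ler_dist_cos _ _)).
    rewrite (_ : _ - _ = lam * (F w - V w * G w)); last by ring.
    by rewrite normrM.
  rewrite RintegralZl//; last exact: integrable_norm iFVG.
  by apply: lerD => //; rewrite ler_wpM2l// ler_wpM2l.
have E2 : \int[P]_w (W w * cos (theta + (lam * V w) * G w)) =
    \int[P]_w (W w * (cos theta * chi (lam * V w * sig))).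
  apply: (cos_step_sum hB hF c theta (M := M) (V := fun w => lam * V w)); rewrite ?tau0 ?taum//.
  by apply: measurable_funM.
(* From the limit to the Gaussian value of the step integral: the arguments of [chi] differ by the
   error on [u 1], weighted by [sig], and by the error on the standard deviation, weighted by
   [u 1]. *)
have E3 : `|\int[P]_w (Y w * (cos theta * chi (lam * (rL * u 1 w)))) -
    \int[P]_w (W w * (cos theta * chi (lam * V w * sig)))| <=
    eps + M * (K * `|lam| * (sig * (2 * eps) + 3 / rL * eps * \int[P]_w `|u 1 w|)).
  have iD1 : P.-integrable setT (EFin \o (fun w => sig * `|u 1 w - V w|)).
    exact: (integrableZl measurableT sig (integrable_norm iu1V)).
  have iD2 : P.-integrable setT (EFin \o (fun w => 3 / rL * eps * `|u 1 w|)).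
    exact: (integrableZl measurableT (3 / rL * eps) (integrable_norm iu1)).
  have iD : P.-integrable setT (EFin \o (fun w => sig * `|u 1 w - V w| + 3 / rL * eps * `|u 1 w|)).
    exact: (integrableD measurableT iD1 iD2).
  apply: (le_trans (Rintegral_prod_dist (M := M)
     (D := fun w => K * `|lam| * (sig * `|u 1 w - V w| + 3 / rL * eps * `|u 1 w|)) _ _ _ _ _ _ _ _ _ _)) => //.
  - by apply: mcc; apply: measurable_funM => //; exact: measurable_funM.
  - by apply: mcc; apply: measurable_funM => //; exact: measurable_funM.
  - exact: (integrableZl measurableT (K * `|lam|) iD).
  - move=> w; rewrite -mulrBr normrM -[leRHS]mul1r ler_pM//.
    apply: (le_trans (chiK _ _)); rewrite -[leRHS]mulrA; apply: ler_wpM2l => //.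
    rewrite -[lam * V w * sig]mulrA -mulrBr normrM; apply: ler_wpM2l => //.
    rewrite (_ : _ - _ = sig * (u 1 w - V w) - (sig - rL) * u 1 w); last by ring.
    apply: (le_trans (ler_normB _ _)); rewrite !normrM (ger0_norm sig0) lerD2l.
    exact: ler_wpM2r.
  rewrite RintegralZl// RintegralD// RintegralZl//; last exact: integrable_norm iu1V.
  rewrite RintegralZl//; last exact: integrable_norm iu1.
  apply: lerD => //; rewrite ler_wpM2l// ler_wpM2l ?mulr_ge0// lerD2r ler_wpM2l//.
(* [sig] depends on the step function; since [eps <= 1], it is bounded in terms of [L] alone. *)
have sigle : sig <= rL + 3 / rL.
  have h : 3 / rL * eps <= 3 / rL by rewrite ler_piMr// divr_ge0// ltW.
  by move: (le_trans sigL h); rewrite ler_norml => /andP[_]; rewrite lerBlDl.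
set U := \int[P]_w `|u 1 w| in E3 *.
have U0 : 0 <= U by apply: Rintegral_ge0.
rewrite distrC in E3.
have -> : (2 + M * `|lam| * C2 + M * K * `|lam| * ((rL + 3 / rL) * 2 + 3 / rL * U)) * eps =
   (eps + M * (`|lam| * (C2 * eps))) +
   (eps + M * (K * `|lam| * ((rL + 3 / rL) * (2 * eps) + 3 / rL * eps * U))) by ring.
apply: (@le_trans _ _ ((eps + M * (`|lam| * (C2 * eps))) +
    (eps + M * (K * `|lam| * (sig * (2 * eps) + 3 / rL * eps * U))))); last first.
  rewrite lerD2l lerD2l ler_wpM2l// ler_wpM2l ?mulr_ge0// lerD2r ler_wpM2r// mulr_ge0//.
  exact: ltW.
rewrite E2 in E1; apply: le_trans (lerD E1 E3).
exact: ler_distD.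
Qed.

End key_estimate.

Lemma cvge0_left {R : realType} (f : R -> \bar R) (e : R) :
  f t @[t --> (1 : R)^'-] --> 0%E -> 0 < e ->
  exists2 delta, 0 <= delta < 1 & forall t, delta < t < 1 -> (f t <= e%:E)%E.
Proof.
move=> /fine_cvgP[finf /cvgrPdist_le cf] e0; have H := cf _ e0.
have /nbhs_ballP[r /= r0 hr] : \forall t \near (1 : R), t < 1 ->
    f t \is a fin_num /\ `|0 - fine (f t)| <= e by exact: filterI finf H.
exists (Num.max 0 (1 - r)); first by rewrite le_max lexx/= gt_max ltr01/= gtrBl.
move=> t /andP[]; rewrite gt_max => /andP[t0 tr] t1.
have [|ft fe] := hr t _ t1.
  by rewrite /ball/= gtr0_norm ?subr_gt0// ltrBlDr -ltrBlDl.
by rewrite -(fineK ft) lee_fin (le_trans (ler_norm _))// -normrN -sub0r.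
Qed.

Section limit.
Context {R : realType} {d : measure_display} {T : measurableType d}.
Variables (P : probability T R) (B : R -> T -> R).
Hypothesis hB : standard_brownian_motion P B.
Hypothesis hF : forall A : set T,
  measurable A <-> completion P (sigma_of_process B 1) A.
Variable u : R -> T -> R.
Hypothesis u_prog : progressively_measurable (natural_filtration P B) u.
Hypothesis u_L2 : (\int[lebesgue_measure]_(t in `[0%R, 1%R])
  mean_square P (u t) < +oo)%E.
Hypothesis u_cont1 : mean_square P (fun w => u t w - u 1 w)
  @[t --> (1 : R)^'-] --> 0%E.
Local Notation FB := (natural_filtration P B).
Local Notation mu := (@lebesgue_measure R).

Let mu_ := progressive_measurable1 hB hF u_prog.

Let mut (t : R) : 0 <= t <= 1 -> measurable_fun setT (u t).
Proof.
by move=> t01; apply: (@section_measurable _ _ _ (`[0, 1] : set R)) => //=; rewrite in_itv.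
Qed.

Let mu1 : measurable_fun setT (u 1).
Proof. by apply: mut; rewrite lexx ler01. Qed.

Lemma progressive_measurable_at (t : R) : 0 <= t <= 1 ->
  measurable_fun [set: g_sigma_algebraType (FB t)] (u t).
Proof.
move=> t01; apply: (@section_measurable _ _ _ (`[0, t] : set R)) => //.
  by have /andP[t0 _] := t01; rewrite /= in_itv/= t0 lexx.
exact: u_prog.
Qed.

(** The time integral makes the second moment finite only at almost every time. But L^2 continuity
    compares [u 1] with [u t] on a whole interval ending at 1; having positive length, it contains a
    time with finite second moment. *)
Lemma square_integrable_end : square_integrable P (u 1).
Proof.
have [delta /andP[d0 d1] hd] := cvge0_left u_cont1 (ltr01 : 0 < (1 : R)).
have [t [td t1 uty]] : exists t, [/\ delta < t, t < 1 & mean_square P (u t) \is a fin_num].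
  apply: contrapT => H.
  have iu : mu.-integrable (`[0, 1] : set R) (fun t => mean_square P (u t)).
    apply/integrableP; split; first exact: measurable_mean_square.
    by under eq_integral do rewrite gee0_abs ?mean_square_ge0//.
  have := @integrable_ae _ (measurableTypeR R) R mu _ (measurable_itv _) _ iu.
  move=> ae; have N : mu.-negligible (`]delta, 1%R[ : set R).
    apply: negligibleS ae => t /=; rewrite in_itv/= => /andP[dt t1] h.
    apply: H; exists t; split => //.
    by apply: h; rewrite in_itv/= (le_trans d0 (ltW dt)) ltW.
  have /eqP := (negligibleP mu (measurable_itv _)).1 N.
  rewrite [X in X == _]lebesgue_measure_itv/= lte_fin d1 -EFinB.
  by rewrite eqe subr_eq0 gt_eqF.
have t01 : 0 <= t <= 1 by rewrite (le_trans d0 (ltW td)) ltW.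
have mut1 : measurable_fun setT (fun w => u t w - u 1 w).
  by apply: measurable_funB => //; exact: mut.
apply/square_integrableP => //.
apply: (le_lt_trans (@mean_square_wsum2 _ _ _ P 2 2 (u 1) (u t)
   (fun w => u t w - u 1 w) _ _ _ _ _ _)) => //; first exact: mut.
- move=> w; rewrite -subr_ge0.
  rewrite (_ : _ - _ = (2 * u t w - u 1 w) ^+ 2) ?sqr_ge0//; ring.
rewrite -(fineK uty) -EFinM; apply: lte_add_pinfty; first exact: ltry.
apply: (@le_lt_trans _ _ (2%:E * 1%:E)%E); last by rewrite -EFinM ltry.
by apply: lee_wpmul2l => //; apply: hd; rewrite td.
Qed.

(** The order of the choices matters: the constant and [eps] come first, then [W], [delta] and [V],
    and only then [n] large enough for this [delta]. *)
Lemma ito_integral_cos_cvg (phi : nat -> R -> R) (L : R) (F : nat -> T -> R)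
    (Y : T -> R) (M lam theta : R) :
  (forall n, measurable_fun (`[0, 1] : set R) (phi n)) ->
  (forall n, exists M : R, forall t, 0 <= t <= 1 -> phi n t <= M) ->
  (forall n t, 0 <= t <= 1 -> 0 <= phi n t) -> 0 < L ->
  (\int[mu]_(t in `[0%R, 1%R]) ((phi n t) ^+ 2)%:E)%E @[n --> \oo] --> L%:E ->
  (forall delta : R, 0 <= delta -> delta < 1 ->
     sup [set phi n t | t in `[0, delta]] @[n --> \oo] --> (0 : R)) ->
  (forall n, is_ito_integral P FB B (fun t w => phi n t * u t w) (F n)) ->
  measurable_fun setT Y -> (forall w, `|Y w| <= M) ->
  \int[P]_w (Y w * cos (theta + lam * F n w)) @[n --> \oo] -->
  \int[P]_w (Y w * (cos theta * chi (lam * (Num.sqrt L * u 1 w)))).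
Proof.
move=> mphi phiM phi0 L0 phiL phi_sup Fito mY YM.
have Lu1 := square_integrable_end.
have iu1 := square_integrable_integrable Lu1.
have [K K0 chiK] := @chi_lipschitz R.
have intu0 : (0 <= \int[mu]_(t in `[0%R, 1%R]) mean_square P (u t))%E.
  by apply: integral_ge0 => t _; exact: mean_square_ge0.
pose A := fine (\int[mu]_(t in `[0%R, 1%R]) mean_square P (u t)).
have uA : (\int[mu]_(t in `[0%R, 1%R]) mean_square P (u t) <= A%:E)%E.
  by rewrite /A fineK// ge0_fin_numE.
have A0 : 0 <= A by exact: fine_ge0.
apply/cvgrPdist_le => e e0.
(* The constant of [ito_cos_dist]. It involves neither [n], [eps] and [delta] nor the substitutes
   [V] and [W], so [eps] may be fixed from it. *)
pose C : R := 2 + M * `|lam| * (Num.sqrt (4 * @normal_moment2 R * (A + 15 * (L + 1) + 3)) + 1) +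
   M * K * `|lam| * ((Num.sqrt L + 3 / Num.sqrt L) * 2 +
     3 / Num.sqrt L * \int[P]_w `|u 1 w|).
pose eps : R := Num.min 1 (e / (`|C| + 1)).
have eps0 : 0 < eps by rewrite lt_min ltr01 divr_gt0// ltr_wpDl.
have eps1 : eps <= 1 by rewrite ge_min lexx.
have Ceps : C * eps <= e.
  apply: (@le_trans _ _ ((`|C| + 1) * (e / (`|C| + 1)))).
    apply: (@le_trans _ _ ((`|C| + 1) * eps)).
      by rewrite ler_wpM2r ?(ltW eps0)// (le_trans (ler_norm _))// lerDl.
    by rewrite ler_wpM2l ?addr_ge0// ge_min lexx orbT.
  by rewrite mulrC divfK// gt_eqF// ltr_wpDl.
have eps20 : 0 < eps ^+ 2 by rewrite exprn_gt0.
have [delta1 [W [/andP[d10 d11] mW1 WM YW]]] := approx_fun_bounded hB hF mY YM eps0.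
have [delta2 /andP[d20 d21] hd2] := cvge0_left u_cont1 eps20.
(* The midpoint puts [delta] strictly between [delta2] and 1, since the L^2 bound holds only at
   times strictly after [delta2]; the maximum keeps [W] known at [delta]. *)
pose delta := Num.max delta1 ((delta2 + 1) / 2).
have d1d : delta1 <= delta by rewrite le_max lexx.
have d2d : delta2 < delta.
  by rewrite lt_max; apply/orP; right; rewrite (midf_lt d21).
have dlt1 : delta < 1 by rewrite gt_max d11/= (midf_lt d21).
have dge0 : 0 <= delta := le_trans d10 d1d.
have d01 : 0 <= delta <= 1 by rewrite dge0 ltW.
have mW : measurable_fun [set: g_sigma_algebraType (FB delta)] W.
  by apply: adaptedS mW1.
(* At this particular time, square integrability is deduced from [u 1] and the L^2 closeness, as the
   time integral yields it only almost everywhere. *)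
have ud1 : square_integrable P (fun w => u delta w - u 1 w).
  apply/square_integrableP; first by apply: measurable_funB => //; exact: mut.
  by apply: (le_lt_trans (hd2 _ _)); rewrite ?d2d// ltry.
have Lud : square_integrable P (u delta).
  have := square_integrableD ud1 Lu1; congr (square_integrable P _).
  by apply/funext => w; rewrite subrK.
have [KV KV0 hKV] := truncation_mean_square Lud eps20.
pose V w := clip KV (u delta w).
have mV : measurable_fun [set: g_sigma_algebraType (FB delta)] V.
  by apply: measurable_clip; exact: progressive_measurable_at.
have VK w : `|V w| <= KV by exact: normr_clip.
have mVT := adapted_measurable hB hF d01 mV.
have u1V : (mean_square P (fun w => u 1 w - V w)%R <= (4 * eps ^+ 2)%:E)%E.
  apply: (le_trans (@mean_square_wsum2 _ _ _ P 2 2 _ (fun w => u delta w - u 1 w)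
     (fun w => u delta w - V w) _ _ _ _ _ _)) => //.
  - exact: measurable_funB.
  - by case: ud1.
  - by apply: measurable_funB => //; exact: mut.
  - move=> w; rewrite -subr_ge0.
    rewrite (_ : _ - _ = (2 * u delta w - u 1 w - V w) ^+ 2) ?sqr_ge0//; ring.
  have -> : (4 * eps ^+ 2)%:E = (2%:E * (eps ^+ 2)%:E + 2%:E * (eps ^+ 2)%:E)%E.
    by rewrite -!EFinM -EFinD; congr EFin; ring.
  apply: leeD; apply: lee_wpmul2l => //.
  by apply: hd2; rewrite d2d.
have uu1 t : delta < t <= 1 ->
     (mean_square P (fun w => u t w - u 1 w)%R <= (eps ^+ 2)%:E)%E.
  move=> /andP[dt]; rewrite le_eqVlt => /orP[/eqP ->|t1].
    rewrite mean_squareE; under eq_integral do rewrite subrr expr0n/=.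
    by rewrite integral0 lee_fin ltW.
  by apply: hd2; rewrite (lt_trans d2d dt).
move: phiL => /fine_cvgP[_ /cvgrPdist_le/(_ _ eps0) phiL].
have /cvgrPdist_le/(_ _ eps0) phis := phi_sup _ dge0 dlt1.
near=> n.
have [Mphi hMphi] := phiM n.
have phieps t : 0 <= t <= delta -> phi n t <= eps.
  move=> td; apply: (@le_trans _ _ (sup [set phi n t | t in `[0, delta]])).
    apply: ub_le_sup; last by exists t.
    exists Mphi => _ [s /= + <-]; rewrite in_itv/= => /andP[s0 sd].
    by apply: hMphi; rewrite s0 (le_trans sd (ltW dlt1)).
  rewrite (le_trans (ler_norm _))// -normrN -sub0r.
  by near: n; exact: phis.
have phiLn : `|\int[mu]_(t in `[0, 1]) (phi n t ^+ 2) - L| <= eps.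
  by rewrite distrC; near: n; exact: phiL.
rewrite distrC; apply: le_trans Ceps.
apply: (@ito_cos_dist _ _ _ P B hB hF u (phi n) (F n) Y W V delta eps L A K M Mphi KV) => //.
- by rewrite dge0.
- by rewrite eps0.
- by move=> t t01; rewrite phi0//= hMphi.
Unshelve. all: by end_near. Qed.

End limit.

(** * From cosines with a phase to complex expectations *)

Lemma cvg_complex {R : realType} (x y : nat -> R) (a b : R) :
  x n @[n --> \oo] --> a -> y n @[n --> \oo] --> b ->
  ((x n +i* y n)%C : Cfield R) @[n --> \oo] --> ((a +i* b)%C : Cfield R).
Proof.
move=> /cvgrPdist_le xa /cvgrPdist_le yb; apply/cvgrPdist_le => -[e e'] e0.
(* The order on complex numbers compares only numbers with equal imaginary parts, so a positive
   radius is a real number. *)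
have e'0 : e' = 0.
  by move: e0; rewrite /Order.lt /= => /andP[/eqP].
have {}e0 : 0 < e by move: e0; rewrite /Order.lt /= => /andP[].
have e20 : 0 < e / 2 by rewrite divr_gt0.
have {}xa := xa _ e20; have {}yb := yb _ e20; near=> n.
have xn : `|a - x n| <= e / 2 by near: n; exact: xa.
have yn : `|b - y n| <= e / 2 by near: n; exact: yb.
rewrite e'0 -[leLHS]/(`|(a - x n) +i* (b - y n)|)%C normc_def lecR.
have -> : e = Num.sqrt (e ^+ 2) by rewrite sqrtr_sqr ger0_norm// ltW.
rewrite ler_wsqrtr//=.
have sq (c : R) : `|c| <= e / 2 -> c ^+ 2 <= (e / 2) ^+ 2.
  by move=> h; rewrite -real_normK ?num_real// lerXn2r ?nnegrE// ltW.
apply: (le_trans (lerD (sq _ xn) (sq _ yn))).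
rewrite -subr_ge0 (_ : _ - _ = 2 * (e / 2) ^+ 2); last by field.
by rewrite mulr_ge0// sqr_ge0.
Unshelve. all: by end_near. Qed.

Lemma complex_expectation_expi {R : realType} {d} {T : measurableType d}
    (P : probability T R) (Y X : T -> R) :
  complex_expectation P (fun w => (Y w)%:C%C * expi (X w)) =
  ((\int[P]_w (Y w * cos (0 + X w))) +i*
   (\int[P]_w (Y w * cos (- (pi / 2) + X w))))%C.
Proof.
rewrite /complex_expectation unlock /expi /Rintegral; congr (_ +i* _)%C; congr fine.
  by apply: eq_integral => w _ /=; rewrite mul0r subr0 add0r.
apply: eq_integral => w _ /=; rewrite mul0r addr0.
by rewrite addrC cosBpihalf.
Qed.

Theorem theorem3p1 (R : realType)
  (d : measure_display) (T : measurableType d) (P : probability T R)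
  (B : R -> T -> R)
  (hB : standard_brownian_motion P B)
  (hF : forall A : set T,
     measurable A <-> completion P (sigma_of_process B 1) A)
  (phi : nat -> R -> R)
  (phi_meas : forall n : nat, measurable_fun (`[0, 1] : set R) (phi n))
  (phi_bounded : forall n : nat, exists M : R, forall t : R,
     0 <= t <= 1 -> phi n t <= M)
  (phi_ge0 : forall (n : nat) (t : R), 0 <= t <= 1 -> 0 <= phi n t)
  (alpha : nat -> R) (L : R)
  (alpha01 : forall n, 0 <= alpha n <= 1)
  (alpha_nd : nondecreasing_seq alpha)
  (alpha_cvg : alpha n @[n --> \oo] --> (1 : R))
  (L_gt0 : 0 < L)
  (phi_tail : (\int[lebesgue_measure]_(t in `[alpha n, 1%R])
                 ((phi n t) ^+ 2)%:E)%E @[n --> \oo] --> L%:E)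
  (phi_total : (\int[lebesgue_measure]_(t in `[0%R, 1%R])
                 ((phi n t) ^+ 2)%:E)%E @[n --> \oo] --> L%:E)
  (phi_sup : forall delta : R, 0 <= delta -> delta < 1 ->
     sup [set phi n t | t in `[0, delta]] @[n --> \oo] --> (0 : R))
  (u : R -> T -> R)
  (u_prog : progressively_measurable (natural_filtration P B) u)
  (u_L2 : (\int[lebesgue_measure]_(t in `[0%R, 1%R])
             mean_square P (u t) < +oo)%E)
  (u_cont1 : mean_square P (fun w => u t w - u 1 w)
               @[t --> (1 : R)^'-] --> 0%E)
  (F : nat -> T -> R)
  (F_ito : forall n, is_ito_integral P (natural_filtration P B) B
             (fun t w => phi n t * u t w) (F n))
  (d' : measure_display) (T' : measurableType d') (P' : probability T' R)
  (p : T' -> T) (p_ext : extends_probability P P' p)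
  (Z : T' -> R) (Z_meas : measurable_fun setT Z)
  (Z_normal : has_law P' Z (normal_prob 0 1))
  (Z_indep : independent_of_sigma P' Z
               (sigma_of_process (fun t w => B t (p w)) 1)) :
  converges_stably P P' p F (fun w => Num.sqrt L * u 1 (p w) * Z w).
Proof.
move=> lambda Y mY [M YM].
have mV : measurable_fun setT (fun w => lambda * (Num.sqrt L * u 1 w)).
  have [mu1 _] := square_integrable_end hB hF u_prog u_L2 u_cont1.
  by apply: measurable_funM => //; exact: measurable_funM.
have lim theta :
    \int[P]_w (Y w * cos (theta + lambda * F n w)) @[n --> \oo] -->
    \int[P']_w (Y (p w) * cos (theta + lambda * (Num.sqrt L * u 1 (p w) * Z w))).
  have := ito_integral_cos_cvg hB hF u_prog u_L2 u_cont1 (lam := lambda) (theta := theta)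
    phi_meas phi_bounded phi_ge0 L_gt0 phi_total phi_sup F_ito mY YM.
  rewrite -(limit_cos hB hF p_ext Z_meas Z_normal Z_indep theta mY YM mV).
  by under eq_Rintegral do rewrite -mulrA.
under eq_fun do rewrite complex_expectation_expi.
rewrite complex_expectation_expi; apply: cvg_complex; exact: lim.
Qed.
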